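(* Let $(d_n)_{n\in\mathbb{N}}$ be a sequence of natural numbers with $d_n\to\infty$. Let $Z_i$, $i\in\mathbb{N}$, be i.i.d. random variables in $l^2$ with $\mathbb{E}[Z_1]=0$, $\mathbb{E}[\|Z_1\|^2]<\infty$ and $\Gamma:=\mathrm{Cov}[Z_1]$. Put $X_{ni}:=(Z_i^{(1)},\ldots,Z_i^{(d_n)})\in\mathbb{R}^{d_n}$ for $1\le i\le n$, $\overline{X}_n:=n^{-1}\sum_{i=1}^nX_{ni}$ and $V_n(d_n):=n\|\overline{X}_n\|_{d_n}^2$. Then $$\sup_{x\in\mathbb{R}}|\mathbb{P}(V_n(d_n)\le x)-F_\infty(x)|\to 0,\quad n\to\infty,$$ where $F_\infty$ is the distribution function of $V_\infty=\sum_{i=1}^\infty\lambda_iN_i^2$, $\lambda_1,\lambda_2,\ldots$ are the eigenvalues of $\Gamma$, and $N_i$, $i\in\mathbb{N}$, are i.i.d. standard normal random variables.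
   Context: $l^2$ is the Hilbert space of square-summable real sequences $x=(x^{(i)})_{i\in\mathbb{N}}$ with norm $\|\cdot\|$; $\|\cdot\|_d$ is the Euclidean norm on $\mathbb{R}^d$. $\mathrm{Cov}[Z_1]$ is the covariance operator of $Z_1$ on $l^2$, identified with the infinite matrix $\Gamma(k,l)=\mathbb{E}[Z_1^{(k)}Z_1^{(l)}]$, $k,l\in\mathbb{N}$ (for centered $Z_1$). Its eigenvalues are listed with multiplicity (padded by zeros if only finitely many are nonzero). *)

(* Defs.v *)
From HB Require Import structures.
From mathcomp Require Import all_boot all_order all_algebra.
From mathcomp Require Import all_classical all_reals all_analysis.
From mathcomp Require Import ring lra.

Set Implicit Arguments.
Unset Strict Implicit.
Unset Printing Implicit Defensive.

Import Order.TTheory GRing.Theory Num.Theory.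
Import numFieldNormedType.Exports.

Local Open Scope classical_set_scope.
Local Open Scope ring_scope.

(* Sequences are indexed from 0: coordinate k here is x^(k+1) in the usual
   one-based notation, and likewise for all families indexed by nat. *)

Definition square_summable (R : realType) : {pred nat -> R} :=
  [pred x : nat -> R | `[< cvgn (series (fun k => x k ^+ 2)) >]].
Arguments square_summable : clear implicits.

Section square_summable.
Variable R : realType.
Implicit Types x y : nat -> R.

Lemma square_summableP x :
  x \in square_summable R <-> cvgn (series (fun k => x k ^+ 2)).
Proof. by split => [/asboolP//|cx]; apply/asboolP. Qed.

Lemma cvg_series_sqr_dot x y : x \in square_summable R ->
  y \in square_summable R -> cvgn (series (fun k => x k * y k)).
Proof.
move=> /square_summableP cx /square_summableP cy.
apply: normed_cvg.
apply: (@series_le_cvg _ _ (fun k => x k ^+ 2 + y k ^+ 2)) => /=.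
- by move=> n; exact: normr_ge0.
- by move=> n; rewrite addr_ge0// sqr_ge0.
- move=> n; rewrite normrM -(@real_normK _ (x n)) ?num_real//.
  rewrite -(@real_normK _ (y n)) ?num_real//.
  have := normr_ge0 (x n); have := normr_ge0 (y n); nra.
- rewrite -[X in series X]/((fun k => x k ^+ 2) + (fun k => y k ^+ 2)).
  by rewrite seriesD; exact: is_cvgD.
Qed.

Lemma square_summable_submod_closed : submod_closed (square_summable R).
Proof.
split=> [|a x y sx sy]; apply/square_summableP.
  rewrite (_ : (fun _ => _) = (fun=> 0)); last first.
    by apply/funext => k; rewrite [LHS]expr0n.
  rewrite (_ : series _ = cst 0); first exact: is_cvg_cst.
  by apply/funext => n; rewrite /series/= big1.
have cxy := cvg_series_sqr_dot sx sy.
move/square_summableP in sx; move/square_summableP in sy.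
rewrite (_ : (fun _ => _) = a ^+ 2 *: (fun k => x k ^+ 2)
    + (2 * a) *: (fun k => x k * y k) + (fun k => y k ^+ 2)); last first.
  apply/funext => k /=.
  rewrite -[LHS]/((a * x k + y k) ^+ 2).
  rewrite -[RHS]/(a ^+ 2 * x k ^+ 2 + (2 * a) * (x k * y k) + y k ^+ 2).
  ring.
rewrite !(seriesD, seriesZ).
apply: is_cvgD => //.
by apply: is_cvgD; apply: is_cvgZl_tmp.
Qed.

HB.instance Definition _ := GRing.isSubmodClosed.Build R (nat -> R)
  (square_summable R) square_summable_submod_closed.

End square_summable.

Record l2 (R : realType) :=
  L2 { l2val :> nat -> R ; _ : l2val \in square_summable R }.

HB.instance Definition _ (R : realType) := [isSub for @l2val R].
HB.instance Definition _ (R : realType) := [Choice of l2 R by <:].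
HB.instance Definition _ (R : realType) :=
  [SubChoice_isSubLmodule of l2 R by <:].

Definition l2dot (R : realType) (x y : l2 R) : R :=
  limn (series (fun k => x k * y k)).

Definition l2norm (R : realType) (x : l2 R) : R := Num.sqrt (l2dot x x).

Section l2_norm.
Variable R : realType.
Implicit Types (x y z : l2 R) (a : R).

Lemma l2DE x y k : (x + y) k = x k + y k. Proof. by []. Qed.
Lemma l2ZE a x k : (a *: x) k = a * x k. Proof. by []. Qed.

Lemma is_cvg_l2dot x y : cvgn (series (fun k => x k * y k)).
Proof. by apply: cvg_series_sqr_dot; exact: valP. Qed.

Lemma l2dotC x y : l2dot x y = l2dot y x.
Proof.
by rewrite /l2dot; congr (limn (series _)); apply/funext => k; rewrite mulrC.
Qed.

Lemma l2dot_linearl a x y z :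
  l2dot (a *: x + y) z = a * l2dot x z + l2dot y z.
Proof.
rewrite /l2dot (_ : (fun _ => _) =
  a *: (fun k => x k * z k) + (fun k => y k * z k)); last first.
  apply/funext => k; rewrite l2DE l2ZE.
  by rewrite -[RHS]/(a * (x k * z k) + y k * z k) mulrDl mulrA.
rewrite seriesD seriesZ; apply/cvg_lim => //.
apply: cvgD; last exact: is_cvg_l2dot.
by apply: cvgZl_tmp; exact: is_cvg_l2dot.
Qed.

Lemma l2dotxx_ge x n : \sum_(0 <= k < n) x k ^+ 2 <= l2dot x x.
Proof.
rewrite -[leLHS]/(series (fun k => x k * x k) n).
apply: nondecreasing_cvgn_le; last exact: is_cvg_l2dot.
by apply: nondecreasing_series => k _ _; rewrite -expr2 sqr_ge0.
Qed.

Lemma l2dotxx_ge0 x : 0 <= l2dot x x.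
Proof. by apply: le_trans (l2dotxx_ge x 0); rewrite big_geq. Qed.

Lemma l2dotxx_eq0 x : l2dot x x = 0 -> x = 0.
Proof.
move=> x0; apply/val_inj/funext => k /=.
have := l2dotxx_ge x k.+1; rewrite x0 big_nat_recr//= => h.
have s0 : 0 <= \sum_(0 <= i < k) x i ^+ 2.
  by apply: sumr_ge0 => i _; exact: sqr_ge0.
apply/eqP; rewrite -[_ == _]sqrf_eq0 eq_le sqr_ge0 andbT.
by apply: le_trans h; rewrite lerDr.
Qed.

Lemma l2normK x : l2norm x ^+ 2 = l2dot x x.
Proof. by rewrite sqr_sqrtr// l2dotxx_ge0. Qed.

Lemma l2dot_le x y : l2dot x y <= l2norm x * l2norm y.
Proof.
have [->|y0] := eqVneq y 0.
  rewrite (_ : l2dot x 0 = 0) ?mulr_ge0 ?sqrtr_ge0//.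
  by rewrite l2dotC -[X in l2dot X](scale0r 0) -[_ *: _]addr0 l2dot_linearl
    mul0r add0r -[X in l2dot X](subrr 0) addrC -scaleN1r l2dot_linearl mulN1r
    addNr.
have yy : 0 < l2dot y y.
  rewrite lt_neqAle l2dotxx_ge0 andbT eq_sym.
  by apply: contra_neq y0; exact: l2dotxx_eq0.
have := l2dotxx_ge0 ((- (l2dot x y / l2dot y y)) *: y + x).
rewrite l2dot_linearl !(l2dotC _ (_ + _)) !l2dot_linearl (l2dotC y x).
set a := l2dot x y; set b := l2dot y y in yy *; set c := l2dot x x => h.
have {}h : a ^+ 2 <= c * b.
  rewrite -subr_ge0.
  have -> : c * b - a ^+ 2 = (- (a / b) * (- (a / b) * b + a)
      + (- (a / b) * a + c)) * b by field; rewrite gt_eqF.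
  by rewrite mulr_ge0// ltW.
rewrite /l2norm -sqrtrM ?l2dotxx_ge0//.
apply: le_trans (ler_norm _) _.
by rewrite -sqrtr_sqr ler_sqrt// (le_trans (sqr_ge0 a) h).
Qed.

Lemma l2norm_triangle x y : l2norm (x + y) <= l2norm x + l2norm y.
Proof.
rewrite -(@ler_pXn2r _ 2) ?nnegrE ?addr_ge0 ?sqrtr_ge0//.
have D (u v w : l2 R) : l2dot (u + v) w = l2dot u w + l2dot v w.
  by have := l2dot_linearl 1 u v w; rewrite scale1r mul1r.
rewrite l2normK sqrrD !l2normK D !(l2dotC _ (_ + _)) !D (l2dotC y x).
have := l2dot_le x y; lra.
Qed.

Lemma l2normZ a x : l2norm (a *: x) = `|a| * l2norm x.
Proof.
rewrite /l2norm (_ : l2dot (a *: x) (a *: x) = a ^+ 2 * l2dot x x).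
  by rewrite sqrtrM ?sqr_ge0// sqrtr_sqr.
rewrite /l2dot -[RHS]/(a ^+ 2 *: _).
rewrite (_ : (fun _ => _) = a ^+ 2 *: (fun k => x k * x k)); last first.
  by apply/funext => k; rewrite l2ZE -[RHS]/(a ^+ 2 * (x k * x k)); ring.
rewrite seriesZ; apply/cvg_lim => //.
by apply: cvgZl_tmp; exact: is_cvg_l2dot.
Qed.

Lemma l2norm_eq0 x : l2norm x = 0 -> x = 0.
Proof. by move=> x0; apply: l2dotxx_eq0; rewrite -l2normK x0 expr0n. Qed.

HB.instance Definition _ :=
  Lmodule_isNormed.Build R (l2 R) l2norm_triangle l2normZ l2norm_eq0.

End l2_norm.

(* Borel sigma-algebra of the norm topology *)
HB.instance Definition _ (R : realType) :=
  @isMeasurable.Build (sigma_display (@open (l2 R))) (l2 R)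
    <<s @open (l2 R) >> (@sigma_algebra0 _ setT open)
    (@sigma_algebraC _ open) (@sigma_algebra_bigcup _ setT open).

Definition mutually_independent d d' (T : measurableType d)
    (T' : measurableType d') (R : realType) (P : probability T R)
    (X : nat -> {RV P >-> T'}) : Prop :=
  forall (s : seq nat) (B : nat -> set T'),
    uniq s -> (forall i, measurable (B i)) ->
    P (\bigcap_(i in [set` s]) X i @^-1` B i) =
    (\prod_(i <- s) fine (P (X i @^-1` B i)))%:E.

Definition identically_distributed d d' (T : measurableType d)
    (T' : measurableType d') (R : realType) (P : probability T R)
    (X : nat -> {RV P >-> T'}) : Prop :=
  forall i (B : set T'), measurable B ->
    distribution P (X i) B = distribution P (X 0%N) B.

(* m is the expectation of X in the weak (Pettis) sense, which is the Bochner
   expectation whenever the norm of X is integrable. *)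
Definition is_expectation d (T : measurableType d) (R : realType)
    (P : probability T R) (X : T -> l2 R) (m : l2 R) : Prop :=
  forall h : l2 R, 'E_P[fun t => l2dot h (X t)]%E = (l2dot h m)%:E.

(* For centered X this is E[X_k X_l], the matrix of the covariance operator. *)
Definition cov_matrix d (T : measurableType d) (R : realType)
    (P : probability T R) (X : T -> l2 R) (k l : nat) : R :=
  fine (covariance P (fun t => X t k) (fun t => X t l)).

(* Kernel of G - r on l2, where the infinite matrix G acts by
   (G x)_k = \sum_l G k l * x_l. *)
Definition l2_eigenspace (R : realType) (G : nat -> nat -> R) (r : R) :
    set (l2 R) :=
  [set x | forall k, series (fun l => G k l * x l) @ \oo --> r * x k].

Definition has_dimension (R : realType) (V : lmodType R) (E : set V) (m : nat) :
    Prop :=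
  exists e : 'I_m -> V, (forall j, E (e j)) /\
    forall x, E x -> exists! c : 'rV[R]_m, x = \sum_(j < m) c 0 j *: e j.

(* lam lists the eigenvalues of G with multiplicity. Only nonzero eigenvalues
   are counted: zeros may occur in lam any number of times, whether as padding
   or as eigenvalues. *)
Definition lists_eigenvalues (R : realType) (G : nat -> nat -> R)
    (lam : nat -> R) : Prop :=
  forall r : R, r != 0 -> exists m : nat,
    has_dimension (l2_eigenspace G r) m /\ ([set i | lam i = r] #= `I_m)%card.

Definition std_normal d (T : measurableType d) (R : realType)
    (P : probability T R) (X : {RV P >-> R}) : Prop :=
  forall B : set R, measurable B -> distribution P X B = normal_prob 0 1 B.

(* The library norm on 'rV[R]_m is the sup norm. *)
Definition euclidean_norm (R : realType) (m : nat) (v : 'rV[R]_m) : R :=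
  Num.sqrt (\sum_(k < m) v 0 k ^+ 2).

Definition l2_trunc (R : realType) (m : nat) (x : l2 R) : 'rV[R]_m :=
  \row_(k < m) x k.

Definition truncated_mean (R : realType) (T : Type) (Z : nat -> T -> l2 R)
    (m n : nat) (t : T) : 'rV[R]_m :=
  n%:R^-1 *: \sum_(i < n) l2_trunc m (Z i t).

Definition V_stat (R : realType) (T : Type) (Z : nat -> T -> l2 R)
    (m n : nat) (t : T) : R :=
  n%:R * euclidean_norm (truncated_mean Z m n t) ^+ 2.

Definition V_infty (R : realType) (T : Type) (lam : nat -> R)
    (N : nat -> T -> R) (t : T) : \bar R :=
  (\sum_(0 <= i <oo) (lam i * N i t ^+ 2)%:E)%E.

(* Main.v *)
(* The Laplace transforms converge first. Averaging cos(sqrt(2s) <g, u>) over a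
   standard Gaussian vector g gives exp(-s |u|^2), so the Laplace transform of
   V_n, with the dimension frozen at m, is a Gaussian average of real parts of
   characteristic functions of one-dimensional normalized sums; by the scalar
   central limit theorem it tends to E exp(-s B(g, g)), where B is the covariance
   form on the first m coordinates. Replacing dim n by m costs at most
   s * E sum_(k >= m) (Z^(k))^2, uniformly in n.

   A maximizer of B on the unit ball orthogonal to the eigenvectors exists by
   weak sequential compactness and is again an eigenvector, hence
   B(v, v) = sum_j lam_j <v, e_j>^2. The duality
   E exp(-s |b g|^2) = E exp(-s |b^T g'|^2) turns E exp(-s B(g, g)) into the
   Laplace transform of sum_j lam_j N_j^2, up to the same tail.

   Laplace transforms at integers are the moments of exp(-V_n) in [0, 1], so by
   Bernstein polynomials E h(exp(-V_n)) converges for Lipschitz h. The law of the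
   limit has no atoms, because a single term lam_i N_i^2 with lam_i > 0 already
   spreads the mass, and a finite grid of ramp functions yields uniform
   convergence of the distribution functions. If all lam_i vanish, both V_n and
   V_infty are almost surely 0. *)

Require Import Defs.
From HB Require Import structures.
From mathcomp Require Import all_boot all_order all_algebra.
From mathcomp Require Import all_classical all_reals all_analysis.
From mathcomp Require Import measurable_realfun.
From mathcomp Require Import ring lra.

Set Implicit Arguments.
Unset Strict Implicit.
Unset Printing Implicit Defensive.

Import Order.TTheory GRing.Theory Num.Theory.
Import numFieldNormedType.Exports.

Local Open Scope classical_set_scope.
Local Open Scope ring_scope.

(** Once the auxiliary Gaussian vector is frozen, the scalar central limit theorem is applied to one
    projection [l2dot u (Z i)] at frequency one, so no multivariate or Hilbert-space limit theorem
    is involved. The variables [N i] serve twice, in the limit and as that auxiliary vector.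
    Characteristic functions are handled as real cosine and sine integrals.

    The eigenvalues are known only through dimensions of eigenspaces. Orthonormal eigenvectors are
    rebuilt from these, while [0 <= lam i] and the expansion of the form along the eigenvectors are
    proved.

    The limit variable is extended real. It enters only through the events that all partial sums
    stay below [x], and through the limit of [exp (- S p t)], which lies in [0, 1]. Hence the
    estimates concern partial sums and have constants independent of [p]. In particular the absence
    of atoms takes the quantitative form of a bound [C * sqrt (b - a)] for the mass of [[a, b]],
    which also yields a grid independent of [n] and [x]. *)

Local Notation itg mu f := (mu.-integrable [set: _] (EFin \o f)).

Lemma cvg_sumr (R : realType) (I : Type) (s : seq I) (p : pred I)
    (u : I -> nat -> R) (l : I -> R) :
  (forall i, p i -> u i n @[n --> \oo] --> l i) ->
  \sum_(i <- s | p i) u i n @[n --> \oo] --> \sum_(i <- s | p i) l i.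
Proof.
move=> ul; elim: s => [|i s ih].
  by rewrite big_nil; under eq_fun do rewrite big_nil; exact: cvg_cst.
rewrite big_cons; under eq_fun do rewrite big_cons.
by case: ifP => // pi; apply: cvgD => //; exact: ul.
Qed.

(** * Real-valued integrals and dominated convergence *)

Section real_integrals.
Context d (T : measurableType d) (R : realType).
Variable mu : {measure set T -> \bar R}.
Implicit Types f g : T -> R.

Lemma itg_measurable f : itg mu f -> measurable_fun [set: T] f.
Proof. by move=> /integrableP[/measurable_EFinP]. Qed.

Lemma itg_le f g : measurable_fun [set: T] f -> itg mu g ->
  (forall x, `|f x| <= g x) -> itg mu f.
Proof.
move=> mf ig fg; apply: (le_integrable measurableT _ _ ig).
  exact/measurable_EFinP.
by move=> x _ /=; rewrite lee_fin (le_trans (fg x))// ler_norm.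
Qed.

Lemma itg_norm f : itg mu f -> itg mu (fun x => `|f x|).
Proof. exact: integrable_norm. Qed.

Lemma itgD f g : itg mu f -> itg mu g -> itg mu (fun x => f x + g x).
Proof. by move=> fi gi; have := integrableD measurableT fi gi. Qed.

Lemma itgB f g : itg mu f -> itg mu g -> itg mu (fun x => f x - g x).
Proof. by move=> fi gi; have := integrableB measurableT fi gi. Qed.

Lemma itgZ c f : itg mu f -> itg mu (fun x => c * f x).
Proof. by move=> fi; have := integrableZl measurableT c fi. Qed.

Lemma itgN f : itg mu f -> itg mu (fun x => - f x).
Proof. by move=> fi; have := integrableN fi. Qed.

Lemma itg_sum (I : Type) (s : seq I) (p : pred I) (h : I -> T -> R) :
  (forall i, p i -> itg mu (h i)) -> itg mu (fun x => \sum_(i <- s | p i) h i x).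
Proof.
move=> hi; apply: (@eq_integrable _ _ _ mu _ measurableT
    (fun x => \sum_(i <- s | p i) (h i x)%:E)%E).
  by move=> x _ /=; rewrite sumEFin.
exact: integrable_sum.
Qed.

Lemma Rint_sum (I : Type) (s : seq I) (p : pred I) (h : I -> T -> R) :
  (forall i, p i -> itg mu (h i)) ->
  \int[mu]_x (\sum_(i <- s | p i) h i x) = \sum_(i <- s | p i) \int[mu]_x h i x.
Proof.
move=> hi; elim: s => [|i s ih].
  rewrite big_nil; under eq_Rintegral do rewrite big_nil.
  by rewrite Rintegral_cst// mul0r.
rewrite big_cons; under eq_Rintegral do rewrite big_cons.
case: ifP => pi //; rewrite RintegralD//; last exact: itg_sum.
- by rewrite ih.
- exact: hi.
Qed.

Lemma Rintegral_dct (f_ : nat -> T -> R) f g :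
  (forall n, measurable_fun [set: T] (f_ n)) -> itg mu g ->
  (forall n x, `|f_ n x| <= g x) -> (forall x, f_ n x @[n --> \oo] --> f x) ->
  itg mu f /\ \int[mu]_x f_ n x @[n --> \oo] --> \int[mu]_x f x.
Proof.
move=> mf ig fg ff.
have ff' x : (f_ n x)%:E @[n --> \oo] --> (f x)%:E by exact/cvg_EFin/ff/nearW.
have mf' : measurable_fun [set: T] (EFin \o f).
  apply: (@emeasurable_fun_cvg _ _ _ _ (fun n x => (f_ n x)%:E)) => [n|x _ //].
  exact/measurable_EFinP.
have [ fi _ cf] := @dominated_convergence _ _ _ mu _ measurableT
  (fun n x => (f_ n x)%:E) (EFin \o f) (EFin \o g)
  (fun n => (measurable_EFinP _ _).2 (mf n)) mf' (aeW _ (fun x _ => ff' x)) ig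
  (aeW _ (fun x n _ => fg n x)).
split => //; rewrite /Rintegral; apply: fine_cvg.
by rewrite fineK//; exact: integrable_fin_num.
Qed.

Lemma Rint_EFin f : itg mu f -> (\int[mu]_x (f x)%:E)%E = (\int[mu]_x f x)%:E.
Proof. by move=> fi; rewrite /Rintegral fineK//; exact: integrable_fin_num. Qed.

Lemma itg_ge0_lty f : measurable_fun [set: T] f -> (forall x, 0 <= f x) ->
  (\int[mu]_x (f x)%:E < +oo)%E -> itg mu f.
Proof.
move=> mf f0 fy; apply/integrableP; split; first exact/measurable_EFinP.
by under eq_integral do rewrite gee0_abs ?lee_fin//.
Qed.

End real_integrals.

Section probability_integrals.
Context d (T : measurableType d) (R : realType) (P : probability T R).
Implicit Types f g : T -> R.

Lemma itg_bounded f M : measurable_fun [set: T] f -> (forall x, `|f x| <= M) ->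
  itg P f.
Proof.
move=> mf fM; apply: (@itg_le _ _ _ P f (cst M)) => //.
exact: finite_measure_integrable_cst.
Qed.

Lemma itg_cst (c : R) : itg P (fun=> c).
Proof. exact: finite_measure_integrable_cst. Qed.

Lemma Rint_cst (c : R) : \int[P]_x c = c.
Proof. by rewrite Rintegral_cst//= probability_setT mulr1. Qed.

Lemma Rint_norm_bound f M : itg P f -> (forall x, `|f x| <= M) ->
  `|\int[P]_x f x| <= M.
Proof.
move=> fi fM; apply: le_trans (le_normr_Rintegral measurableT fi) _.
rewrite -[leRHS]Rint_cst; apply: le_Rintegral => //; first exact: itg_norm.
exact: itg_cst.
Qed.

Lemma itg_sqr_itg f : measurable_fun [set: T] f -> itg P (fun x => f x ^+ 2) ->
  itg P f.
Proof.
move=> mf f2; apply: (itg_le mf (itgD (itg_cst 1) f2)) => x.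
rewrite -(@real_normK _ (f x)) ?num_real//.
by have := normr_ge0 (f x); nra.
Qed.

End probability_integrals.

(** * Independence *)

Section measure_on_rectangles.
Context d1 d2 (T1 : measurableType d1) (T2 : measurableType d2) (R : realType).
Local Open Scope ereal_scope.

(** Rectangles form a pi-system that generates the product sigma-algebra and contains the whole
    space, so finiteness of [m] suffices. Neither measure is assumed to be a product:
    [independent_partial_sum] compares two joint laws. *)
Lemma rectangle_measure_unique
    (m m' : {measure set (T1 * T2) -> \bar R}) : m [set: _] < +oo ->
  (forall A B, measurable A -> measurable B -> m (A `*` B) = m' (A `*` B)) ->
  forall D, measurable D -> m D = m' D.
Proof.
move=> moo mm' D mD.
pose G : set (set (T1 * T2)) :=
  [set C | exists A, measurable A /\ exists B, measurable B /\ C = A `*` B].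
apply: (measure_unique G (fun=> setT)) => //.
- rewrite measurable_prod_measurableType //; congr (<<s _ >>).
  rewrite predeqE => E; split => [[A mA [B mB <-]]|[A [mA [B [mB ->]]]]].
    by exists A; split => //; exists B.
  by exists A => //; exists B.
- move=> _ _ [A [mA [B [mB ->]]]] [A' [mA' [B' [mB' ->]]]].
  rewrite -setXI; exists (A `&` A'); split; first exact: measurableI.
  by exists (B `&` B'); split => //; exact: measurableI.
- by move=> n; exists setT; split => //; exists setT; split => //; rewrite setXTT.
- by apply/seteqP; split => // x _; exists 0%N.
- by move=> A [A1 [mA1 [A2 [mA2 ->]]]]; exact: mm'.
Qed.

End measure_on_rectangles.

Section independent_pair.
Context d (T : measurableType d) (R : realType) (P : probability T R).
Context d1 d2 (T1 : measurableType d1) (T2 : measurableType d2).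
Local Open Scope ereal_scope.

Definition independent2 (U : T -> T1) (V : T -> T2) :=
  forall A B, measurable A -> measurable B ->
    P (U @^-1` A `&` V @^-1` B) = P (U @^-1` A) * P (V @^-1` B).

Variables (U : T -> T1) (V : T -> T2).
Hypotheses (mU : measurable_fun [set: T] U) (mV : measurable_fun [set: T] V).
Hypothesis UV : independent2 U V.

Let U' : {mfun T >-> T1} := HB.pack U (isMeasurableFun.Build _ _ _ _ _ mU).
Let V' : {mfun T >-> T2} := HB.pack V (isMeasurableFun.Build _ _ _ _ _ mV).
Let mW : measurable_fun [set: T] (fun t => (U t, V t)).
Proof. exact: measurable_fun_pair. Qed.
Let W' : {mfun T >-> (T1 * T2)%type} :=
  HB.pack (fun t => (U t, V t)) (isMeasurableFun.Build _ _ _ _ _ mW).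

Let lawE D : measurable D ->
  distribution P W' D = (distribution P U' \x distribution P V') D.
Proof.
move=> mD; apply/esym; apply: product_measure_unique => // A B mA mB.
Qed.

Lemma measurable_section_probability (D : set (T1 * T2)) : measurable D ->
  measurable_fun [set: T] (fun t => P [set t' | D (U t, V t')]).
Proof.
move=> mD.
have := measurableT_comp (measurable_fun_xsection (distribution P V') mD) mU.
congr (measurable_fun _ _); apply/funext => t /=.
rewrite /distribution /pushforward/=.
by congr (P _); apply/seteqP; split => t' /=; rewrite /xsection/= inE.
Qed.

Lemma independent2_law (D : set (T1 * T2)) : measurable D ->
  P [set t | D (U t, V t)] = \int[P]_t P [set t' | D (U t, V t')].
Proof.
move=> mD; rewrite [LHS](lawE mD) /product_measure1.
rewrite (@ge0_integral_distribution _ _ _ _ _ P U')//; last first.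
  exact: measurable_fun_xsection.
apply: eq_integral => t _ /=; rewrite /distribution /pushforward/=.
by congr (P _); apply/seteqP; split => t' /=; rewrite /xsection/= inE.
Qed.

(** The iterated integral of [|g| * |h|] under the product law factors into two finite integrals;
    this gives integrability of the product, after which Fubini gives the identity. *)
Lemma independent2_product (g : T1 -> R) (h : T2 -> R) :
  measurable_fun [set: T1] g -> measurable_fun [set: T2] h ->
  itg P (g \o U) -> itg P (h \o V) ->
  itg P (fun t => g (U t) * h (V t))%R /\
  (\int[P]_t (g (U t) * h (V t)) = \int[P]_t g (U t) * \int[P]_t h (V t))%R.
Proof.
move=> mg mh ig ih; pose f (z : T1 * T2) := (g z.1 * h z.2)%R.
have mf : measurable_fun [set: T1 * T2] f.
  by apply: measurable_funM; apply: measurableT_comp.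
have ig' : itg (distribution P U') g.
  by apply: integrable_pushforward => //; exact/measurable_EFinP.
have ih' : itg (distribution P V') h.
  by apply: integrable_pushforward => //; exact/measurable_EFinP.
have eqm (k : T1 * T2 -> \bar R) :
    \int[distribution P U' \x distribution P V']_z k z =
    \int[distribution P W']_z k z.
  by apply: eq_measure_integral => D mD _; exact/esym/lawE.
have inner (x : T1) : \int[distribution P V']_y (f (x, y))%:E =
    (g x * \int[P]_t h (V t))%R%:E.
  rewrite /f/=; under eq_integral do rewrite EFinM.
  rewrite integralZl//= integral_distribution//; last exact/measurable_EFinP.
  by rewrite Rint_EFin.
have fi : (distribution P U' \x distribution P V').-integrable setT (EFin \o f).
  apply/integrable12ltyP => /=; first exact/measurable_EFinP.
  under eq_integral.
    move=> x _; under eq_integral do rewrite /f/= normrM EFinM.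
    rewrite (integralZl measurableT); last exact: itg_norm.
    rewrite Rint_EFin; last exact: itg_norm.
    over.
  rewrite (integralZr measurableT); last exact: itg_norm.
  by rewrite Rint_EFin ?ltry//; exact: itg_norm.
have Wfi : itg P (f \o W').
  move/integrableP : fi => [_ fi].
  apply/integrableP; split; first by apply/measurable_EFinP; exact: measurableT_comp.
  rewrite eqm ge0_integral_distribution// in fi.
  by do 2 apply: measurableT_comp => //; exact/measurable_EFinP.
split => //.
have := integral12_prod_meas1 fi; rewrite eqm integral_distribution//;
  last exact/measurable_EFinP.
rewrite (eq_integral (fun x => (g x)%:E * (\int[P]_t h (V t))%R%:E)); last first.
  by move=> x _; rewrite -EFinM; exact: inner.
rewrite (integralZr measurableT)//.
rewrite integral_distribution//; last exact/measurable_EFinP.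
by rewrite Rint_EFin// (Rint_EFin Wfi) => -[].
Qed.

End independent_pair.

Section independent_sums.
Context d d' (T : measurableType d) (T' : measurableType d') (R : realType).
Variables (P : probability T R) (X : nat -> {RV P >-> T'}).
Hypothesis Xind : mutually_independent X.
Variable f : nat -> T' -> R.
Hypothesis mf : forall i, measurable_fun [set: T'] (f i).
Local Open Scope ereal_scope.

Lemma measurable_partial_sum s :
  measurable_fun [set: T] (fun t => \sum_(i <- s) f i (X i t))%R.
Proof.
by apply: measurable_sum => i; exact: measurableT_comp.
Qed.

(** Mutual independence speaks of finitely many events, not of sums. Keeping the events indexed by
    [r] next to the sum over [s] makes an induction on [s] possible: one index at a time passes from
    the events to the sum. *)
Lemma independent_partial_sum s r A B : uniq (s ++ r) -> measurable A ->
  (forall i, measurable (B i)) ->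
  P ((fun t => \sum_(i <- s) f i (X i t))%R @^-1` A `&`
     \bigcap_(i in [set` r]) X i @^-1` B i) =
  P ((fun t => \sum_(i <- s) f i (X i t))%R @^-1` A) *
  (\prod_(i <- r) fine (P (X i @^-1` B i)))%:E.
Proof.
elim: s r A B => [|i s ih] r A B.
  move=> /= ur mA mB; rewrite -Xind//.
  have [A0|A0] := pselect (A 0%R).
    rewrite (_ : _ @^-1` A = setT) ?setTI ?probability_setT ?mul1e//.
    by apply/seteqP; split => // t _; rewrite /= big_nil.
  rewrite (_ : _ @^-1` A = set0) ?set0I ?measure0 ?mul0e//.
  by apply/seteqP; split => // t; rewrite /= big_nil.
move=> /=/andP[isr usr] mA mB.
move: isr; rewrite mem_cat negb_or => /andP[is_ ir].
have mXB j (C : set T') : measurable C -> measurable (X j @^-1` C).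
  by move=> mC; rewrite -[X in measurable X]setTI; exact: measurable_funPT.
have mF : measurable (\bigcap_(i in [set` r]) X i @^-1` B i).
  by apply: fin_bigcap_measurable => // j _; exact: mXB.
set F := \bigcap_(_ in _) _ in mF *.
pose W t := (\sum_(i <- s) f i (X i t), X i t)%R.
have mW : measurable_fun [set: T] W.
  by apply: measurable_fun_pair => //; exact: measurable_partial_sum.
pose W' : {mfun T >-> (R * T')%type} := HB.pack W (isMeasurableFun.Build _ _ _ _ _ mW).
pose D := [set z : R * T' | A (f i z.2 + z.1)%R].
have mD : measurable D.
  have mg : measurable_fun [set: R * T'] (fun z => f i z.2 + z.1)%R.
    by apply: measurable_funD => //; exact: measurableT_comp.
  by rewrite -[X in measurable X]setTI; exact: mg.
pose c := (\prod_(i <- r) fine (P (X i @^-1` B i)))%R.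
have c0 : (0 <= c)%R by apply: prodr_ge0 => j _; exact: fine_ge0.
(* [m1] is the law of [W] restricted to the event [F], and [m2] is [c] times the law of [W]. The
   claim is their equality on [D], which is not a rectangle, but equality on rectangles is
   enough. *)
pose m1 := pushforward (mrestr P mF) W'.
pose m2 := mscale (NngNum c0) (distribution P W').
have DE : W @^-1` D = (fun t => \sum_(j <- i :: s) f j (X j t))%R @^-1` A.
  by apply/seteqP; split => t; rewrite /D /= big_cons.
suff : m1 D = m2 D.
  rewrite /m1 /m2 /mscale /pushforward /mrestr /= muleC.
  by rewrite -[distribution P W' D]/(P (W @^-1` D)) DE.
apply: rectangle_measure_unique => //.
  change (P (W @^-1` setT `&` F) < +oo); rewrite preimage_setT setTI.
  by apply: (@le_lt_trans _ _ 1%E); [exact: probability_le1|exact: ltry].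
move=> A1 B1 mA1 mB1.
set S := fun t => (\sum_(j <- s) f j (X j t))%R.
change (P (S @^-1` A1 `&` X i @^-1` B1 `&` F) =
  c%:E * P (S @^-1` A1 `&` X i @^-1` B1)).
have us : uniq (s ++ [:: i]).
  by rewrite cats1 rcons_uniq is_; move: usr; rewrite cat_uniq => /andP[].
have usir : uniq (s ++ i :: r).
  by rewrite -(perm_uniq (permEl (perm_catCA [:: i] s r)))/= mem_cat negb_or is_ ir.
(* On rectangles the induction hypothesis is used twice: with the single event of [i], and with the
   events of [i :: r], where [B'] is [B] with the set at [i] replaced by [B1]. *)
have := ih [:: i] A1 (fun=> B1) us mA1 (fun=> mB1).
rewrite bigcap_seq !big_seq1 -/S => ->.
pose B' j := if j == i then B1 else B j.
have mB' j : measurable (B' j) by rewrite /B'; case: ifP.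
have := ih (i :: r) A1 B' usir mA1 mB'.
rewrite bigcap_seq 2!big_cons -bigcap_seq {1 3}/B' eqxx.
rewrite (_ : \bigcap_(j in [set` r]) X j @^-1` B' j = F); last first.
  apply: eq_bigcapr => j jr; rewrite /B'; case: eqP => // ji.
  by move: ir; rewrite -ji => /negP.
rewrite setIA => ->.
rewrite (_ : \prod_(j <- r) fine (P (X j @^-1` B' j)) = c)%R.
  by rewrite EFinM muleA muleC.
apply: eq_big_seq => j jr; rewrite /B'; case: eqP => // ji.
by move: ir; rewrite -ji jr.
Qed.

Lemma independent2_partial_sum i s : uniq (i :: s) ->
  independent2 P (fun t => \sum_(j <- s) f j (X j t))%R (X i).
Proof.
move=> us A B mA mB; have us' : uniq (s ++ [:: i]) by rewrite cats1 rcons_uniq.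
have := independent_partial_sum us' mA (fun=> mB).
rewrite bigcap_seq !big_seq1 => ->.
by rewrite fineK// fin_num_measure// -[X in measurable X]setTI; exact: measurable_funPT.
Qed.

End independent_sums.

Section measurable_trigonometry.
Context d (T : measurableType d) (R : realType).
Implicit Type g : T -> R.

Lemma measurable_fun_cos g : measurable_fun [set: T] g ->
  measurable_fun [set: T] (fun x => cos (g x)).
Proof.
move=> mg; apply: measurableT_comp => //.
by apply: continuous_measurable_fun; exact: continuous_cos.
Qed.

Lemma measurable_fun_sin g : measurable_fun [set: T] g ->
  measurable_fun [set: T] (fun x => sin (g x)).
Proof.
move=> mg; apply: measurableT_comp => //.
by apply: continuous_measurable_fun; exact: continuous_sin.
Qed.

Variable P : probability T R.

Lemma itg_cos g : measurable_fun [set: T] g -> itg P (fun x => cos (g x)).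
Proof.
move=> mg; apply: (@itg_bounded _ _ _ P _ 1); first exact: measurable_fun_cos.
by move=> x; exact: cos_max.
Qed.

Lemma itg_sin g : measurable_fun [set: T] g -> itg P (fun x => sin (g x)).
Proof.
move=> mg; apply: (@itg_bounded _ _ _ P _ 1); first exact: measurable_fun_sin.
by move=> x; exact: sin_max.
Qed.

Lemma Rint_cos_le1 g : measurable_fun [set: T] g -> `|\int[P]_x cos (g x)| <= 1.
Proof.
by move=> mg; apply: Rint_norm_bound; [exact: itg_cos|move=> x; exact: cos_max].
Qed.

Lemma Rint_sin_le1 g : measurable_fun [set: T] g -> `|\int[P]_x sin (g x)| <= 1.
Proof.
by move=> mg; apply: Rint_norm_bound; [exact: itg_sin|move=> x; exact: sin_max].
Qed.

End measurable_trigonometry.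

Section moments_of_independent_sums.
Context d d' (T : measurableType d) (T' : measurableType d') (R : realType).
Variables (P : probability T R) (X : nat -> {RV P >-> T'}).
Hypothesis Xind : mutually_independent X.
Variable f : nat -> T' -> R.
Hypothesis mf : forall i, measurable_fun [set: T'] (f i).

Let S s t := \sum_(i <- s) f i (X i t).
Let mS s : measurable_fun [set: T] (S s). Proof. exact: measurable_partial_sum. Qed.
Let mfX i : measurable_fun [set: T] (fun t => f i (X i t)).
Proof. exact: measurableT_comp. Qed.

Let product_rule i s (g : R -> R) (h : R -> R) : uniq (i :: s) ->
  measurable_fun [set: R] g -> measurable_fun [set: R] h ->
  itg P (fun t => g (S s t)) -> itg P (fun t => h (f i (X i t))) ->
  itg P (fun t => g (S s t) * h (f i (X i t))) /\
  \int[P]_t (g (S s t) * h (f i (X i t))) =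
  \int[P]_t g (S s t) * \int[P]_t h (f i (X i t)).
Proof.
move=> us mg mh; have ind := independent2_partial_sum Xind mf us.
apply: (independent2_product (mS s) (@measurable_funPT _ _ _ _ (X i)) ind
  (h := h \o f i)) => //.
exact: measurableT_comp.
Qed.

Let mc : measurable_fun [set: R] cos := measurable_fun_cos (@measurable_id _ _ _).
Let ms : measurable_fun [set: R] sin := measurable_fun_sin (@measurable_id _ _ _).

Lemma Rint_cos_sum i s : uniq (i :: s) ->
  \int[P]_t cos (\sum_(j <- i :: s) f j (X j t)) =
  \int[P]_t cos (\sum_(j <- s) f j (X j t)) * \int[P]_t cos (f i (X i t)) -
  \int[P]_t sin (\sum_(j <- s) f j (X j t)) * \int[P]_t sin (f i (X i t)).
Proof.
move=> us.
have [icc ecc] := product_rule us mc mc (itg_cos P (mS s)) (itg_cos P (mfX i)).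
have [iss ess] := product_rule us ms ms (itg_sin P (mS s)) (itg_sin P (mfX i)).
rewrite -ecc -ess -RintegralB//; apply: eq_Rintegral => t _.
by rewrite big_cons cosD /S; ring.
Qed.

Lemma Rint_sin_sum i s : uniq (i :: s) ->
  \int[P]_t sin (\sum_(j <- i :: s) f j (X j t)) =
  \int[P]_t cos (\sum_(j <- s) f j (X j t)) * \int[P]_t sin (f i (X i t)) +
  \int[P]_t sin (\sum_(j <- s) f j (X j t)) * \int[P]_t cos (f i (X i t)).
Proof.
move=> us.
have [icc ecc] := product_rule us mc ms (itg_cos P (mS s)) (itg_sin P (mfX i)).
have [iss ess] := product_rule us ms mc (itg_sin P (mS s)) (itg_cos P (mfX i)).
rewrite -ecc -ess -RintegralD//; apply: eq_Rintegral => t _.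
by rewrite big_cons sinD /S; ring.
Qed.

(** Multiplicativity of characteristic functions when all of them are real. The addition formulas
    mix cosine and sine integrals, so the vanishing of the latter is carried through the
    induction. *)
Lemma Rint_cos_sum_symmetric (c : nat -> R) s : uniq s ->
  (forall i, \int[P]_t cos (f i (X i t)) = c i) ->
  (forall i, \int[P]_t sin (f i (X i t)) = 0) ->
  \int[P]_t cos (\sum_(i <- s) f i (X i t)) = \prod_(i <- s) c i.
Proof.
move=> + fc fs; suff : uniq s ->
    \int[P]_t cos (\sum_(i <- s) f i (X i t)) = \prod_(i <- s) c i /\
    \int[P]_t sin (\sum_(i <- s) f i (X i t)) = 0.
  by move=> h /h [].
elim: s => [_|i s ih us].
  under eq_Rintegral do rewrite big_nil cos0; rewrite Rint_cst big_nil.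
  by under eq_Rintegral do rewrite big_nil sin0; rewrite Rint_cst.
have [|ihc ihs] := ih; first by move: us => /= /andP[].
rewrite Rint_cos_sum// Rint_sin_sum// ihc ihs fc fs big_cons; split; ring.
Qed.

(** A real substitute for the power [(a + i b) ^ n] of a characteristic function: each summand adds
    at most [|b|] to the error, since all cosine and sine integrals are bounded by 1. In the central
    limit theorem [n * b] tends to 0. *)
Lemma Rint_cos_sum_iid (a b : R) s : uniq s ->
  (forall i, \int[P]_t cos (f i (X i t)) = a) ->
  (forall i, \int[P]_t sin (f i (X i t)) = b) ->
  `|\int[P]_t cos (\sum_(i <- s) f i (X i t)) - a ^+ size s| <=
  (size s)%:R * `|b|.
Proof.
move=> + fa fb.
have a1 : `|a| <= 1 by rewrite -(fa 0%N); exact: (Rint_cos_le1 P (mfX 0%N)).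
elim: s => [_|i s ih us].
  under eq_Rintegral do rewrite big_nil cos0; rewrite Rint_cst.
  by rewrite expr0 subrr normr0 mul0r.
have {}ih := ih (andP us).2; rewrite Rint_cos_sum// fa fb.
set C := (X in X * a - _) in ih *; set D := (X in _ - X * _).
have D1 : `|D| <= 1 by exact: (Rint_sin_le1 P (mS s)).
rewrite (_ : C * a - D * b - a ^+ size (i :: s) =
  (C - a ^+ size s) * a - D * b); last by rewrite /= exprS; ring.
apply: (le_trans (ler_normB _ _)); rewrite !normrM /= -natr1 mulrDl mul1r.
apply: lerD; last by rewrite ler_piMl.
by rewrite (le_trans _ ih)// ler_piMr.
Qed.

(** The cross terms factor by independence and vanish by centering. *)
Lemma Rint_sqr_sum s : uniq s ->
  (forall i, itg P (fun t => f i (X i t) ^+ 2)) ->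
  (forall i, \int[P]_t f i (X i t) = 0) ->
  itg P (fun t => (\sum_(i <- s) f i (X i t)) ^+ 2) /\
  \int[P]_t (\sum_(i <- s) f i (X i t)) ^+ 2 =
  \sum_(i <- s) \int[P]_t f i (X i t) ^+ 2.
Proof.
move=> + if2 f0; have fi i : itg P (fun t => f i (X i t)) by exact: itg_sqr_itg.
elim: s => [_|i s ih us].
  rewrite big_nil; split.
    by apply: (@itg_bounded _ _ _ P _ 0) => [|t]; [apply: measurable_funX; exact: mS|rewrite big_nil expr0n normr0].
  by under eq_Rintegral do rewrite big_nil expr0n; rewrite Rint_cst.
have [is2 es2] := ih (andP us).2.
have iS : itg P (S s) by exact: itg_sqr_itg.
have [ifS efS] := product_rule us (@measurable_id _ _ _) (@measurable_id _ _ _)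
  iS (fi i).
have eq2 t : (\sum_(j <- i :: s) f j (X j t)) ^+ 2 =
    f i (X i t) ^+ 2 + (2 * (S s t * f i (X i t)) + S s t ^+ 2).
  by rewrite big_cons -/(S s t); ring.
split.
  under [X in itg P X]eq_fun do rewrite eq2.
  by apply: itgD => //; apply: itgD => //; exact: itgZ.
under eq_Rintegral do rewrite eq2.
rewrite RintegralD//; last by apply: itgD => //; exact: itgZ.
rewrite RintegralD//; last exact: itgZ.
by rewrite RintegralZl// efS f0 mulr0 mulr0 add0r es2 big_cons.
Qed.

End moments_of_independent_sums.

(** * The standard normal law *)

Section standard_normal_density.
Context {R : realType}.
Local Notation mu := (@lebesgue_measure R).
Local Notation p := (normal_pdf (0:R) 1).

Lemma std_normal_pdfE x : p x = normal_peak 1 * expR (- (x ^+ 2 / 2)).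
Proof. by rewrite normal_pdfE ?oner_neq0// /normal_fun subr0 expr1n mulNr. Qed.

Global Instance is_derive_std_normal_pdf (x : R) : is_derive x 1 p (- x * p x).
Proof.
rewrite std_normal_pdfE (_ : p = normal_peak 1 *: (expR \o (fun y => - (y ^+ 2 / 2)))); last first.
  by apply/funext => y; rewrite std_normal_pdfE.
have h : is_derive x 1 (fun y : R => - (y ^+ 2 / 2)) (- x).
  rewrite (_ : (fun y : R => - (y ^+ 2 / 2)) = (- 2^-1) *: (fun y => y ^+ 2)); last first.
    by apply/funext => y; rewrite -[RHS]/(- 2^-1 * y ^+ 2); field.
  apply: is_derive_eq; rewrite /GRing.scale/=; by field.
have hc := @is_derive1_comp _ expR (fun y : R => - (y ^+ 2 / 2)) x _ _ (is_derive_expR _) h.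
by apply: is_derive_eq; rewrite /GRing.scale/=; ring.
Qed.

(** Since [|x| <= 1 + x^2/4 <= exp (x^2/4)], the integrand is at most a multiple of [exp (- x^2/4)],
    that is, of the normal density with variance 2. *)
Lemma itg_abs_std_normal_pdf : itg mu (fun x => `|x| * p x).
Proof.
have r2 : Num.sqrt 2 != 0 :> R by rewrite gt_eqF// sqrtr_gt0.
apply: (itg_le _ (itgZ (normal_peak 1 / normal_peak (Num.sqrt 2))
  (integrable_normal_pdf 0 (Num.sqrt 2 : R)))).
  apply: measurable_funM; last exact: measurable_normal_pdf.
  exact: normr_measurable.
move=> x /=; rewrite std_normal_pdfE normal_pdfE// /normal_fun subr0 sqr_sqrtr//.
rewrite [leRHS]mulrA divfK ?gt_eqF ?normal_peak_gt0// normrM normr_id.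
rewrite ger0_norm ?mulr_ge0 ?expR_ge0 ?normal_peak_ge0//.
rewrite mulrCA ler_wpM2l ?normal_peak_ge0//.
have -> : - x ^+ 2 / (2 *+ 2) = - (x ^+ 2 / 2) + x ^+ 2 / 4 :> R.
  by rewrite -mulr_natr; field.
rewrite expRD mulrC ler_wpM2l ?expR_ge0//.
apply: le_trans (expR_ge1Dx _).
by rewrite -(@real_normK _ x) ?num_real//; have := sqr_ge0 (`|x| - 2); nra.
Qed.

Let continuous_p : continuous p.
Proof. by apply: continuous_normal_pdf; exact: oner_neq0. Qed.

Let LR (F : R -> R) a b : (forall x, derivable F x 1) ->
  derivable_oo_LRcontinuous F a b.
Proof.
move=> dF; have cF : continuous F.
  by move=> x; exact/differentiable_continuous/derivable1_diffP.
split => [x _||]; first exact: dF.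
- exact/cvg_at_right_filter/cF.
- exact/cvg_at_left_filter/cF.
Qed.

(** Integration by parts against [p' = - x p] on growing symmetric segments. The boundary terms
    vanish because [F] is bounded and [p n] is at most a constant over [n]. *)
Lemma stein_identity (F f : R -> R) (M : R) :
  (forall x : R, is_derive x (1 : R) F (f x)) ->
  continuous f -> (forall x, `|F x| <= M) -> (forall x, `|f x| <= M) ->
  \int[mu]_x (F x * (x * p x)) = \int[mu]_x (f x * p x).
Proof.
move=> dF cf FM fM.
have dF' x : derivable F x 1 by [].
have cF : continuous F.
  by move=> x; exact/differentiable_continuous/derivable1_diffP.
have dp x : derivable p x 1 by [].
pose g x := - x * p x.
have cg : continuous g.
  by move=> x; apply: cvgM; [exact: cvgN|exact: continuous_p].
have p0 x : 0 <= p x := normal_pdf_ge0 0 1 x.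
have mc (h : R -> R) : continuous h -> measurable_fun setT h.
  exact: continuous_measurable_fun.
have iFg : itg mu (fun x => F x * g x).
  apply: (itg_le _ (itgZ M itg_abs_std_normal_pdf)).
    by apply: measurable_funM; exact: mc.
  move=> x; rewrite /g !normrM normrN (ger0_norm (p0 x)) ler_wpM2r//.
  by rewrite mulr_ge0.
have ifp : itg mu (fun x => f x * p x).
  apply: (itg_le _ (itgZ M (integrable_normal_pdf 0 1))).
    by apply: measurable_funM; exact: mc.
  by move=> x; rewrite normrM (ger0_norm (p0 x)) ler_wpM2r.
have restr_cvg (h : R -> R) : itg mu h ->
    \int[mu]_(x in `[- n%:R, n%:R]) h x @[n --> \oo] --> \int[mu]_x h x.
  move=> ih; under eq_fun do rewrite Rintegral_mkcond.
  apply: (Rintegral_dct _ (itg_norm ih) _ _).2.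
  - by move=> n; apply/measurable_restrict => //; rewrite setTI; apply: measurable_funTS; exact: itg_measurable ih.
  - by move=> n x; rewrite /patch; case: ifP => // _; rewrite normr0.
  - move=> x; apply: cvg_near_cst; near=> n.
    rewrite /patch ifT// inE/= in_itv/= -ler_norml.
    by near: n; exact: nbhs_infty_ger.
have ibp (n : nat) : \int[mu]_(x in `[- n.+1%:R, n.+1%:R]) (F x * g x) =
    (F n.+1%:R * p n.+1%:R - F (- n.+1%:R) * p (- n.+1%:R)) -
    \int[mu]_(x in `[- n.+1%:R, n.+1%:R]) (f x * p x).
  apply: Rintegration_by_parts; [| | | | | |].
  - by have := ltr0Sn R n; lra.
  - exact: continuous_subspaceT.
  - exact: LR.
  - by move=> x _; rewrite derive1E; exact: derive_val.
  - exact: continuous_subspaceT.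
  - exact: LR.
  - by move=> x _; rewrite derive1E; exact: derive_val.
have p_even x : p (- x) = p x by rewrite !std_normal_pdfE sqrrN.
have p_cvg0 : p n.+1%:R @[n --> \oo] --> (0 : R).
  apply: (@squeeze_cvgr _ _ _ _ (cst 0) (fun n => (normal_peak 1 * 2) * harmonic n)).
  - apply: nearW => n; rewrite p0/= std_normal_pdfE -mulrA ler_wpM2l ?normal_peak_ge0//.
    rewrite /harmonic/= expRN ler_pdivlMr ?ltr0Sn// mulrC.
    rewrite ler_pdivrMr ?expR_gt0//.
    have := expR_ge1Dx (n.+1%:R ^+ 2 / 2 : R).
    by have := ltr0Sn R n; have := sqr_ge0 (n.+1%:R - 1 : R); nra.
  - exact: cvg_cst.
  - rewrite -[0](mulr0 (normal_peak 1 * 2)); apply: cvgZl_tmp; exact: cvg_harmonic.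
have bd : F n.+1%:R * p n.+1%:R - F (- n.+1%:R) * p (- n.+1%:R)
    @[n --> \oo] --> (0 : R).
  apply: norm_cvg0.
  apply: (@squeeze_cvgr _ _ _ _ (cst 0) (fun n => 2 * M * p n.+1%:R)).
  - apply: nearW => n; rewrite normr_ge0/= p_even -mulrBl normrM (ger0_norm (p0 _)).
    rewrite ler_wpM2r// (le_trans (ler_normB _ _))//.
    by have := FM n.+1%:R; have := FM (- n.+1%:R); lra.
  - exact: cvg_cst.
  - by rewrite -[X in _ --> X](mulr0 (2 * M)); apply: cvgZl_tmp.
have lim1 : \int[mu]_(x in `[- n.+1%:R, n.+1%:R]) (F x * g x) @[n --> \oo]
    --> \int[mu]_x (F x * g x).
  by have := restr_cvg _ iFg; rewrite -(cvg_shiftS _).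
have lim2 : \int[mu]_(x in `[- n.+1%:R, n.+1%:R]) (F x * g x) @[n --> \oo]
    --> 0 - \int[mu]_x (f x * p x).
  under eq_fun do rewrite ibp; apply: cvgB => //.
  by have := restr_cvg _ ifp; rewrite -(cvg_shiftS _).
have := cvg_unique (@norm_hausdorff _ _) lim1 lim2; rewrite sub0r => e.
have e2 : -1 * \int[mu]_x (F x * (x * p x)) = \int[mu]_x (F x * g x).
  rewrite -RintegralZl//; first by apply: eq_Rintegral => x _; rewrite /g; ring.
  by apply: eq_integrable (itgN iFg) => // x _; congr EFin; rewrite /g /=; ring.
by move: e2; rewrite e mulN1r => /oppr_inj.
Unshelve. all: end_near. Qed.

End standard_normal_density.

Section normal_characteristic_function.
Context {R : realType}.
Local Notation mu := (@lebesgue_measure R).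
Local Notation p := (normal_pdf (0:R) 1).

(* By Stein's identity the integral [phi t] satisfies [phi' t = - t * phi t]; the
   cases of interest are [h = cos] and [h = sin]. *)
Lemma Rint_normal_oscillation (h h' : R -> R) (t : R) :
  (forall x : R, is_derive x (1 : R) h (h' x)) ->
  (forall x : R, is_derive x (1 : R) h' (- h x)) ->
  (forall x, `|h x| <= 1) -> (forall x, `|h' x| <= 1) ->
  \int[mu]_x (h (t * x) * p x) = h 0 * expR (- (t ^+ 2 / 2)).
Proof.
move=> dh dh' h1 h'1.
have ch : continuous h.
  by move=> x; apply/differentiable_continuous/derivable1_diffP.
have ch' : continuous h'.
  by move=> x; apply/differentiable_continuous/derivable1_diffP.
have cmul (s : R) : continuous ( *%R s) by move=> x; exact: mulrl_continuous.
have dmul (s x : R) : is_derive x (1 : R) ( *%R s) s.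
  rewrite (_ : *%R s = s *: id)//; apply: is_derive_eq.
  by rewrite /GRing.scale/= mulr1.
have dhM (s x : R) : is_derive x (1 : R) (fun y => h (s * y)) (h' (s * x) * s).
  exact: (@is_derive1_comp _ h ( *%R s) x _ _ (dh _) (dmul s x)).
have dhM' (s x : R) : is_derive x (1 : R) (fun y => h' (s * y)) (- h (s * x) * s).
  exact: (@is_derive1_comp _ h' ( *%R s) x _ _ (dh' _) (dmul s x)).
have p0 x : 0 <= p x := normal_pdf_ge0 0 1 x.
pose F s := \int[mu]_x (h (s * x) * p x).
pose f s x := h (s * x) * p x.
have mfs s : measurable_fun [set: R] (f s).
  apply: measurable_funM; last exact: measurable_normal_pdf.
  apply: continuous_measurable_fun => x; apply: continuous_comp; [exact: cmul|exact: ch].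
have ifs s : itg mu (f s).
  apply: (@itg_le _ _ _ mu (f s) p (mfs s) (integrable_normal_pdf 0 1)) => x.
  by rewrite normrM (ger0_norm (p0 x)) ler_piMl.
have dfs s x : is_derive s (1 : R) (f ^~ x) (h' (s * x) * x * p x).
  rewrite (_ : f ^~ x = p x *: (fun y => h (x * y))); last first.
    by apply/funext => y; rewrite /f mulrC (mulrC y).
  by apply: is_derive_eq; rewrite /GRing.scale/= (mulrC x); ring.
have p1 s x : partial1of2 f s x = h' (s * x) * x * p x.
  by rewrite partial1of2E; exact: derive_val.
have G1 s x : `|partial1of2 f s x| <= `|x| * p x.
  rewrite p1 !normrM (ger0_norm (p0 x)) ler_wpM2r//.
  by rewrite ler_piMl.
have G0 x : 0 <= `|x| * p x by rewrite mulr_ge0.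
have dF s : is_derive s (1 : R) F (- s * F s).
  have Is : `]s - 1, s + 1[%classic s by rewrite /= in_itv/=; apply/andP; split; lra.
  apply: DeriveDef.
    apply: (derivable_under_integral measurableT Is (fun s _ => ifs s) _ G0
      itg_abs_std_normal_pdf (fun s x _ _ => G1 s x)).
    by move=> r x _ _.
  have := differentiation_under_integral measurableT Is (fun s _ => ifs s)
    (fun s x _ _ => @ex_derive _ _ _ _ _ _ _ (dfs s x)) G0
      itg_abs_std_normal_pdf (fun s x _ _ => G1 s x).
  rewrite -derive1E => ->.
  under eq_Rintegral do rewrite p1 -mulrA.
  rewrite (@stein_identity _ (fun x => h' (s * x)) (fun x => - h (s * x) * s) (1 + `|s|)).
  - rewrite /F -RintegralZl//; last exact: ifs.
    by apply: eq_Rintegral => x _; ring.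
  - move=> x; apply: cvgM; last exact: cvg_cst.
    by apply: cvgN; apply: continuous_comp; [exact: cmul|exact: ch].
  - by move=> x; rewrite (le_trans (h'1 _))// lerDl.
  - by move=> x; rewrite normrM normrN (@le_trans _ _ `|s|)// ?ler_piMl// lerDr.
(* The integrating factor of the equation [F' = - s F]: the product [F * e] has derivative zero,
   hence is constant. *)
pose e (s : R) := expR (s ^+ 2 / 2).
have de (s : R) : is_derive s (1 : R) e (s * e s).
  have hs : is_derive s (1 : R) (fun y : R => y ^+ 2 / 2) s.
    rewrite (_ : (fun y : R => y ^+ 2 / 2) = 2^-1 *: (fun y => y ^+ 2)).
      by apply: is_derive_eq; rewrite /GRing.scale/=; by field.
    by apply/funext => y; rewrite mulrC.
  have hc := @is_derive1_comp _ expR (fun y : R => y ^+ 2 / 2) s _ _ (is_derive_expR _) hs.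
  by rewrite mulrC.
have dFe (s : R) : is_derive s (1 : R) (F * e) 0.
  apply: is_derive_eq; rewrite /GRing.scale/=; ring.
have := is_derive_0_is_cst t 0 dFe.
rewrite -[LHS]/(F t * e t) -[RHS]/(F 0 * e 0) {2}/e expr0n mul0r expR0 mulr1.
have -> : F 0 = h 0.
  rewrite /F; under eq_Rintegral do rewrite mul0r.
  rewrite RintegralZl//; last exact: integrable_normal_pdf.
  by rewrite /Rintegral integral_normal_pdf mulr1.
by move=> <-; rewrite expRN mulfK// gt_eqF// expR_gt0.
Qed.

Lemma Rint_cos_normal (t : R) :
  \int[mu]_x (cos (t * x) * p x) = expR (- (t ^+ 2 / 2)).
Proof.
rewrite (@Rint_normal_oscillation cos (fun x => - sin x)) ?cos0 ?mul1r//.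
- by move=> x; exact: cos_max.
- by move=> x; rewrite normrN; exact: sin_max.
Qed.

Lemma Rint_sin_normal (t : R) : \int[mu]_x (sin (t * x) * p x) = 0.
Proof.
rewrite (@Rint_normal_oscillation sin cos) ?sin0 ?mul0r//.
- by move=> x; exact: sin_max.
- by move=> x; exact: cos_max.
Qed.

End normal_characteristic_function.

Section std_normal_variable.
Context d (T : measurableType d) (R : realType) (P : probability T R).
Local Notation mu := (@lebesgue_measure R).

(** The Radon-Nikodym derivative of the normal law agrees almost everywhere with the density,
    because both have the same integral over every measurable set. *)
Lemma integral_normal_prob (g : R -> \bar R) :
  (normal_prob 0 1).-integrable [set: R] g ->
  (\int[normal_prob 0 1]_x g x = \int[mu]_x (g x * (normal_pdf 0 1 x)%:E))%E.
Proof.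
move=> ig; have dom := @normal_prob_dominates R 0 1.
have mg := measurable_int _ ig.
rewrite -(Radon_Nikodym_change_of_variables dom)//=.
apply: ae_eq_integral => //.
- by apply: emeasurable_funM.
- apply: emeasurable_funM => //; apply/measurable_EFinP; exact: measurable_normal_pdf.
- apply: ae_eqe_mul2l => /=.
  rewrite Radon_NikodymE//=.
  case: cid => /= h [h1 h2 h3].
  apply: integral_ae_eq => //=.
    by apply/measurable_EFinP; exact: measurable_normal_pdf.
  by move=> E _ mE; rewrite -h3.
Qed.

Variable X : {RV P >-> R}.
Hypothesis X_normal : std_normal X.

Lemma Rint_std_normal (g : R -> R) M : measurable_fun [set: R] g ->
  (forall x, `|g x| <= M) ->
  \int[P]_t g (X t) = \int[mu]_x (g x * normal_pdf 0 1 x).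
Proof.
move=> mg gM; have ig := itg_bounded (normal_prob 0 1) mg gM.
rewrite /Rintegral; congr fine; under [RHS]eq_integral do rewrite EFinM.
rewrite -(integral_normal_prob ig).
have mX : measurable_fun [set: T] (X : T -> measurableTypeR R).
  exact: (@measurable_funPT _ _ _ _ X).
pose X' : {mfun T >-> measurableTypeR R} :=
  HB.pack (X : T -> measurableTypeR R) (isMeasurableFun.Build _ _ _ _ _ mX).
have h A : measurable A -> A `<=` [set: measurableTypeR R] ->
    distribution P X' A = normal_prob 0 1 A.
  by move=> mA _; exact: X_normal.
rewrite -(@eq_measure_integral _ _ R setT _ (distribution P X') _ h).
rewrite integral_distribution//; first exact/measurable_EFinP.
apply: (@itg_bounded _ _ _ P (g \o X) M) => [|x]; last exact: gM.
exact: (measurableT_comp mg (measurable_funPT X)).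
Qed.

Lemma std_normal_cos a : \int[P]_t cos (a * X t) = expR (- (a ^+ 2 / 2)).
Proof.
rewrite (@Rint_std_normal (fun x => cos (a * x)) 1) ?Rint_cos_normal//.
  by apply: measurable_fun_cos; exact: measurable_funM.
by move=> x; exact: cos_max.
Qed.

Lemma std_normal_sin a : \int[P]_t sin (a * X t) = 0.
Proof.
rewrite (@Rint_std_normal (fun x => sin (a * x)) 1) ?Rint_sin_normal//.
  by apply: measurable_fun_sin; exact: measurable_funM.
by move=> x; exact: sin_max.
Qed.

End std_normal_variable.

(** * The Hilbert space l2 *)

Section l2_geometry.
Context {R : realType}.
Implicit Types x y z : l2 R.

Lemma l2dotDl x y z : l2dot (x + y) z = l2dot x z + l2dot y z.
Proof. by have := l2dot_linearl 1 x y z; rewrite scale1r mul1r. Qed.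

Lemma l2dot0l x : l2dot 0 x = 0.
Proof. by apply: (addrI (l2dot 0 x)); rewrite -l2dotDl !addr0. Qed.

Lemma l2dotZl a x y : l2dot (a *: x) y = a * l2dot x y.
Proof. by have := l2dot_linearl a x 0 y; rewrite addr0 l2dot0l addr0. Qed.

Lemma l2dotNl x y : l2dot (- x) y = - l2dot x y.
Proof. by rewrite -scaleN1r l2dotZl mulN1r. Qed.

Lemma l2dotBl x y z : l2dot (x - y) z = l2dot x z - l2dot y z.
Proof. by rewrite l2dotDl l2dotNl. Qed.

Lemma l2dot_suml (I : Type) (s : seq I) (p : pred I) (f : I -> l2 R) y :
  l2dot (\sum_(i <- s | p i) f i) y = \sum_(i <- s | p i) l2dot (f i) y.
Proof.
by apply: (big_morph (fun x => l2dot x y)) => [u v|]; rewrite ?l2dotDl ?l2dot0l.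
Qed.

Lemma l2dotDr x y z : l2dot z (x + y) = l2dot z x + l2dot z y.
Proof. by rewrite l2dotC l2dotDl !(l2dotC z). Qed.

Lemma l2dotZr a x y : l2dot x (a *: y) = a * l2dot x y.
Proof. by rewrite l2dotC l2dotZl l2dotC. Qed.

Lemma l2dotNr x y : l2dot x (- y) = - l2dot x y.
Proof. by rewrite l2dotC l2dotNl l2dotC. Qed.

Lemma l2dotBr x y z : l2dot z (x - y) = l2dot z x - l2dot z y.
Proof. by rewrite l2dotDr l2dotNr. Qed.

Lemma l2dot0r x : l2dot x 0 = 0.
Proof. by rewrite l2dotC l2dot0l. Qed.

Lemma l2dot_sumr (I : Type) (s : seq I) (p : pred I) (f : I -> l2 R) y :
  l2dot y (\sum_(i <- s | p i) f i) = \sum_(i <- s | p i) l2dot y (f i).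
Proof. by rewrite l2dotC l2dot_suml; under eq_bigr do rewrite l2dotC. Qed.

Lemma l2_sqr_norm x : `|x| ^+ 2 = l2dot x x.
Proof. exact: l2normK. Qed.

Lemma l2dot_abs_le x y : `|l2dot x y| <= `|x| * `|y|.
Proof.
rewrite ler_norml lerNl -l2dotNl; apply/andP; split; last exact: l2dot_le.
by rewrite -(normrN x); exact: l2dot_le.
Qed.

Lemma l2_sumE (I : Type) (s : seq I) (p : pred I) (f : I -> l2 R) k :
  (\sum_(i <- s | p i) f i) k = \sum_(i <- s | p i) f i k.
Proof. exact: (big_morph (fun x : l2 R => x k)). Qed.

Section finite_support.
Variables (m : nat) (v : nat -> R).

Let seq_supp_cvg (u : nat -> R) :
  series (fun k => if (k < m)%N then u k else 0) n @[n --> \oo] -->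
  \sum_(0 <= k < m) u k.
Proof.
apply: cvg_near_cst; near=> n.
have mn : (m <= n)%N by near: n; exact: nbhs_infty_ge.
rewrite /series/= (big_cat_nat _ mn)//= [X in _ + X]big_nat_cond.
rewrite [X in _ + X]big1 ?addr0.
  by apply: eq_big_nat => k /andP[_ ->].
by move=> k /andP[/andP[mk _] _]; rewrite ltnNge mk.
Unshelve. all: end_near. Qed.

Lemma l2_fin_subproof :
  (fun k => if (k < m)%N then v k else 0) \in square_summable R.
Proof.
apply/square_summableP.
rewrite (_ : (fun k => _) = (fun k => if (k < m)%N then v k ^+ 2 else 0)).
  by apply/cvg_ex; exists (\sum_(0 <= k < m) v k ^+ 2); exact: seq_supp_cvg.
by apply/funext => k; case: ifP => //; rewrite expr0n.
Qed.

(** The sequence [v] need not be square-summable. This covers both the truncations of an element of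
    l2 and the Gaussian vectors [(N 0 t, ..., N (m - 1) t)]. *)
Definition l2_fin : l2 R := L2 l2_fin_subproof.

Lemma l2_finE k : l2_fin k = if (k < m)%N then v k else 0.
Proof. by []. Qed.

Lemma l2dot_finl y : l2dot l2_fin y = \sum_(0 <= k < m) v k * y k.
Proof.
rewrite /l2dot (_ : (fun k => _) = (fun k => if (k < m)%N then v k * y k else 0)).
  exact/cvg_lim/seq_supp_cvg.
by apply/funext => k; rewrite l2_finE; case: ifP => //; rewrite mul0r.
Qed.

End finite_support.

Definition l2_delta k := l2_fin k.+1 (fun i => (i == k)%:R : R).

Lemma l2dot_delta k y : l2dot (l2_delta k) y = y k.
Proof.
rewrite l2dot_finl big_nat_recr//= eqxx mul1r big_nat_cond big1 ?add0r//.
by move=> i /andP[/andP[_ ik] _]; rewrite ltn_eqF// mul0r.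
Qed.

Lemma l2_sqr_norm_fin m (v : nat -> R) :
  `|l2_fin m v| ^+ 2 = \sum_(0 <= k < m) v k ^+ 2.
Proof.
rewrite l2_sqr_norm l2dot_finl; apply: eq_big_nat => k /andP[_ km].
by rewrite l2_finE km expr2.
Qed.

Lemma cvg_l2_sqr_norm x :
  \sum_(0 <= k < n) x k ^+ 2 @[n --> \oo] --> `|x| ^+ 2.
Proof. by rewrite l2_sqr_norm; exact: is_cvg_l2dot. Qed.

Lemma cvg_l2dot x y : \sum_(0 <= k < n) x k * y k @[n --> \oo] --> l2dot x y.
Proof. exact: is_cvg_l2dot. Qed.

Lemma l2_fin_approx x : `|x - l2_fin n x| @[n --> \oo] --> (0 : R).
Proof.
have h n : `|x - l2_fin n x| ^+ 2 = `|x| ^+ 2 - \sum_(0 <= k < n) x k ^+ 2.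
  have e : l2dot (l2_fin n x) x = \sum_(0 <= k < n) x k ^+ 2.
    by rewrite l2dot_finl; apply: eq_bigr => k _; rewrite expr2.
  rewrite l2_sqr_norm l2dotBl !l2dotBr -!l2_sqr_norm l2_sqr_norm_fin.
  by rewrite (l2dotC x) e; ring.
rewrite (_ : (fun n => _) = (fun n => Num.sqrt (`|x - l2_fin n x| ^+ 2))); last first.
  by apply/funext => n; rewrite sqrtr_sqr normr_id.
rewrite -[X in _ --> X]sqrtr0; apply: continuous_cvg; first exact: sqrt_continuous.
under eq_fun do rewrite h.
suff : `|x| ^+ 2 - \sum_(0 <= k < n) x k ^+ 2 @[n --> \oo] -->
    `|x| ^+ 2 - `|x| ^+ 2 by rewrite subrr.
by apply: cvgB; [exact: cvg_cst|exact: cvg_l2_sqr_norm].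
Qed.

Lemma l2_bounded_sums (u : nat -> R) C :
  (forall m, \sum_(0 <= k < m) u k ^+ 2 <= C) -> u \in square_summable R.
Proof.
move=> uC; apply/square_summableP; apply: nondecreasing_is_cvgn.
  by apply: nondecreasing_series => k _ _; exact: sqr_ge0.
by exists C => _ [m _ <-]; exact: uC.
Qed.

Lemma l2_norm_le x C : 0 <= C ->
  (forall m, \sum_(0 <= k < m) x k ^+ 2 <= C ^+ 2) -> `|x| <= C.
Proof.
move=> C0 xC; rewrite -(@ler_pXn2r _ 2) ?nnegrE//.
have <- : limn (fun m => \sum_(0 <= k < m) x k ^+ 2) = `|x| ^+ 2.
  by apply/cvg_lim => //; exact: cvg_l2_sqr_norm.
apply: limr_le; first by apply/cvg_ex; exists (`|x| ^+ 2); exact: cvg_l2_sqr_norm.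
exact: nearW.
Qed.

Lemma l2_partial_norm_le x m : \sum_(0 <= k < m) x k ^+ 2 <= `|x| ^+ 2.
Proof. by rewrite l2_sqr_norm; exact: l2dotxx_ge. Qed.

(** Finitely supported vectors are dense, and against such a vector coordinatewise convergence
    suffices. The norm bound controls the remainder uniformly in [n]; the summand 1 in [D] only
    keeps the divisor positive. *)
Lemma weak_cvg_l2dot (x_ : nat -> l2 R) x C y : (forall n, `|x_ n| <= C) ->
  (forall k, x_ n k @[n --> \oo] --> x k) -> l2dot (x_ n) y @[n --> \oo] --> l2dot x y.
Proof.
move=> xC xk; apply/cvgrPdist_le => eps eps0.
have C0 : 0 <= C by apply: le_trans (xC 0%N).
pose D := `|x| + C + 1.
have D0 : 0 < D by rewrite ltr_wpDl// addr_ge0.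
have [m _ ym] : \forall m \near \oo, `|y - l2_fin m y| <= eps / 2 / D.
  have /cvgrPdist_le/(_ (eps / 2 / D)) := l2_fin_approx y.
  move=> /(_ _)[|m _ h]; first by rewrite !divr_gt0.
  by exists m => // n /h; rewrite sub0r normrN normr_id.
have := ym m (leqnn m) => {}ym.
have fcvg : l2dot (x_ n) (l2_fin m y) @[n --> \oo] --> l2dot x (l2_fin m y).
  rewrite l2dotC l2dot_finl; under eq_fun do rewrite l2dotC l2dot_finl.
  by apply: cvg_sumr => k _; apply: cvgM; [exact: cvg_cst|exact: xk].
have e2 : 0 < eps / 2 by rewrite divr_gt0.
have /cvgrPdist_le/(_ _ e2) := fcvg; apply: filterS => n xn.
rewrite (_ : l2dot x y - l2dot (x_ n) y =
  (l2dot x (l2_fin m y) - l2dot (x_ n) (l2_fin m y)) +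
   l2dot (x - x_ n) (y - l2_fin m y)); last by rewrite !l2dotBl !l2dotBr; ring.
rewrite (le_trans (ler_normD _ _))// (splitr eps) lerD//.
rewrite (le_trans (l2dot_abs_le _ _))// -(divfK (lt0r_neq0 D0) (eps / 2)) mulrC.
apply: ler_pM => //; rewrite (le_trans (ler_normB _ _))//.
by rewrite /D; have := xC n; lra.
Qed.

End l2_geometry.

Section weak_compactness.
Context {R : realType}.

(** All coordinates lie in [[-C, C]], so by Tychonoff the sequence has a cluster point in the
    product topology, whose neighbourhoods constrain finitely many coordinates. Square-summability
    of [p] is obtained only in [weak_sequential_compactness]. *)
Lemma weak_cluster_point (x_ : nat -> l2 R) C : (forall n, `|x_ n| <= C) ->
  exists p : nat -> R, forall m n0 (e : R), 0 < e ->
    exists n, (n0 <= n)%N /\ forall k, (k < m)%N -> `|p k - x_ n k| < e.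
Proof.
move=> xC; have C0 : 0 <= C by apply: le_trans (xC 0%N).
have xkC n k : `|x_ n k| <= C.
  rewrite -(@ler_pXn2r _ 2) ?nnegrE// real_normK ?num_real//.
  apply: le_trans (_ : `|x_ n| ^+ 2 <= _); last first.
    by rewrite ler_pXn2r ?nnegrE.
  apply: le_trans (l2_partial_norm_le (x_ n) k.+1).
  by rewrite big_nat_recr//= lerDr sumr_ge0// => i _; exact: sqr_ge0.
pose K (k : nat) : topologicalType := R.
pose A := [set f : prod_topology K | forall k, `[- C, C]%classic (f k)].
have cA : compact A.
  by apply: (@tychonoff _ K (fun=> `[- C, C]%classic)) => k; exact: segment_compact.
pose F : set_system (prod_topology K) := fmap (fun n => l2val (x_ n)) \oo.
have FA : F A.
  by exists 0%N => // n _ k /=; rewrite in_itv/= -ler_norml.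
have PF : ProperFilter F by apply: fmap_proper_filter.
have [p [_ cp]] := cA F PF FA.
exists p => m n0 e e0.
have Nb : nbhs p [set f : prod_topology K | forall k, (k < m)%N -> `|p k - f k| < e].
  elim: m => [|m ih]; first by apply: filterE => f k; rewrite ltn0.
  have pm : nbhs p [set f : prod_topology K | `|p m - f m| < e].
    have bm : nbhs (p m : R) [set z : R | `|p m - z| < e].
      by have := nbhsx_ballx (p m : R) e e0; rewrite -ball_normE.
    exact: (@proj_continuous nat K m p _ bm).
  apply: filterS (filterI ih pm) => f [fk fm] k.
  by rewrite ltnS leq_eqVlt => /predU1P[->//|]; exact: fk.
have Fn : F [set l2val (x_ n) | n in [set n | (n0 <= n)%N]].
  by exists n0 => // n /= n0n; exists n.
have [_ [[n n0n <-] /= h]] := cp _ _ Fn Nb.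
by exists n.
Qed.

(** Choose [phi n >= n] such that the first [n] coordinates are within [1/(n+1)] of the cluster
    point. The map [phi] need not be increasing; the bound [n <= phi n] is all that is used
    later. *)
Lemma weak_sequential_compactness (x_ : nat -> l2 R) C : (forall n, `|x_ n| <= C) ->
  exists phi : nat -> nat, exists x : l2 R, [/\ `|x| <= C,
    (forall n, (n <= phi n)%N) & forall k, x_ (phi n) k @[n --> \oo] --> x k].
Proof.
move=> xC; have C0 : 0 <= C by apply: le_trans (xC 0%N).
have [p hp] := weak_cluster_point xC.
have {hp}/choice[phi hphi] : forall n, exists k, (n <= k)%N /\
    forall j, (j < n)%N -> `|p j - x_ k j| < n.+1%:R^-1.
  by move=> n; apply: hp; rewrite invr_gt0.
have cp k : x_ (phi n) k @[n --> \oo] --> p k.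
  apply/cvgrPdist_lt => e e0; near=> n.
  apply: lt_trans ((hphi n).2 k _) _.
    by near: n; exact: nbhs_infty_gt.
  by near: n; have := near_infty_natSinv_lt (PosNum e0).
have pC m : \sum_(0 <= k < m) p k ^+ 2 <= C ^+ 2.
  have h : \sum_(0 <= k < m) (x_ (phi n) k) ^+ 2 @[n --> \oo] -->
      \sum_(0 <= k < m) p k ^+ 2.
    apply: cvg_sumr => k _; rewrite expr2; under eq_fun do rewrite expr2.
    by apply: cvgM.
  rewrite -(cvg_lim _ h)//; apply: limr_le; first by apply/cvg_ex; eexists; exact: h.
  apply: nearW => n; apply: le_trans (l2_partial_norm_le _ _) _.
  by rewrite ler_pXn2r ?nnegrE.
exists phi, (L2 (l2_bounded_sums pC)); split => //.
- exact: l2_norm_le.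
- by move=> n; exact: (hphi n).1.
Unshelve. all: end_near. Qed.

End weak_compactness.

Section l2_measurability.
Context {R : realType}.

Lemma measurable_l2_continuous (f : l2 R -> R) : continuous f ->
  measurable_fun [set: l2 R] f.
Proof.
move=> cf; apply: (measurability (@RGenOInfty.G R)).
  exact: RGenOInfty.measurableE.
move=> _ [_ [a ->] <-]; rewrite setTI; apply: sub_sigma_algebra.
by apply: open_comp => [x _|]; [exact: cf|exact: interval_open].
Qed.

Lemma l2dot_continuous (u : l2 R) : continuous (l2dot u).
Proof.
move=> x; have FF : Filter (nbhs x) by exact: nbhs_filter.
apply: (@cvgrPdist_le _ R _ (nbhs x) FF _ _).2 => e e0.
have u1 : 0 < `|u| + 1 by rewrite ltr_wpDl.
have eu : 0 < e / (`|u| + 1) by rewrite divr_gt0.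
have : nbhs x [set y : l2 R | `|x - y| < e / (`|u| + 1)].
  by have := nbhsx_ballx x _ eu; rewrite -ball_normE.
apply: filterS => y /= xy.
rewrite -l2dotBr (le_trans (l2dot_abs_le _ _))//.
move: (ltW xy); rewrite ler_pdivlMr// mulrC; apply: le_trans.
by rewrite mulrDl mul1r lerDl.
Qed.

Lemma measurable_l2dot (u : l2 R) : measurable_fun [set: l2 R] (l2dot u).
Proof. by apply: measurable_l2_continuous; exact: l2dot_continuous. Qed.

Lemma measurable_l2_coord k : measurable_fun [set: l2 R] (fun x : l2 R => x k).
Proof.
rewrite (_ : (fun x : l2 R => x k) = l2dot (l2_delta k)); first exact: measurable_l2dot.
by apply/funext => x; rewrite l2dot_delta.
Qed.

Lemma measurable_l2_norm : measurable_fun [set: l2 R] (fun x : l2 R => `|x|).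
Proof. by apply: measurable_l2_continuous => x; exact: norm_continuous. Qed.

End l2_measurability.

(** * Spectral decomposition of the covariance *)

Section covariance_form.
Context d (T : measurableType d) (R : realType) (P : probability T R).
Variable Z : {RV P >-> l2 R}.
Hypothesis iZ : itg P (fun t => `|Z t| ^+ 2).
Implicit Types x y : l2 R.

(** The form [<Gamma x, y>] when [Z] is centered. Written as an integral, it makes positivity,
    boundedness and weak continuity immediate; [cov_matrixE] recovers the matrix entries. *)
Definition cov_form x y := \int[P]_t (l2dot x (Z t) * l2dot y (Z t)).

Let mdot x : measurable_fun [set: T] (fun t => l2dot x (Z t)).
Proof. exact: (measurableT_comp (measurable_l2dot x) (measurable_funPT Z)). Qed.

Let dot_bound x y t :
  `|l2dot x (Z t) * l2dot y (Z t)| <= `|x| * `|y| * `|Z t| ^+ 2.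
Proof.
rewrite normrM expr2 mulrACA; apply: ler_pM => //; exact: l2dot_abs_le.
Qed.

Lemma itg_cov_form x y : itg P (fun t => l2dot x (Z t) * l2dot y (Z t)).
Proof.
apply: (itg_le _ (itgZ (`|x| * `|y|) iZ)); last exact: dot_bound.
exact: measurable_funM.
Qed.

Lemma itg_l2dot_sqr x : itg P (fun t => l2dot x (Z t) ^+ 2).
Proof. exact: itg_cov_form. Qed.

Lemma cov_formC x y : cov_form x y = cov_form y x.
Proof. by apply: eq_Rintegral => t _; rewrite mulrC. Qed.

Lemma cov_form_linl a x y z :
  cov_form (a *: x + y) z = a * cov_form x z + cov_form y z.
Proof.
rewrite /cov_form -RintegralZl//; last exact: itg_cov_form.
rewrite -RintegralD//; [|exact/itgZ/itg_cov_form|exact: itg_cov_form].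
by apply: eq_Rintegral => t _; rewrite l2dotDl l2dotZl; ring.
Qed.

Lemma cov_formDl x y z : cov_form (x + y) z = cov_form x z + cov_form y z.
Proof. by have := cov_form_linl 1 x y z; rewrite scale1r mul1r. Qed.

Lemma cov_form0l x : cov_form 0 x = 0.
Proof. by apply: (addrI (cov_form 0 x)); rewrite -cov_formDl !addr0. Qed.

Lemma cov_formZl a x y : cov_form (a *: x) y = a * cov_form x y.
Proof. by have := cov_form_linl a x 0 y; rewrite addr0 cov_form0l addr0. Qed.

Lemma cov_formBl x y z : cov_form (x - y) z = cov_form x z - cov_form y z.
Proof. by rewrite -scaleN1r cov_formDl cov_formZl mulN1r. Qed.

Lemma cov_form_suml (s : seq nat) (f : nat -> l2 R) y :
  cov_form (\sum_(i <- s) f i) y = \sum_(i <- s) cov_form (f i) y.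
Proof.
by apply: (big_morph (fun x => cov_form x y)) => [u v|]; rewrite ?cov_formDl ?cov_form0l.
Qed.

Lemma cov_form_ge0 x : 0 <= cov_form x x.
Proof. by apply: Rintegral_ge0 => t _; rewrite -expr2 sqr_ge0. Qed.

Lemma cov_form_bound x y : `|cov_form x y| <= `|x| * `|y| * \int[P]_t `|Z t| ^+ 2.
Proof.
apply: le_trans (le_normr_Rintegral measurableT (itg_cov_form x y)) _.
rewrite -RintegralZl//; apply: le_Rintegral => //.
- exact/itg_norm/itg_cov_form.
- exact: itgZ.
Qed.

(** This is the compactness of the covariance operator: weak convergence of both arguments is
    enough, by dominated convergence with majorant [C^2 |Z|^2]. *)
Lemma cov_form_weak_cvg (x_ y_ : nat -> l2 R) x y C :
  (forall n, `|x_ n| <= C) -> (forall n, `|y_ n| <= C) ->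
  (forall k, x_ n k @[n --> \oo] --> x k) ->
  (forall k, y_ n k @[n --> \oo] --> y k) ->
  cov_form (x_ n) (y_ n) @[n --> \oo] --> cov_form x y.
Proof.
move=> xC yC xk yk; have C0 : 0 <= C by apply: le_trans (xC 0%N).
apply: (Rintegral_dct _ (itgZ (C * C) iZ) _ _).2.
- by move=> n; exact: measurable_funM.
- move=> n t; rewrite (le_trans (dot_bound _ _ _))// ler_wpM2r ?sqr_ge0//.
  exact: ler_pM.
- by move=> t; apply: cvgM; apply: weak_cvg_l2dot; eassumption.
Qed.

Lemma l2_fin_bound x n : `|l2_fin n x| <= `|x|.
Proof.
by rewrite -(@ler_pXn2r _ 2) ?nnegrE// l2_sqr_norm_fin l2_partial_norm_le.
Qed.

Lemma cvg_l2_fin x k : l2_fin n x k @[n --> \oo] --> x k.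
Proof.
apply: cvg_near_cst; near=> n; rewrite l2_finE ifT//.
by near: n; exact: nbhs_infty_gt.
Unshelve. all: end_near. Qed.

Lemma cov_form_fin (x : nat -> R) n y :
  cov_form (l2_fin n x) y = \sum_(0 <= k < n) x k * cov_form (l2_delta k) y.
Proof.
transitivity (\int[P]_t \sum_(0 <= k < n)
    x k * (l2dot (l2_delta k) (Z t) * l2dot y (Z t))).
  apply: eq_Rintegral => t _; rewrite l2dot_finl mulr_suml.
  by apply: eq_bigr => k _; rewrite l2dot_delta mulrA.
rewrite Rint_sum; last by move=> k _; exact/itgZ/itg_cov_form.
by apply: eq_bigr => k _; rewrite RintegralZl//; exact: itg_cov_form.
Qed.

Lemma cvg_cov_form_fin x y :
  \sum_(0 <= k < n) x k * cov_form (l2_delta k) y @[n --> \oo] --> cov_form x y.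
Proof.
under eq_fun do rewrite -cov_form_fin.
apply: (@cov_form_weak_cvg _ (fun=> y) _ _ (`|x| + `|y|)).
- by move=> n; rewrite (le_trans (l2_fin_bound _ _))// lerDl.
- by move=> n; rewrite lerDr.
- exact: cvg_l2_fin.
- by move=> k; exact: cvg_cst.
Qed.

(** The vector [w] is [Gamma x], with coordinates [B (l2_delta k) x]. It lies in l2 because its
    truncations [u] satisfy [|u|^2 = B u x <= |u| * M]. *)
Lemma cov_form_representer x :
  exists w : l2 R, forall y, l2dot w y = cov_form x y.
Proof.
pose w k := cov_form (l2_delta k) x; pose M := `|x| * \int[P]_t `|Z t| ^+ 2.
have M0 : 0 <= M by rewrite mulr_ge0// Rintegral_ge0// => t _; exact: sqr_ge0.
have wM m : \sum_(0 <= k < m) w k ^+ 2 <= M ^+ 2.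
  rewrite -l2_sqr_norm_fin; set u := l2_fin m w.
  have : `|u| ^+ 2 <= `|u| * M.
    rewrite l2_sqr_norm_fin.
    have -> : \sum_(0 <= k < m) w k ^+ 2 = cov_form u x.
      by rewrite /u cov_form_fin; apply: eq_bigr => k _; rewrite expr2.
    rewrite (le_trans (ler_norm _))// (le_trans (cov_form_bound _ _))//.
    by rewrite mulrA.
  rewrite expr2; have [->|u0] := eqVneq `|u| 0; first by rewrite mul0r sqr_ge0.
  have up : 0 < `|u| by rewrite lt_neqAle eq_sym u0/=.
  by rewrite ler_pM2l// => uM; rewrite expr2; exact: ler_pM.
exists (L2 (l2_bounded_sums wM)) => y.
have h1 := @cvg_l2dot R (L2 (l2_bounded_sums wM)) y.
have h2 : \sum_(0 <= k < n) w k * y k @[n --> \oo] --> cov_form x y.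
  rewrite cov_formC; have := @cvg_cov_form_fin y x.
  by under eq_fun do under eq_bigr do rewrite mulrC.
exact: (cvg_unique (@norm_hausdorff _ _) h1 h2).
Qed.

End covariance_form.

(** First-order condition at a minimum. The value [t = - c / (D + 1)] is used instead of the
    minimizer [- c / D] because [D] may be zero. *)
Lemma quadratic_ge0_linear_eq0 (R : realType) (c D : R) : 0 <= D ->
  (forall t, 0 <= 2 * t * c + t ^+ 2 * D) -> c = 0.
Proof.
move=> D0 /(_ (- c / (D + 1))); have D1 : 0 < D + 1 by lra.
have -> : 2 * (- c / (D + 1)) * c + (- c / (D + 1)) ^+ 2 * D =
  - (c ^+ 2 * (D + 2)) / (D + 1) ^+ 2 by field; rewrite gt_eqF.
rewrite pmulr_lge0 ?invr_gt0 ?exprn_gt0// oppr_ge0 => h.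
apply/eqP; rewrite -sqrf_eq0 eq_le sqr_ge0 andbT.
by rewrite -(pmulr_lle0 _ (_ : 0 < D + 2))//; lra.
Qed.

Section spectral_decomposition.
Context d (T : measurableType d) (R : realType) (P : probability T R).
Variable Z : {RV P >-> l2 R}.
Hypothesis iZ : itg P (fun t => `|Z t| ^+ 2).
Variables (e : nat -> l2 R) (lam : nat -> R).
Local Notation B := (@cov_form _ _ _ P Z).
(* In particular [e i = 0] at the zeros of [lam], which are mere padding. *)
Hypothesis e_orth : forall i j, l2dot (e i) (e j) = ((i == j) && (lam i != 0))%:R.
Hypothesis e_eigen : forall i y, B y (e i) = lam i * l2dot y (e i).
Hypothesis e_max : forall x r, r != 0 -> (forall y, B y x = r * l2dot y x) ->
  (forall i, l2dot x (e i) = 0) -> x = 0.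

Lemma eigenvalue_ge0 i : 0 <= lam i.
Proof.
have [->//|li] := eqVneq (lam i) 0.
have := cov_form_ge0 Z (e i); rewrite e_eigen e_orth eqxx li mulr1.
exact.
Qed.

Let dot_e0 i v : lam i = 0 -> l2dot v (e i) = 0.
Proof.
move=> li; have := e_orth i i; rewrite li !eqxx/= => /l2dotxx_eq0 ->.
exact: l2dot0r.
Qed.

(* A maximizer of the form on the part of the unit ball orthogonal to the
   eigenvectors exists by weak compactness; it is itself an eigenvector. *)
Lemma cov_form_orthogonal_eq0 x : (forall i, l2dot x (e i) = 0) -> B x x = 0.
Proof.
move=> xe; apply/eqP; rewrite -[_ == _]negbK; apply/negP => Bx.
have {}Bx : 0 < B x x by rewrite lt_neqAle eq_sym Bx cov_form_ge0.
have x0 : x != 0 by apply/eqP => x0; move: Bx; rewrite x0 cov_form0l// ltxx.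
pose K := [set y : l2 R | `|y| <= 1 /\ forall i, l2dot y (e i) = 0].
pose S := [set B y y | y in K]; pose M := sup S.
have K0 : K 0 by split => [|i]; rewrite ?normr0// l2dot0l.
have ubS : ubound S (\int[P]_t `|Z t| ^+ 2).
  move=> _ [y [y1 _] <-]; rewrite (le_trans (ler_norm _))//.
  rewrite (le_trans (cov_form_bound iZ _ _))// ler_piMl ?mulr_ile1//.
  by apply: Rintegral_ge0 => t _; exact: sqr_ge0.
have hS : has_sup S by split; [exists (B 0 0), 0|exists (\int[P]_t `|Z t| ^+ 2)].
have leM y : K y -> B y y <= M by move=> Ky; apply: (ub_le_sup hS.2); exists y.
have scaled z : (forall i, l2dot z (e i) = 0) -> B z z <= M * `|z| ^+ 2.
  move=> ze; have [->|z0] := eqVneq z 0.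
    by rewrite cov_form0l// normr0 expr0n mulr0.
  have zp : 0 < `|z| by rewrite normr_gt0.
  have /leM : K (`|z|^-1 *: z).
    split=> [|i]; last by rewrite l2dotZl ze mulr0.
    by rewrite normrZ normfV normr_id mulVf// gt_eqF.
  rewrite cov_formZl// cov_formC cov_formZl// mulrA -expr2 exprVn mulrC.
  by rewrite ler_pdivrMr// exprn_gt0.
have Mgt0 : 0 < M.
  have := lt_le_trans Bx (scaled x xe).
  by rewrite pmulr_lgt0// exprn_gt0// normr_gt0.
have /choice[y_ hy_] : forall n, exists y, K y /\ M - n.+1%:R^-1 < B y y.
  move=> n; have n0 : (0 : R) < n.+1%:R^-1 by rewrite invr_gt0.
  by have [_ [y Ky <-] h] := sup_adherent n0 hS; exists y.
have [phi [y [y1 phin yk]]] := weak_sequential_compactness (fun n => (hy_ n).1.1).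
have ye i : l2dot y (e i) = 0.
  have h := @weak_cvg_l2dot _ _ _ _ (e i) (fun n => (hy_ (phi n)).1.1) yk.
  have h0 : l2dot (y_ (phi n)) (e i) @[n --> \oo] --> (0 : R).
    by apply: cvg_near_cst; apply: nearW => n; have [[_ ->]] := hy_ (phi n).
  exact: (cvg_unique (@norm_hausdorff _ _) h h0).
have ByM : B y y = M.
  apply/eqP; rewrite eq_le leM//=.
  have h := cov_form_weak_cvg iZ (fun n => (hy_ (phi n)).1.1)
    (fun n => (hy_ (phi n)).1.1) yk yk.
  have hM : M - n.+1%:R^-1 @[n --> \oo] --> M.
    rewrite -[X in _ --> X]subr0; apply: cvgB; [exact: cvg_cst|exact: cvg_harmonic].
  apply: (ler_cvg_to hM h); apply: nearW => n.
  apply: le_trans (ltW (hy_ (phi n)).2); rewrite lerD2l lerN2.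
  by rewrite lef_pV2 ?posrE// ler_nat ltnS.
(* First variation at the maximizer: along [t *: z + y] the function [M |.|^2 - B] is nonnegative,
   and its value at [t = 0] is at most 0, so its linear coefficient vanishes. *)
have stationary z : (forall i, l2dot z (e i) = 0) -> M * l2dot y z = B y z.
  move=> ze; apply/eqP; rewrite -subr_eq0; apply/eqP.
  apply: (@quadratic_ge0_linear_eq0 _ _ (M * `|z| ^+ 2 - B z z)).
    by rewrite subr_ge0 scaled.
  move=> t; have : B (t *: z + y) (t *: z + y) <= M * `|t *: z + y| ^+ 2.
    by apply: scaled => i; rewrite l2dotDl l2dotZl ze ye mulr0 addr0.
  rewrite cov_form_linl// !(cov_formC _ _ (_ + _)) !cov_form_linl// ByM.
  rewrite (l2_sqr_norm (_ + _)) l2dotDl !l2dotDr !l2dotZl !l2dotZr -!l2_sqr_norm.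
  rewrite (cov_formC _ z y) (l2dotC z y).
  have : M * `|y| ^+ 2 <= M by rewrite ler_piMr// ?exprn_ile1// ltW.
  rewrite !mulrDr !expr2.
  move: (M * _) (B y z) (B z z) (l2dot y z) (`|z| * `|z|) => a b c u w.
  clear; lra.
(* Stationarity is available only against vectors orthogonal to all [e i]. The vector [w - M *: y]
   is itself such a vector, so testing it against itself gives [Gamma y = M y]. *)
have [w hw] := cov_form_representer iZ y.
have wM : w - M *: y = 0.
  apply: l2dotxx_eq0; rewrite [LHS]l2dotBl l2dotZl hw stationary ?subrr//.
  by move=> i; rewrite l2dotBl l2dotZl hw ye mulr0 subr0 e_eigen ye mulr0.
have y0 : y = 0.
  apply: (@e_max y M); [by rewrite gt_eqF| |exact: ye].
  move=> z; rewrite cov_formC -hw; have /eqP := wM; rewrite subr_eq0 => /eqP ->.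
  by rewrite l2dotZl l2dotC.
by move: Mgt0; rewrite -ByM y0 cov_form0l// ltxx.
Qed.

Let resid v p := v - \sum_(0 <= i < p) l2dot v (e i) *: e i.

Let resid_e v p j : l2dot (resid v p) (e j) = if (j < p)%N then 0 else l2dot v (e j).
Proof.
have [lj|lj] := eqVneq (lam j) 0; first by rewrite !dot_e0// if_same.
rewrite l2dotBl l2dot_suml.
under eq_bigr => i _ do rewrite l2dotZl e_orth.
have [jp|jp] := ltnP j p.
  rewrite big_mkord (bigD1 (Ordinal jp))//= eqxx lj mulr1 big1 ?addr0 ?subrr//.
  by move=> i; rewrite -val_eqE/= => /negbTE ->; rewrite mulr0.
rewrite big_nat_cond big1 ?subr0// => i /andP[/andP[_ ip] _].
by rewrite ltn_eqF ?mulr0// (leq_trans ip).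
Qed.

Let resid_norm v p : `|resid v p| ^+ 2 = `|v| ^+ 2 - \sum_(0 <= i < p) l2dot v (e i) ^+ 2.
Proof.
rewrite l2_sqr_norm {2}/resid l2dotBr l2dot_sumr [X in _ - X]big_nat_cond.
rewrite [X in _ - X]big1 ?subr0; last first.
  by move=> i /andP[/andP[_ ip] _]; rewrite l2dotZr resid_e ip mulr0.
rewrite l2dotBl l2_sqr_norm l2dot_suml; congr (_ - _).
by apply: eq_bigr => i _; rewrite l2dotZl (l2dotC (e i)) expr2.
Qed.

Let resid_form v p : B (resid v p) (resid v p) =
  B v v - \sum_(0 <= i < p) lam i * l2dot v (e i) ^+ 2.
Proof.
have Be i u y : B (u *: e i) y = u * (lam i * l2dot y (e i)).
  by rewrite cov_formZl// cov_formC e_eigen.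
rewrite {1}/resid cov_formBl// cov_form_suml// [X in _ - X]big_nat_cond.
rewrite [X in _ - X]big1 ?subr0; last first.
  by move=> i /andP[/andP[_ ip] _]; rewrite Be resid_e ip !mulr0.
rewrite cov_formC cov_formBl// cov_form_suml//; congr (_ - _).
by apply: eq_bigr => i _; rewrite Be; ring.
Qed.

Lemma spectral_sum_le v p :
  \sum_(0 <= i < p) lam i * l2dot v (e i) ^+ 2 <= B v v.
Proof. by rewrite -subr_ge0 -resid_form cov_form_ge0. Qed.

(** The residuals of [v] are bounded, and a weak limit of them is orthogonal to all [e i], so the
    form vanishes there. Thus the form of the residuals tends to 0 along [phi], and then along all
    [p], because it is nonincreasing in [p]. *)
Theorem spectral_decomposition v :
  \sum_(0 <= i < p) lam i * l2dot v (e i) ^+ 2 @[p --> \oo] --> B v v.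
Proof.
have rv p : `|resid v p| <= `|v|.
  rewrite -(@ler_pXn2r _ 2) ?nnegrE// resid_norm gerBl sumr_ge0// => i _.
  exact: sqr_ge0.
have [phi [y [_ phin yk]]] := weak_sequential_compactness rv.
have ye i : l2dot y (e i) = 0.
  have h := @weak_cvg_l2dot _ _ _ _ (e i) (fun n => rv (phi n)) yk.
  have h0 : l2dot (resid v (phi n)) (e i) @[n --> \oo] --> (0 : R).
    apply: cvg_near_cst; near=> n; rewrite resid_e ifT//.
    by rewrite (leq_trans _ (phin n))//; near: n; exact: nbhs_infty_gt.
  exact: (cvg_unique (@norm_hausdorff _ _) h h0).
have := cov_form_weak_cvg iZ (fun n => rv (phi n)) (fun n => rv (phi n)) yk yk.
rewrite (cov_form_orthogonal_eq0 ye) => h.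
apply/cvgrPdist_le => eps eps0.
have /cvgrPdist_le/(_ _ eps0)[n _ /(_ n (leqnn n))/=] := h.
rewrite sub0r normrN ger0_norm ?cov_form_ge0// => hn.
exists (phi n) => // p /= np.
rewrite -resid_form (ger0_norm (cov_form_ge0 _ _)); apply: le_trans hn.
rewrite !resid_form.
rewrite lerD2l lerN2 (big_cat_nat _ np)//= lerDl sumr_ge0// => i _.
by rewrite mulr_ge0 ?sqr_ge0// eigenvalue_ge0.
Unshelve. all: end_near. Qed.

End spectral_decomposition.

(** * Orthonormal bases of eigenspaces and the eigenvector family *)

Lemma wide_kernel (F : fieldType) m k (A : 'M[F]_(m, k)) : (k < m)%N ->
  exists c : 'rV[F]_m, c != 0 /\ c *m A = 0.
Proof.
move=> km; exists (nz_row (kermx A)); split.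
  rewrite nz_row_eq0 -mxrank_eq0 mxrank_ker subn_eq0 -ltnNge.
  exact: leq_ltn_trans (rank_leq_col A) km.
by apply/sub_kermxP; exact: nz_row_sub.
Qed.

Section orthonormal_basis.
Variables (R : realType) (E : set (l2 R)).
Hypothesis E_lin : forall a x y, E x -> E y -> E (a *: x + y).
Hypothesis E_0 : E 0.

Let E_sum (m : nat) (c : 'I_m -> R) (b : 'I_m -> l2 R) :
  (forall j, E (b j)) -> E (\sum_(j < m) c j *: b j).
Proof.
move=> Eb; apply: big_rec => // j x _ Ex; exact: E_lin.
Qed.

Definition orthonormal_in (k : nat) (f : nat -> l2 R) :=
  (forall j, (j < k)%N -> E (f j)) /\
  (forall i j, (i < k)%N -> (j < k)%N -> l2dot (f i) (f j) = (i == j)%:R).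

Let extend k f x : orthonormal_in k f -> E x -> x != 0 ->
  (forall j, (j < k)%N -> l2dot x (f j) = 0) ->
  orthonormal_in k.+1 (fun j => if (j < k)%N then f j else `|x|^-1 *: x).
Proof.
move=> [fE fo] Ex x0 xf; split => [j _|i j].
  case: ifPn => jk; first exact: fE.
  by rewrite -[_ *: x]addr0; exact: E_lin.
have xx : l2dot (`|x|^-1 *: x) (`|x|^-1 *: x) = 1.
  rewrite l2dotZl l2dotZr -l2_sqr_norm mulrA -expr2 -exprMn mulVf ?expr1n//.
  by rewrite normr_eq0.
rewrite !ltnS => ik jk; case: ltnP => ik'; case: ltnP => jk'.
- exact: fo.
- by rewrite l2dotC l2dotZl xf// mulr0 ltn_eqF// (leq_trans ik').
- by rewrite l2dotZl xf// mulr0 gtn_eqF// (leq_trans jk').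
- by rewrite xx (@anti_leq i j) ?eqxx// (leq_trans ik jk') (leq_trans jk ik').
Qed.

(** Two dimension counts by [wide_kernel]. With [k < m] orthonormal vectors given, some nonzero
    combination of the [m] basis vectors is orthogonal to all of them, which replaces Gram-Schmidt
    formulas. A further orthogonal vector would give [m + 1] orthonormal vectors with dependent
    coordinate rows. *)
Lemma orthonormal_basis m : has_dimension E m -> exists f, orthonormal_in m f /\
  forall x, E x -> (forall j, (j < m)%N -> l2dot x (f j) = 0) -> x = 0.
Proof.
move=> [b [Eb bE]].
have b_free (c : 'rV[R]_m) : \sum_(j < m) c 0 j *: b j = 0 -> c = 0.
  move=> c0; have [c' [_ uc]] := bE _ E_0.
  rewrite -(uc c)// -(uc 0)// big1// => j _; by rewrite mxE scale0r.
have [f fm] : exists f, orthonormal_in m f.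
  suff : forall k, (k <= m)%N -> exists f, orthonormal_in k f by move=> /(_ m); exact.
  elim=> [_|k ih km]; first by exists (fun=> 0); split.
  have [f ff] := ih (ltnW km).
  have [c [c0 cA]] := wide_kernel (\matrix_(i < m, j < k) l2dot (b i) (f j)) km.
  exists (fun j => if (j < k)%N then f j else
    `|\sum_(j < m) c 0 j *: b j|^-1 *: \sum_(j < m) c 0 j *: b j).
  apply: extend => //; first exact: E_sum.
    by apply: contra_neq c0; exact: b_free.
  move=> j jk; have /rowP/(_ (Ordinal jk)) := cA; rewrite !mxE => h.
  rewrite l2dot_suml -[RHS]h; apply: eq_bigr => i _.
  by rewrite l2dotZl mxE.
exists f; split => // x Ex xf; apply/eqP; apply: contrapT => /negP x0.
pose g j := if (j < m)%N then f j else `|x|^-1 *: x.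
have [gE go] : orthonormal_in m.+1 g := extend fm Ex x0 xf.
have /choice[C CE] : forall i : 'I_m.+1, exists c : 'rV[R]_m,
    g i = \sum_(j < m) c 0 j *: b j.
  by move=> i; have [c [hc _]] := bE _ (gE i (ltn_ord i)); exists c.
have [c [c0 cC]] := wide_kernel (\matrix_(i < m.+1, j < m) C i 0 j) (leqnn _).
have sum0 : \sum_(i < m.+1) c 0 i *: g i = 0.
  under eq_bigr do rewrite CE scaler_sumr.
  rewrite exchange_big/=; apply: big1 => j _.
  under eq_bigr do rewrite scalerA; rewrite -scaler_suml.
  have /rowP/(_ j) := cC; rewrite !mxE.
  by under eq_bigr do rewrite mxE; move=> ->; rewrite scale0r.
move/eqP: c0; apply; apply/rowP => i; rewrite mxE.
have := congr1 (fun y => l2dot y (g i)) sum0.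
rewrite l2dot_suml l2dot0l (bigD1 i)//= l2dotZl go// eqxx mulr1 big1 ?addr0//.
by move=> j ji; rewrite l2dotZl go// (_ : (_ == _) = false) ?mulr0//; exact/negbTE.
Qed.

End orthonormal_basis.

Section covariance_eigenvectors.
Context d (T : measurableType d) (R : realType) (P : probability T R).
Variable Z : {RV P >-> l2 R}.
Hypothesis iZ : itg P (fun t => `|Z t| ^+ 2).
Hypothesis Z_centered : is_expectation P Z 0.
Local Notation B := (@cov_form _ _ _ P Z).

Lemma itg_l2dot x : itg P (fun t => l2dot x (Z t)).
Proof.
apply: itg_sqr_itg; last exact: itg_l2dot_sqr.
exact: (measurableT_comp (measurable_l2dot x) (measurable_funPT Z)).
Qed.

Lemma Rint_l2dot_centered x : \int[P]_t l2dot x (Z t) = 0.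
Proof.
have := Z_centered x; rewrite unlock Rint_EFin; last exact: itg_l2dot.
by rewrite l2dot0r => -[].
Qed.

Lemma cov_matrixE k l : cov_matrix P Z k l = B (l2_delta k) (l2_delta l).
Proof.
have E0 j : 'E_P[fun t => Z t j]%E = 0%E.
  have h := Z_centered (l2_delta j); rewrite l2dot0r in h; rewrite -[RHS]h.
  by congr ('E_P[_])%E; apply/funext => t; rewrite l2dot_delta.
rewrite /cov_matrix unlock !E0 unlock /cov_form /Rintegral; congr fine.
apply: eq_integral => t _; rewrite !l2dot_delta.
by rewrite -[X in X%:E = _]/((Z t k - 0) * (Z t l - 0)) !subr0.
Qed.

(** Passes from the coordinatewise matrix equation to the weak form. The series of row [k] always
    converges, to [B (l2_delta k) x], so the equation at the unit vectors extends to every [y]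
    through its truncations. *)
Lemma eigenspaceE r x :
  l2_eigenspace (cov_matrix P Z) r x <-> forall y, B y x = r * l2dot y x.
Proof.
have rows k : series (fun l => cov_matrix P Z k l * x l) @ \oo --> B (l2_delta k) x.
  rewrite cov_formC; have := @cvg_cov_form_fin _ _ _ _ _ iZ x (l2_delta k).
  rewrite /series/=.
  by under eq_fun do under eq_bigr do rewrite cov_formC -cov_matrixE mulrC.
split=> [xr y|h k].
  have xk k : B (l2_delta k) x = r * x k.
    exact: (cvg_unique (@norm_hausdorff _ _) (rows k) (xr k)).
  have h2 : \sum_(0 <= k < n) y k * B (l2_delta k) x @[n --> \oo] -->
      r * l2dot y x.
    rewrite (_ : (fun n => _) = (fun n => r * \sum_(0 <= k < n) y k * x k)).
      by apply: cvgMl_tmp; exact: cvg_l2dot.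
    apply/funext => n; rewrite mulr_sumr; apply: eq_bigr => k _.
    by rewrite xk mulrCA.
  exact: (cvg_unique (@norm_hausdorff _ _) (@cvg_cov_form_fin _ _ _ _ _ iZ y x) h2).
by have := rows k; rewrite h l2dot_delta.
Qed.

(** For each [r != 0] the equipotence in [lists_eigenvalues] lets the indices with [lam i = r] label
    an orthonormal basis of the eigenspace of [r]. These finite families are glued along [lam]. *)
Lemma eigenvector_family (lam : nat -> R) :
  lists_eigenvalues (cov_matrix P Z) lam ->
  exists e : nat -> l2 R, [/\
    (forall i j, l2dot (e i) (e j) = ((i == j) && (lam i != 0))%:R),
    (forall i y, B y (e i) = lam i * l2dot y (e i)) &
    (forall x r, r != 0 -> (forall y, B y x = r * l2dot y x) ->
      (forall i, l2dot x (e i) = 0) -> x = 0)].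
Proof.
move=> lamE.
have /choice[g hg] : forall r, exists g : nat -> l2 R, r != 0 -> [/\
    (forall i, lam i = r -> forall y, B y (g i) = r * l2dot y (g i)),
    (forall i j, lam i = r -> lam j = r -> l2dot (g i) (g j) = (i == j)%:R) &
    (forall x, (forall y, B y x = r * l2dot y x) ->
       (forall i, lam i = r -> l2dot x (g i) = 0) -> x = 0)].
  move=> r; have [->|r0] := eqVneq r 0; first by exists (fun=> 0).
  have [m [dimE /card_set_bijP[phi [phim phi_inj phi_surj]]]] := lamE r r0.
  have [||f [[fE fo] fmax]] := orthonormal_basis _ _ dimE.
  - move=> a x y /eigenspaceE Ex /eigenspaceE Ey; apply/eigenspaceE => z.
    by rewrite cov_formC cov_form_linl// !(cov_formC _ _ z) Ex Ey l2dotDr l2dotZr; ring.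
  - by apply/eigenspaceE => z; rewrite cov_formC cov_form0l// l2dot0r mulr0.
  exists (f \o phi) => _; split => [i ir|i j ir jr|x /eigenspaceE Ex xg].
  - by apply/eigenspaceE/fE; exact: phim.
  - rewrite fo; [|exact: phim..]; congr (_%:R); congr nat_of_bool.
    apply/eqP/eqP => [|->//]; apply: phi_inj; exact: mem_set.
  - apply: fmax => // j jm; have [i ir <-] := phi_surj j jm.
    exact: xg.
(* Zeros in [lam] carry no information about the kernel, so the zero vector is placed there. *)
exists (fun i => if lam i == 0 then 0 else g (lam i) i).
have eig i y : B y (if lam i == 0 then 0 else g (lam i) i) =
    lam i * l2dot y (if lam i == 0 then 0 else g (lam i) i).
  case: eqVneq => [->|li]; first by rewrite cov_formC cov_form0l// mul0r.
  by have [h _ _] := hg _ li; exact: h.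
split => // [i j|x r r0 Ex xe].
  have [ij|ij] := eqVneq (lam i) (lam j).
    case: eqVneq => [li|li]; first by rewrite l2dot0l andbF.
    by rewrite -ij (negbTE li); have [_ h _] := hg _ li; rewrite h ?andbT// -ij.
  rewrite (_ : (i == j) = false)/=; last first.
    by apply/eqP => e; rewrite e eqxx in ij.
  (* Symmetry of the form gives [(lam i - lam j) * <e_i, e_j> = 0], hence orthogonality across
     distinct eigenvalues. *)
  have := eig j (if lam i == 0 then 0 else g (lam i) i).
  rewrite cov_formC eig l2dotC => /eqP; rewrite -subr_eq0 -mulrBl mulf_eq0.
  by rewrite subr_eq0 (negbTE ij)/= => /eqP.
have [_ _ h] := hg _ r0; apply: h => // i ir.
by have := xe i; rewrite ir (negbTE r0).
Qed.

End covariance_eigenvectors.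

(** * Characteristic functions and the central limit theorem *)

Section trigonometric_bounds.
Context {R : realType}.
Implicit Type x : R.

Lemma ge0_of_derive_ge0 (f df : R -> R) : (forall x : R, is_derive x (1 : R) f (df x)) ->
  f 0 = 0 -> (forall x, 0 <= x -> 0 <= df x) -> forall x, 0 <= x -> 0 <= f x.
Proof.
move=> fd f0 df0 x x0.
have cf : {within `[0, x], continuous f}.
  by apply: derivable_within_continuous => y _; exact: ex_derive.
have [c] := MVT_segment x0 (fun y _ => fd y) cf.
rewrite in_itv/= f0 !subr0 => /andP[c0 _] ->.
by rewrite mulr_ge0// df0.
Qed.

Let sin_le x : 0 <= x -> sin x <= x.
Proof.
rewrite -[_ <= x]subr_ge0.
apply: (@ge0_of_derive_ge0 (id - sin) (fun y => 1 - cos y)).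
- by rewrite -[LHS]/(0 - sin 0) sin0 subrr.
- by move=> y _; rewrite subr_ge0 cos_le1.
Qed.

Lemma abs_sin_le x : `|sin x| <= `|x|.
Proof.
wlog x0 : x / 0 <= x.
  move=> h; have [|x0] := leP 0 x; first exact: h.
  by rewrite -normrN -sinN -(normrN x); apply: h; rewrite oppr_ge0 ltW.
rewrite (ger0_norm x0) ler_norml sin_le// andbT.
have [x1|x1] := leP x 1.
  rewrite (@le_trans _ _ 0)// ?oppr_le0// sin_ge0_pi// x0/=.
  by rewrite (le_trans x1)// (le_trans _ (pi_ge2 R))// ler1n.
by have := sin_geN1 x; lra.
Qed.

Let cos_half x : 1 - cos x = 2 * sin (x / 2) ^+ 2.
Proof.
have -> : cos x = cos (x / 2 *+ 2) by congr cos; rewrite -mulr_natr; field.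
by rewrite cos_mulr2n cos2sin2 mulr2n; ring.
Qed.

Lemma cos_bound x : 0 <= 1 - cos x <= x ^+ 2 / 2.
Proof.
rewrite subr_ge0 cos_le1/= cos_half.
have := abs_sin_le (x / 2); rewrite -(@ler_pXn2r _ 2) ?nnegrE//.
rewrite !real_normK ?num_real// => h.
have -> : x ^+ 2 / 2 = 2 * (x / 2) ^+ 2 by field.
by rewrite ler_pM2l.
Qed.

Let sin_ge_cube x : 0 <= x -> x - sin x <= x ^+ 3 / 6.
Proof.
rewrite -[_ <= x ^+ 3 / 6]subr_ge0 (mulrC (x ^+ 3)); move: x.
apply: (@ge0_of_derive_ge0 (6^-1 *: (fun y => y ^+ 3) - (id - sin))
  (fun y => y ^+ 2 / 2 - (1 - cos y))).
- move=> y; apply: is_derive_eq; rewrite /GRing.scale/=; by field.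
- by rewrite -[LHS]/(6^-1 * 0 ^+ 3 - (0 - sin 0)) sin0 expr0n mulr0 !subrr.
- by move=> y _; rewrite subr_ge0; have /andP[] := cos_bound y.
Qed.

Lemma sin_sub_cube x : `|sin x - x| <= `|x| ^+ 3 / 6.
Proof.
wlog x0 : x / 0 <= x.
  move=> h; have [|x0] := leP 0 x; first exact: h.
  rewrite -normrN (_ : - (sin x - x) = sin (- x) - - x); last by rewrite sinN; ring.
  by rewrite -(normrN x); apply: h; rewrite oppr_ge0 ltW.
by rewrite distrC ger0_norm ?subr_ge0 ?sin_le// (ger0_norm x0) sin_ge_cube.
Qed.

(** Weaker near 0 than the cubic bound, but usable as a majorant when only second moments are
    finite; the cubic bound serves for pointwise limits. *)
Lemma sin_sub_sqr x : `|sin x - x| <= x ^+ 2.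
Proof.
have := sin_sub_cube x; rewrite -(@real_normK _ x) ?num_real//.
have [x2|x2] := leP `|x| 2 => h.
  by apply: le_trans h _; have := normr_ge0 x; nra.
apply: le_trans (ler_normB _ _) _; have := sin_max x; nra.
Qed.

(** With [1 - cos x = 2 sin^2 (x/2)] the left side is a difference of squares. Order three suffices,
    since the bound at [c n * g t] still tends to 0 after division by [c n ^+ 2]. *)
Lemma cos_sub_cube x : `|x ^+ 2 / 2 - (1 - cos x)| <= `|x| ^+ 3.
Proof.
rewrite cos_half (_ : _ - _ = 2 * ((x / 2 - sin (x / 2)) * (x / 2 + sin (x / 2)))); last by field.
rewrite !normrM (ger0_norm (ler0n _ 2)) distrC.
have h1 := sin_sub_sqr (x / 2).
have h2 : `|x / 2 + sin (x / 2)| <= `|x|.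
  apply: le_trans (ler_normD _ _) _; have := abs_sin_le (x / 2).
  by rewrite normrM (ger0_norm (_ : 0 <= 2^-1))//; lra.
apply: (@le_trans _ _ (2 * ((x / 2) ^+ 2 * `|x|))).
  by rewrite ler_pM2l// ler_pM.
have -> : (x / 2) ^+ 2 = `|x| ^+ 2 / 4 by rewrite real_normK ?num_real//; field.
have := exprn_ge0 3 (normr_ge0 x).
have -> : 2 * (`|x| ^+ 2 / 4 * `|x|) = `|x| ^+ 3 / 2 by field.
lra.
Qed.

Lemma expRN_bound x : 0 <= x -> x - x ^+ 2 / 2 <= 1 - expR (- x) <= x.
Proof.
move=> x0; apply/andP; split; last by have := expR_ge1Dx (- x); lra.
rewrite -subr_ge0 (mulrC (x ^+ 2)) [X in 0 <= X](_ : _ =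
  1 - expR (- x) - (x - 2^-1 * x ^+ 2)) //; move: x x0.
apply: (@ge0_of_derive_ge0 (cst 1 - (expR \o -%R) - (id - 2^-1 *: (fun y => y ^+ 2)))
  (fun y => expR (- y) - 1 + y)).
- move=> y; have hc := @is_derive1_comp _ expR -%R y _ _ (is_derive_expR _) _.
  by apply: is_derive_eq; rewrite /GRing.scale/=; field.
- rewrite -[LHS]/(1 - expR (- 0) - (0 - 2^-1 * 0 ^+ 2)).
  by rewrite oppr0 expR0 expr0n mulr0 !subrr.
- by move=> y _; have := expR_ge1Dx (- y); lra.
Qed.

End trigonometric_bounds.

Section small_frequency.
Context d (T : measurableType d) (R : realType) (P : probability T R).
Variables (g : T -> R) (c : nat -> R).
Hypothesis mg : measurable_fun [set: T] g.
Hypothesis ig2 : itg P (fun t => g t ^+ 2).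
Hypothesis c_gt0 : forall n, 0 < c n.
Hypothesis c_cvg0 : c n @[n --> \oo] --> 0.

Let mcg n : measurable_fun [set: T] (fun t => c n * g t).
Proof. exact: measurable_funM. Qed.

Let c2 n : 0 < (c n ^+ 2)^-1. Proof. by rewrite invr_gt0 exprn_gt0. Qed.

Let ccube n t : (c n ^+ 2)^-1 * `|c n * g t| ^+ 3 = c n * `|g t| ^+ 3.
Proof.
rewrite normrM (ger0_norm (ltW (c_gt0 n))) exprMn.
by field; rewrite gt_eqF.
Qed.

Let cvg_c3 t : c n * `|g t| ^+ 3 @[n --> \oo] --> (0 : R).
Proof. by rewrite -[X in _ --> X](mul0r (`|g t| ^+ 3)); apply: cvgMr_tmp. Qed.

(** Second-order expansion of the characteristic function without third moments: the integrand is
    dominated by [g^2 / 2] and converges pointwise by the cubic estimate. *)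
Lemma cvg_small_frequency_cos :
  (c n ^+ 2)^-1 * (1 - \int[P]_t cos (c n * g t)) @[n --> \oo] -->
  (\int[P]_t g t ^+ 2) / 2.
Proof.
have e n : (c n ^+ 2)^-1 * (1 - \int[P]_t cos (c n * g t)) =
    \int[P]_t ((c n ^+ 2)^-1 * (1 - cos (c n * g t))).
  rewrite RintegralZl//; last by apply: itgB; [exact: itg_cst|exact: itg_cos].
  by rewrite RintegralB// ?Rint_cst//; [exact: itg_cst|exact: itg_cos].
under eq_fun do rewrite e.
rewrite (_ : _ / 2 = \int[P]_t (2^-1 * g t ^+ 2)); last by rewrite RintegralZl// mulrC.
apply: (Rintegral_dct _ (itgZ 2^-1 ig2) _ _).2.
- move=> n; apply: measurable_funM => //; apply: measurable_funB => //.
  exact: measurable_fun_cos.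
- move=> n t; have /andP[h0 h1] := cos_bound (c n * g t).
  rewrite ger0_norm ?mulr_ge0 ?(ltW (c2 n))//.
  rewrite ler_pdivrMl ?exprn_gt0//; apply: le_trans h1 _.
  by rewrite exprMn -mulrA [X in _ * X <= _]mulrC.
- move=> t; apply/cvgrPdist_le => eps eps0.
  have /cvgrPdist_le/(_ _ eps0) := cvg_c3 t; apply: filterS => n.
  rewrite sub0r normrN ger0_norm ?mulr_ge0 ?exprn_ge0 ?(ltW (c_gt0 n))//; apply: le_trans.
  have -> : 2^-1 * g t ^+ 2 - (c n ^+ 2)^-1 * (1 - cos (c n * g t)) =
    (c n ^+ 2)^-1 * ((c n * g t) ^+ 2 / 2 - (1 - cos (c n * g t))).
    by field; rewrite gt_eqF.
  rewrite normrM (ger0_norm (ltW (c2 n))) -ccube ler_pM2l//.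
  exact: cos_sub_cube.
Qed.

Hypothesis g_centered : \int[P]_t g t = 0.

(** Centering allows the linear term [c n * g] to be subtracted under the integral; the remainder is
    then dominated by [g^2]. *)
Lemma cvg_small_frequency_sin :
  (c n ^+ 2)^-1 * \int[P]_t sin (c n * g t) @[n --> \oo] --> 0.
Proof.
have ig : itg P g by exact: itg_sqr_itg.
have e n : (c n ^+ 2)^-1 * \int[P]_t sin (c n * g t) =
    \int[P]_t ((c n ^+ 2)^-1 * (sin (c n * g t) - c n * g t)).
  rewrite RintegralZl//; last by apply: itgB; [exact: itg_sin|exact: itgZ].
  rewrite RintegralB//; [|exact: itg_sin|exact: itgZ].
  by rewrite (RintegralZl _ _ ig)// g_centered mulr0 subr0.
under eq_fun do rewrite e.
rewrite -(@Rint_cst _ _ _ P 0).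
apply: (Rintegral_dct _ ig2 _ _).2.
- move=> n; apply: measurable_funM => //; apply: measurable_funB => //.
  exact: measurable_fun_sin.
- move=> n t; rewrite normrM (ger0_norm (ltW (c2 n))).
  rewrite ler_pdivrMl ?exprn_gt0// -exprMn.
  exact: sin_sub_sqr.
- move=> t; apply/cvgrPdist_le => eps eps0.
  have /cvgrPdist_le/(_ _ eps0) := cvg_c3 t; apply: filterS => n.
  rewrite !sub0r !normrN ger0_norm ?mulr_ge0 ?exprn_ge0 ?(ltW (c_gt0 n))//; apply: le_trans.
  rewrite normrM (ger0_norm (ltW (c2 n))) -ccube ler_pM2l//.
  apply: le_trans (sin_sub_cube _) _.
  by rewrite ler_piMr ?exprn_ge0// invf_le1// ler1n.
Qed.

End small_frequency.

Section identical_distribution.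
Context d d' (T : measurableType d) (T' : measurableType d') (R : realType).
Variables (P : probability T R) (X : nat -> {RV P >-> T'}).
Hypothesis Xid : identically_distributed X.

Lemma identically_distributed_itg i (h : T' -> R) : measurable_fun [set: T'] h ->
  itg P (fun t => h (X 0%N t)) ->
  itg P (fun t => h (X i t)) /\ \int[P]_t h (X i t) = \int[P]_t h (X 0%N t).
Proof.
move=> mh ih.
have mX j : measurable_fun [set: T] (fun t => h (X j t)).
  exact: (measurableT_comp mh (measurable_funPT (X j))).
have eqm (f : T' -> \bar R) :
    (\int[distribution P (X i)]_y f y = \int[distribution P (X 0%N)]_y f y)%E.
  by apply: eq_measure_integral => A mA _; exact: Xid.
have ihi : itg P (fun t => h (X i t)).
  apply/integrableP; split; first exact/measurable_EFinP.
  have mn : measurable_fun [set: T'] (fun y => `|(h y)%:E|%E).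
    by do 2 apply: measurableT_comp => //.
  move/integrableP : ih => [_]; apply: le_lt_trans.
  have := eqm (fun y => `|(h y)%:E|%E).
  by rewrite !ge0_integral_distribution// => ->.
split => //; rewrite /Rintegral; congr fine.
have := eqm (EFin \o h); rewrite !integral_distribution//; exact/measurable_EFinP.
Qed.

End identical_distribution.

Lemma pow_sub_le (R : realType) (a b : R) n : `|a| <= 1 -> `|b| <= 1 ->
  `|a ^+ n - b ^+ n| <= n%:R * `|a - b|.
Proof.
move=> a1 b1; elim: n => [|n ih]; first by rewrite !expr0 subrr normr0 mul0r.
rewrite !exprS (_ : _ - _ = a * (a ^+ n - b ^+ n) + (a - b) * b ^+ n); last by ring.
rewrite (le_trans (ler_normD _ _))// !normrM -natr1 mulrDl mul1r lerD//.
  by rewrite (le_trans _ ih)// ler_piMl.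
by rewrite ler_piMr// normrX exprn_ile1.
Qed.

Section central_limit.
Context d d' (T : measurableType d) (T' : measurableType d') (R : realType).
Variables (P : probability T R) (X : nat -> {RV P >-> T'}).
Hypothesis Xind : mutually_independent X.
Hypothesis Xid : identically_distributed X.
Variable h : T' -> R.
Hypothesis mh : measurable_fun [set: T'] h.
Hypothesis ih2 : itg P (fun t => h (X 0%N t) ^+ 2).
Hypothesis h_centered : \int[P]_t h (X 0%N t) = 0.
Local Notation s2 := (\int[P]_t h (X 0%N t) ^+ 2).

(** The comparison is with [u n], whose power [n + 1] equals the limit exactly. By [pow_sub_le] it
    remains to see that [(n + 1) (1 - a n)] and [(n + 1) (1 - u n)] have the same limit, while the
    sine part contributes at most [(n + 1) |b n|], which tends to 0. Frequency one suffices because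
    [h] is arbitrary. *)
Lemma clt_characteristic_function :
  \int[P]_t cos ((Num.sqrt n%:R)^-1 * \sum_(0 <= i < n) h (X i t)) @[n --> \oo] -->
  expR (- (s2 / 2)).
Proof.
pose c (n : nat) : R := (Num.sqrt n.+1%:R)^-1.
have s0 n : 0 < Num.sqrt (n.+1%:R : R) by rewrite sqrtr_gt0.
have c0 n : 0 < c n by rewrite invr_gt0.
have c2 n : (c n ^+ 2)^-1 = n.+1%:R by rewrite exprVn invrK sqr_sqrtr.
have nn n : n.+1%:R * c n ^+ 2 = 1.
  by rewrite -c2 mulVf// expf_eq0/= gt_eqF.
have cc : c n @[n --> \oo] --> (0 : R).
  rewrite (_ : c = fun n => Num.sqrt (harmonic n)); last first.
    by apply/funext => n; rewrite /c /harmonic sqrtrV.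
  rewrite -[X in _ --> X]sqrtr0; apply: continuous_cvg; first exact: sqrt_continuous.
  exact: cvg_harmonic.
have mhX : measurable_fun [set: T] (fun t => h (X 0%N t)).
  exact: (measurableT_comp mh (measurable_funPT (X 0%N))).
pose a n := \int[P]_t cos (c n * h (X 0%N t)).
pose b n := \int[P]_t sin (c n * h (X 0%N t)).
have ca := cvg_small_frequency_cos mhX ih2 c0 cc.
have cb := cvg_small_frequency_sin mhX ih2 c0 cc h_centered.
have sE : 0 <= s2 / 2 by rewrite divr_ge0// Rintegral_ge0// => t _; exact: sqr_ge0.
pose u n := expR (- (s2 / 2 * (c n ^+ 2))).
have un n : u n ^+ n.+1 = expR (- (s2 / 2)).
  rewrite /u -expRM_natl; congr expR.
  by rewrite mulrN mulrCA nn mulr1.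
have cu : n.+1%:R * (1 - u n) @[n --> \oo] --> s2 / 2.
  have c2cvg : c n ^+ 2 @[n --> \oo] --> (0 : R).
    by rewrite -[X in _ --> X](mulr0 0); under eq_fun do rewrite expr2; exact: cvgM.
  apply: (@squeeze_cvgr _ _ _ _ (fun n => s2 / 2 - (s2 / 2) ^+ 2 / 2 * c n ^+ 2)
     (cst (s2 / 2))); last exact: cvg_cst.
    apply: nearW => n; have cn2 : 0 < c n ^+ 2 by rewrite exprn_gt0.
    have /andP[h1 h2] := expRN_bound (mulr_ge0 sE (ltW cn2)).
    have n1 : (0:R) <= n.+1%:R by [].
    have := ler_wpM2l n1 h1; have := ler_wpM2l n1 h2.
    rewrite -/(u n).
    have -> : n.+1%:R * (s2 / 2 * c n ^+ 2) = s2 / 2 by rewrite mulrCA nn mulr1.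
    have -> : n.+1%:R * (s2 / 2 * c n ^+ 2 - (s2 / 2 * c n ^+ 2) ^+ 2 / 2) =
      (n.+1%:R * c n ^+ 2) * (s2 / 2 - (s2 / 2) ^+ 2 / 2 * c n ^+ 2) by ring.
    by rewrite nn mul1r /cst => -> ->.
  rewrite -[X in _ --> X]subr0 -[X in _ - X](mulr0 ((s2 / 2) ^+ 2 / 2)).
  by apply: cvgB; [exact: cvg_cst|exact: cvgMl_tmp].
rewrite -(cvg_shiftS (fun n => \int[P]_t cos _))/=.
have key n : `|\int[P]_t cos (c n * \sum_(0 <= i < n.+1) h (X i t)) - expR (- (s2 / 2))|
    <= `|n.+1%:R * b n| + `|n.+1%:R * (1 - a n) - n.+1%:R * (1 - u n)|.
  have hm (i : nat) : measurable_fun [set: T'] (fun y => c n * h y) by exact: measurable_funM.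
  have mcos : measurable_fun [set: T'] (fun y => cos (c n * h y)).
    by apply: measurable_fun_cos; exact: (hm 0%N).
  have msin : measurable_fun [set: T'] (fun y => sin (c n * h y)).
    by apply: measurable_fun_sin; exact: (hm 0%N).
  have mcX : measurable_fun [set: T] (fun t => c n * h (X 0%N t)) by exact: measurable_funM.
  have := @Rint_cos_sum_iid _ _ _ _ _ _ _ Xind (fun _ y => c n * h y) hm (a n) (b n) (index_iota 0 n.+1)
    (iota_uniq _ _)
    (fun i => (identically_distributed_itg Xid i mcos (itg_cos P mcX)).2)
    (fun i => (identically_distributed_itg Xid i msin (itg_sin P mcX)).2).
  rewrite size_iota subn0 => k1.
  under eq_Rintegral do rewrite mulr_sumr.
  rewrite -(un n) -[X in `|X|](subrKA (a n ^+ n.+1)).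
  rewrite (le_trans (ler_normD _ _))// lerD//.
    by rewrite normrM (ger0_norm (ler0n _ _)).
  have a1 : `|a n| <= 1 by exact: (Rint_cos_le1 P mcX).
  have u1 : `|u n| <= 1.
    rewrite ger0_norm ?expR_ge0// -expR0 ler_expR oppr_le0 mulr_ge0// sqr_ge0//.
  rewrite (le_trans (pow_sub_le _ a1 u1))// -mulrBr normrM (ger0_norm (ler0n _ _)).
  by rewrite (_ : 1 - a n - (1 - u n) = - (a n - u n)) ?normrN//; ring.
apply/cvgrPdist_le => eps eps0.
have lim0 : `|n.+1%:R * b n| + `|n.+1%:R * (1 - a n) - n.+1%:R * (1 - u n)|
    @[n --> \oo] --> (0 : R).
  have -> : (0 : R) = `|0 : R| + `|s2 / 2 - s2 / 2| by rewrite subrr normr0 addr0.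
  apply: cvgD; apply: cvg_norm.
    by move: cb; under eq_fun do rewrite c2.
  apply: cvgB => //.
  by move: ca; under eq_fun do rewrite c2.
have /cvgrPdist_le/(_ _ eps0) := lim0; apply: filterS => n.
rewrite sub0r normrN ger0_norm ?addr_ge0// => hn.
by apply: le_trans hn; rewrite distrC; exact: key.
Qed.

End central_limit.

(** * Laplace transforms of quadratic forms *)

Section bounded_Fubini.
Context d d' (T : measurableType d) (T' : measurableType d') (R : realType).
Variables (P : probability T R) (Q : probability T' R).
Variables (f : T * T' -> R) (M : R).
Hypothesis mf : measurable_fun [set: T * T'] f.
Hypothesis fM : forall z, `|f z| <= M.

Let mf1 x : measurable_fun [set: T'] (fun y => f (x, y)).
Proof. by apply: measurableT_comp => //; exact: measurable_pair1. Qed.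

Let mf2 y : measurable_fun [set: T] (fun x => f (x, y)).
Proof. by apply: measurableT_comp => //; exact: measurable_pair2. Qed.

Let if1 x : itg Q (fun y => f (x, y)).
Proof. by apply: (itg_bounded _ (mf1 x)) => y; exact: fM. Qed.

Let if2 y : itg P (fun x => f (x, y)).
Proof. by apply: (itg_bounded _ (mf2 y)) => x; exact: fM. Qed.

Let ifPQ : (P \x Q)%E.-integrable setT (EFin \o f).
Proof.
apply/integrable12ltyP => /=; first exact/measurable_EFinP.
apply: (@le_lt_trans _ _ (\int[P]_x M%:E)%E); last first.
  by rewrite integral_cst//= probability_setT mule1 ltry.
apply: ge0_le_integral => //.
- by move=> x _; apply: integral_ge0.
- apply: (measurable_fun_fubini_tonelli_F (fun z => `|(f z)%:E|%E)) => //.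
  by apply: measurableT_comp => //; exact/measurable_EFinP.
- move=> x _; rewrite (Rint_EFin (itg_norm (if1 x))) lee_fin.
  rewrite -[leRHS](@Rint_cst _ _ _ Q); apply: le_Rintegral => //.
  + exact: itg_norm.
  + exact: itg_cst.
Qed.

Lemma Fubini_bounded :
  \int[P]_x \int[Q]_y f (x, y) = \int[Q]_y \int[P]_x f (x, y).
Proof.
rewrite /Rintegral; congr fine.
transitivity (\int[P]_x \int[Q]_y (f (x, y))%:E)%E.
  by apply: eq_integral => x _; rewrite -Rint_EFin.
rewrite [LHS](Fubini ifPQ).
by apply: eq_integral => y _; rewrite -Rint_EFin.
Qed.

Lemma measurable_Rintegral_snd : measurable_fun [set: T'] (fun y => \int[P]_x f (x, y)).
Proof.
apply/measurable_EFinP.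
have := measurable_fubini_G ifPQ; congr (measurable_fun _ _).
by apply/funext => y; rewrite /= -Rint_EFin.
Qed.

End bounded_Fubini.

Section gaussian_sequence.
Context d (T : measurableType d) (R : realType) (Q : probability T R).
Variable N : nat -> {RV Q >-> R}.
Hypothesis N_indep : mutually_independent N.
Hypothesis N_normal : forall i, std_normal (N i).

Let mN i : measurable_fun [set: T] (N i). Proof. exact: measurable_funPT. Qed.

Let c (n : nat) : R := n.+1%:R^-1.
Let c_gt0 n : 0 < c n. Proof. by rewrite invr_gt0. Qed.
Let c_cvg0 : c n @[n --> \oo] --> (0 : R). Proof. exact: cvg_harmonic. Qed.

Let half_limit i : (c n ^+ 2)^-1 * (1 - \int[Q]_t cos (c n * N i t)) @[n --> \oo] -->
  (2^-1 : R).
Proof.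
under eq_fun do rewrite std_normal_cos//.
have c2cvg : c n ^+ 2 @[n --> \oo] --> (0 : R).
  by rewrite -[X in _ --> X](mulr0 0); under eq_fun do rewrite expr2; exact: cvgM.
apply: (@squeeze_cvgr _ _ _ _ (fun n => 2^-1 - 8^-1 * c n ^+ 2) (cst 2^-1));
  last exact: cvg_cst.
  apply: nearW => n; have cn2 : 0 < c n ^+ 2 by rewrite exprn_gt0.
  have /expRN_bound/andP[h1 h2] : 0 <= c n ^+ 2 / 2 by rewrite divr_ge0// ltW.
  rewrite /cst ler_pdivlMl// ler_pdivrMl// h2 andbT; apply: le_trans h1.
  by rewrite le_eqVlt; apply/orP; left; apply/eqP; field.
rewrite -[X in _ --> X]subr0 -[X in _ - X](mulr0 8^-1).
by apply: cvgB; [exact: cvg_cst|exact: cvgMl_tmp].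
Qed.

(** The second moment is read off the characteristic function: [2 (1 - cos (c N)) / c^2] is
    nonnegative and tends to [N^2] as [c] tends to 0, with integrals tending to 1, so Fatou
    applies. *)
Lemma itg_normal_sqr i : itg Q (fun t => N i t ^+ 2).
Proof.
have mN2 : measurable_fun [set: T] (fun t => N i t ^+ 2) by exact: measurable_funX.
apply: itg_ge0_lty => //; first by move=> t; exact: sqr_ge0.
pose u n t := 2 * ((c n ^+ 2)^-1 * (1 - cos (c n * N i t))).
have mcN n : measurable_fun [set: T] (fun t => c n * N i t) by exact: measurable_funM.
have mu' n : measurable_fun [set: T] (u n).
  do 2 apply: measurable_funM => //; apply: measurable_funB => //.
  exact: measurable_fun_cos.
have u0 n t : 0 <= u n t.
  apply: mulr_ge0 => //; apply: mulr_ge0; first by rewrite invr_ge0 sqr_ge0.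
  by have /andP[] := cos_bound (c n * N i t).
have iu n : \int[Q]_t u n t =
    2 * ((c n ^+ 2)^-1 * (1 - \int[Q]_t cos (c n * N i t))).
  have i1 : itg Q (fun t => 1 - cos (c n * N i t)).
    by apply: itgB; [exact: itg_cst|exact: itg_cos].
  rewrite RintegralZl//; last exact: itgZ.
  by rewrite RintegralZl// RintegralB// ?Rint_cst//; [exact: itg_cst|exact: itg_cos].
have iuE n : itg Q (u n).
  apply: itgZ; apply: itgZ; apply: itgB; [exact: itg_cst|exact: itg_cos].
have uN t : u n t @[n --> \oo] --> N i t ^+ 2.
  apply/cvgrPdist_le => eps eps0.
  have : c n * (2 * `|N i t| ^+ 3) @[n --> \oo] --> (0 : R).
    by rewrite -[X in _ --> X](mul0r (2 * `|N i t| ^+ 3)); apply: cvgMr_tmp.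
  move=> /cvgrPdist_le/(_ _ eps0); apply: filterS => n.
  rewrite sub0r normrN ger0_norm ?mulr_ge0 ?exprn_ge0 ?(ltW (c_gt0 n))//; apply: le_trans.
  have -> : N i t ^+ 2 - u n t =
    2 * ((c n ^+ 2)^-1 * ((c n * N i t) ^+ 2 / 2 - (1 - cos (c n * N i t)))).
    by rewrite /u; field; rewrite gt_eqF.
  have c2 : 0 < (c n ^+ 2)^-1 by rewrite invr_gt0 exprn_gt0.
  rewrite !normrM (ger0_norm (ltW c2)) (ger0_norm (ler0n _ 2)) [leRHS]mulrCA ler_pM2l//.
  rewrite ler_pdivrMl ?exprn_gt0//; apply: le_trans (cos_sub_cube _) _.
  rewrite normrM (ger0_norm (ltW (c_gt0 n))).
  by rewrite le_eqVlt; apply/orP; left; apply/eqP; ring.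
have -> : (\int[Q]_t (N i t ^+ 2)%:E = \int[Q]_t limn_einf (fun n => (u n t)%:E))%E.
  apply: eq_integral => t _; apply/esym/(fun h => (cvg_limn_einf_sup h).1).
  by apply: cvg_EFin; [exact: nearW|exact: uN].
apply: le_lt_trans (fatou Q measurableT _ _) _.
- by move=> n; exact/measurable_EFinP.
- by move=> n t _; rewrite lee_fin.
have cu : (\int[Q]_t (u n t)%:E)%E @[n --> \oo] --> 1%E.
  under eq_fun do rewrite Rint_EFin// iu.
  apply: cvg_EFin; first exact: nearW.
  rewrite -[X in _ --> X](@divff _ 2)//.
  by apply: cvgMl_tmp; exact: half_limit.
by rewrite (cvg_limn_einf_sup cu).1 ltry.
Qed.

(** Integrability being known, [cvg_small_frequency_cos] gives a second expression for the limit in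
    [half_limit]. *)
Lemma Rint_normal_sqr i : \int[Q]_t N i t ^+ 2 = 1.
Proof.
have h := cvg_small_frequency_cos (mN i) (itg_normal_sqr i) c_gt0 c_cvg0.
have e := cvg_unique (@norm_hausdorff _ _) h (half_limit i).
by rewrite -[LHS](@divfK _ 2)// e mulVf.
Qed.

(** The variables [sin (c N) / c] have mean zero, are dominated by [|N|], and tend to [N] as [c]
    tends to 0. *)
Lemma Rint_normal i : \int[Q]_t N i t = 0.
Proof.
have iN : itg Q (N i) by apply: itg_sqr_itg => //; exact: itg_normal_sqr.
have ci n : 0 < (c n)^-1 by rewrite invr_gt0.
have h : \int[Q]_t ((c n)^-1 * sin (c n * N i t)) @[n --> \oo] --> \int[Q]_t N i t.
  apply: (Rintegral_dct _ (itg_norm iN) _ _).2.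
  - move=> n; apply: measurable_funM => //; apply: measurable_fun_sin.
    exact: measurable_funM.
  - move=> n t; rewrite normrM (ger0_norm (ltW (ci n))).
    rewrite ler_pdivrMl//; apply: le_trans (abs_sin_le _) _.
    by rewrite normrM (ger0_norm (ltW (c_gt0 n))).
  - move=> t; apply/cvgrPdist_le => eps eps0.
    have : c n * N i t ^+ 2 @[n --> \oo] --> (0 : R).
      by rewrite -[X in _ --> X](mul0r (N i t ^+ 2)); apply: cvgMr_tmp.
    move=> /cvgrPdist_le/(_ _ eps0); apply: filterS => n.
    rewrite sub0r normrN (ger0_norm (mulr_ge0 (ltW (c_gt0 n)) (sqr_ge0 _))); apply: le_trans.
    have -> : N i t - (c n)^-1 * sin (c n * N i t) =
      - ((c n)^-1 * (sin (c n * N i t) - c n * N i t)) by field; rewrite gt_eqF.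
    rewrite normrN normrM (ger0_norm (ltW (ci n))).
    rewrite ler_pdivrMl//; apply: le_trans (sin_sub_sqr _) _.
    by rewrite le_eqVlt; apply/orP; left; apply/eqP; ring.
have h0 : \int[Q]_t ((c n)^-1 * sin (c n * N i t)) @[n --> \oo] --> (0 : R).
  apply: cvg_near_cst; apply: nearW => k.
  rewrite RintegralZl//; first by rewrite std_normal_sin// mulr0.
  by apply: itg_sin; exact: measurable_funM.
exact: (cvg_unique (@norm_hausdorff _ _) h h0).
Qed.

Lemma Rint_cos_gaussian_sum (a : nat -> R) m :
  \int[Q]_t cos (\sum_(0 <= k < m) a k * N k t) =
  expR (- ((\sum_(0 <= k < m) a k ^+ 2) / 2)).
Proof.
have ma (k : nat) : measurable_fun [set: R] ( *%R (a k)) by exact: measurable_funM.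
rewrite (@Rint_cos_sum_symmetric _ _ _ _ _ _ _ N_indep (fun k => *%R (a k)) ma
  (fun k => expR (- (a k ^+ 2 / 2)))) ?iota_uniq//.
- rewrite -expR_sum; congr expR; rewrite mulr_suml -sumrN.
  by apply: eq_bigr.
- by move=> k; exact: std_normal_cos.
- by move=> k; exact: std_normal_sin.
Qed.

Lemma Rint_gaussian_sum_sqr (a : nat -> R) m :
  itg Q (fun t => (\sum_(0 <= k < m) a k * N k t) ^+ 2) /\
  \int[Q]_t (\sum_(0 <= k < m) a k * N k t) ^+ 2 = \sum_(0 <= k < m) a k ^+ 2.
Proof.
have ma (k : nat) : measurable_fun [set: R] ( *%R (a k)) by exact: measurable_funM.
have iN k : itg Q (N k) by apply: itg_sqr_itg => //; exact: itg_normal_sqr.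
have e2 k t : (a k * N k t) ^+ 2 = a k ^+ 2 * N k t ^+ 2 by rewrite exprMn.
have := @Rint_sqr_sum _ _ _ _ _ _ _ N_indep (fun k => *%R (a k)) ma (index_iota 0 m)
  (iota_uniq _ _).
case.
- move=> k; under [X in itg Q X]eq_fun do rewrite e2.
  by apply: itgZ; exact: itg_normal_sqr.
- by move=> k; rewrite RintegralZl// Rint_normal mulr0.
move=> h1 h2; split => //; rewrite h2; apply: eq_bigr => k _.
under eq_Rintegral do rewrite e2.
by rewrite RintegralZl// ?Rint_normal_sqr ?mulr1//; exact: itg_normal_sqr.
Qed.

Lemma gaussian_linearization d' (T' : measurableType d') (P : probability T' R)
    (U : nat -> T' -> R) m (s : R) : 0 <= s ->
  (forall k, measurable_fun [set: T'] (U k)) ->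
  \int[P]_x expR (- (s * \sum_(0 <= k < m) U k x ^+ 2)) =
  \int[Q]_t \int[P]_x cos (Num.sqrt (2 * s) * \sum_(0 <= k < m) N k t * U k x) /\
  measurable_fun [set: T]
   (fun t => \int[P]_x cos (Num.sqrt (2 * s) * \sum_(0 <= k < m) N k t * U k x)).
Proof.
move=> s0 mU.
pose f (z : T' * T) := cos (Num.sqrt (2 * s) * \sum_(0 <= k < m) N k z.2 * U k z.1).
have mf : measurable_fun [set: T' * T] f.
  apply: measurable_fun_cos; apply: measurable_funM => //.
  apply: measurable_sum => k; apply: measurable_funM.
    exact: (measurableT_comp (mN k) measurable_snd).
  exact: (measurableT_comp (mU k) measurable_fst).
have f1 z : `|f z| <= 1 by exact: cos_max.
split; last exact: (measurable_Rintegral_snd P Q mf f1).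
rewrite -(Fubini_bounded P Q mf f1); apply: eq_Rintegral => x _; rewrite /f/=.
under eq_Rintegral do (rewrite mulr_sumr; under eq_bigr do rewrite mulrCA mulrC).
transitivity (\int[Q]_t cos (\sum_(0 <= k < m) (Num.sqrt (2 * s) * U k x) * N k t)).
  rewrite Rint_cos_gaussian_sum; congr (expR (- _)).
  under [in RHS]eq_bigr do rewrite exprMn sqr_sqrtr ?mulr_ge0//.
  by rewrite -mulr_sumr; field.
apply: eq_Rintegral => t _; congr cos; apply: eq_bigr => k _; ring.
Qed.

(* Linearizing either side gives the average of [cos (sqrt (2s) <b^T N, N'>)]
   over two independent Gaussian sequences [N] and [N']. *)
Lemma gaussian_duality (b : nat -> nat -> R) p m (s : R) : 0 <= s ->
  \int[Q]_t expR (- (s * \sum_(0 <= j < p) (\sum_(0 <= k < m) b j k * N k t) ^+ 2)) =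
  \int[Q]_t expR (- (s * \sum_(0 <= k < m) (\sum_(0 <= j < p) b j k * N j t) ^+ 2)).
Proof.
move=> s0.
have mU j : measurable_fun [set: T] (fun t => \sum_(0 <= k < m) b j k * N k t).
  by apply: measurable_sum => k; exact: measurable_funM.
have [-> _] := gaussian_linearization Q p s0 mU.
apply: eq_Rintegral => t _.
transitivity (\int[Q]_x cos (\sum_(0 <= k < m)
    (Num.sqrt (2 * s) * \sum_(0 <= j < p) b j k * N j t) * N k x)).
  apply: eq_Rintegral => x _; congr cos; rewrite mulr_sumr.
  under eq_bigr do rewrite !mulr_sumr.
  rewrite exchange_big/=; apply: eq_bigr => k _.
  rewrite mulr_sumr mulr_suml; apply: eq_bigr => j _; ring.
rewrite Rint_cos_gaussian_sum; congr (expR (- _)).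
under eq_bigr do rewrite exprMn sqr_sqrtr ?mulr_ge0//.
by rewrite -mulr_sumr; field.
Qed.

End gaussian_sequence.

Lemma expRN_lipschitz (R : realType) (s x y : R) : 0 <= s -> 0 <= x -> 0 <= y ->
  `|expR (- (s * x)) - expR (- (s * y))| <= s * `|x - y|.
Proof.
move=> s0; wlog xy : x y / x <= y.
  move=> h x0 y0; have [xy|yx] := leP x y; first exact: h.
  by rewrite distrC (distrC x); apply: h => //; exact: ltW.
move=> x0 y0; have -> : expR (- (s * y)) = expR (- (s * x)) * expR (- (s * (y - x))).
  by rewrite -expRD; congr expR; ring.
have yx0 : 0 <= y - x by rewrite subr_ge0.
have /andP[_ h] := expRN_bound (mulr_ge0 s0 yx0).
have h1 : expR (- (s * (y - x))) <= 1.
  by rewrite -expR0 ler_expR oppr_le0 mulr_ge0.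
have h2 : expR (- (s * x)) <= 1 by rewrite -expR0 ler_expR oppr_le0 mulr_ge0.
rewrite -[X in X - _]mulr1 -mulrBr normrM ger0_norm ?expR_ge0// ger0_norm ?subr_ge0//.
by rewrite distrC (ger0_norm yx0) (le_trans _ h)// ler_piMl// subr_ge0.
Qed.

(** * The statistic in frozen dimension and its truncation error *)

Section statistic.
Context d (T : measurableType d) (R : realType) (P : probability T R).
Variable Z : nat -> {RV P >-> l2 R}.
Hypothesis Z_indep : mutually_independent Z.
Hypothesis Z_ident : identically_distributed Z.
Hypothesis Z_centered : is_expectation P (Z 0%N) 0.
Hypothesis iZ : itg P (fun t => `|Z 0%N t| ^+ 2).
Local Notation B := (@cov_form _ _ _ P (Z 0%N)).
Local Notation Gam k := (B (l2_delta k) (l2_delta k)).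

(** The trace of the covariance beyond the first [m] coordinates, [E sum_(k >= m) (Z^(k))^2],
    written as a difference to avoid an infinite sum. *)
Definition variance_tail m :=
  \int[P]_t `|Z 0%N t| ^+ 2 - \sum_(0 <= k < m) Gam k.

Let mZ i : measurable_fun [set: T] (Z i). Proof. exact: measurable_funPT. Qed.
Let mZk i k : measurable_fun [set: T] (fun t => Z i t k).
Proof. exact: (measurableT_comp (measurable_l2_coord k) (mZ i)). Qed.

Let GamE k : Gam k = \int[P]_t (Z 0%N t k) ^+ 2.
Proof. by apply: eq_Rintegral => t _; rewrite l2dot_delta expr2. Qed.

Let iZk k : itg P (fun t => Z 0%N t k ^+ 2).
Proof.
by have := itg_l2dot_sqr iZ (l2_delta k); under eq_fun do rewrite l2dot_delta.
Qed.

Let sum_GamE m : \sum_(0 <= k < m) Gam k =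
  \int[P]_t \sum_(0 <= k < m) Z 0%N t k ^+ 2.
Proof. by rewrite Rint_sum//; apply: eq_bigr => k _. Qed.

Lemma cvg_variance_tail : variance_tail m @[m --> \oo] --> 0.
Proof.
rewrite -[X in _ --> X](subrr (\int[P]_t `|Z 0%N t| ^+ 2)).
apply: cvgB; first exact: cvg_cst.
under eq_fun do rewrite sum_GamE.
apply: (Rintegral_dct _ iZ _ _).2.
- by move=> m; apply: measurable_sum => k; exact: measurable_funX.
- move=> m t; rewrite ger0_norm ?l2_partial_norm_le// sumr_ge0// => k _.
  exact: sqr_ge0.
- by move=> t; exact: cvg_l2_sqr_norm.
Qed.

Lemma sum_variance_le m n : (m <= n)%N ->
  \sum_(m <= k < n) Gam k <= variance_tail m.
Proof.
move=> mn; rewrite lerBrDl -big_cat_nat// sum_GamE; apply: le_Rintegral => //.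
  by apply: itg_sum => k _.
by move=> t _; exact: l2_partial_norm_le.
Qed.

Lemma variance_tail_ge0 m : 0 <= variance_tail m.
Proof. by have := sum_variance_le (leqnn m); rewrite big_geq. Qed.

Let U n k t := (Num.sqrt n%:R)^-1 * \sum_(0 <= i < n) Z i t k.

Let mU n k : measurable_fun [set: T] (U n k).
Proof. by apply: measurable_funM => //; exact: measurable_sum. Qed.

Lemma V_statE m n t : V_stat Z m n t =
  \sum_(0 <= k < m) ((Num.sqrt n%:R)^-1 * \sum_(0 <= i < n) Z i t k) ^+ 2.
Proof.
rewrite /V_stat /euclidean_norm sqr_sqrtr; last first.
  by apply: sumr_ge0 => k _; exact: sqr_ge0.
rewrite mulr_sumr big_mkord; apply: eq_bigr => k _.
rewrite /truncated_mean mxE summxE big_mkord exprMn exprMn exprVn exprVn sqr_sqrtr//.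
under eq_bigr do rewrite mxE.
rewrite mulrA; congr (_ * _).
(* At [n = 0] both sides vanish, thanks to the convention [0^-1 = 0]. *)
have [->|n0] := eqVneq (n%:R : R) 0; first by rewrite mul0r invr0.
by field.
Qed.

Lemma measurable_V_stat m n : measurable_fun [set: T] (V_stat Z m n).
Proof.
rewrite (_ : V_stat Z m n = fun t => \sum_(0 <= k < m) (U n k t) ^+ 2).
  by apply: measurable_sum => k; exact: measurable_funX.
by apply/funext => t; exact: V_statE.
Qed.

Lemma V_stat_ge0 m n t : 0 <= V_stat Z m n t.
Proof. by rewrite mulr_ge0// sqr_ge0. Qed.

(** Equality holds for [n > 0]; the inequality also covers [n = 0], where [U] vanishes. *)
Let U_second_moment n k : itg P (fun t => U n k t ^+ 2) /\
  \int[P]_t U n k t ^+ 2 <= Gam k.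
Proof.
have mc (i : nat) : measurable_fun [set: l2 R] (fun x : l2 R => x k).
  exact: measurable_l2_coord.
have mc2 : measurable_fun [set: l2 R] (fun x : l2 R => x k ^+ 2).
  exact: (measurable_funX 2 (mc 0%N)).
have Zk0 : \int[P]_t Z 0%N t k = 0.
  have := Rint_l2dot_centered iZ Z_centered (l2_delta k).
  by under eq_Rintegral do rewrite l2dot_delta.
have iZk1 : itg P (fun t => Z 0%N t k) by exact: itg_sqr_itg.
have idk2 i := identically_distributed_itg Z_ident i mc2 (iZk k).
have idk i := identically_distributed_itg Z_ident i (mc 0%N) iZk1.
have [h1 h2] := Rint_sqr_sum Z_indep mc (iota_uniq 0 (n - 0))
  (fun i => (idk2 i).1) (fun i => etrans (idk i).2 Zk0).
have e t : U n k t ^+ 2 = (Num.sqrt n%:R)^-1 ^+ 2 * (\sum_(0 <= i < n) Z i t k) ^+ 2.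
  by rewrite exprMn.
split; first by under [X in itg P X]eq_fun do rewrite e; exact: itgZ.
under eq_Rintegral do rewrite e.
rewrite RintegralZl// exprVn sqr_sqrtr// h2.
under eq_bigr do rewrite (idk2 _).2 -GamE.
rewrite big_const_nat iter_addr_0 subn0.
have [->|n0] := eqVneq n 0%N; first by rewrite mulr0n mulr0 cov_form_ge0.
by rewrite -[X in _ * X]mulr_natr mulrCA mulVf ?mulr1// pnatr_eq0.
Qed.

Lemma Rint_V_stat_le m n : itg P (V_stat Z m n) /\
  \int[P]_t V_stat Z m n t <= \sum_(0 <= k < m) Gam k.
Proof.
rewrite (_ : V_stat Z m n = fun t => \sum_(0 <= k < m) U n k t ^+ 2); last first.
  by apply/funext => t; exact: V_statE.
split; first by apply: itg_sum => k _; exact: (U_second_moment n k).1.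
rewrite Rint_sum => [|k _]; last exact: (U_second_moment n k).1.
by apply: ler_sum => k _; exact: (U_second_moment n k).2.
Qed.

Lemma Laplace_truncation s m dm n : 0 <= s -> (m <= dm)%N ->
  `|\int[P]_t expR (- (s * V_stat Z dm n t)) - \int[P]_t expR (- (s * V_stat Z m n t))|
  <= s * variance_tail m.
Proof.
move=> s0 mdm.
have ie k : itg P (fun t => expR (- (s * V_stat Z k n t))).
  apply: (@itg_bounded _ _ _ P _ 1).
    apply: measurableT_comp => //; apply: measurableT_comp => //.
    by apply: measurable_funM => //; exact: measurable_V_stat.
  move=> t; rewrite ger0_norm ?expR_ge0// -expR0 ler_expR oppr_le0.
  by rewrite mulr_ge0// V_stat_ge0.
have diff t : V_stat Z dm n t - V_stat Z m n t = \sum_(m <= k < dm) U n k t ^+ 2.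
  by rewrite !V_statE (big_cat_nat _ mdm)//= addrAC subrr add0r.
have iU : itg P (fun t => \sum_(m <= k < dm) U n k t ^+ 2).
  by apply: itg_sum => k _; exact: (U_second_moment n k).1.
rewrite -RintegralB//; apply: le_trans (le_normr_Rintegral measurableT _) _.
  exact: itgB.
apply: (@le_trans _ _ (\int[P]_t (s * \sum_(m <= k < dm) U n k t ^+ 2))).
  apply: le_Rintegral => //; [exact/itg_norm/itgB|exact: itgZ|].
  move=> t _; apply: le_trans (expRN_lipschitz s0 (V_stat_ge0 _ _ _) (V_stat_ge0 _ _ _)) _.
  by rewrite diff ger0_norm// sumr_ge0// => k _; exact: sqr_ge0.
rewrite RintegralZl// ler_wpM2l//; apply: le_trans (sum_variance_le mdm).
rewrite Rint_sum; last by move=> k _; exact: (U_second_moment n k).1.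
by apply: ler_sum => k _; exact: (U_second_moment n k).2.
Qed.

Context d' (T' : measurableType d') (Q : probability T' R).
Variable N : nat -> {RV Q >-> R}.
Hypothesis N_indep : mutually_independent N.
Hypothesis N_normal : forall i, std_normal (N i).

Let v m t' := l2_fin m (fun k => N k t').

Lemma Laplace_clt s m : 0 <= s ->
  \int[P]_t expR (- (s * V_stat Z m n t)) @[n --> \oo] -->
  \int[Q]_t' expR (- (s * B (v m t') (v m t'))).
Proof.
move=> s0.
have lin n := gaussian_linearization N_indep N_normal P m s0 (mU n).
have -> : (fun n => \int[P]_t expR (- (s * V_stat Z m n t))) = (fun n =>
    \int[Q]_t' \int[P]_t cos (Num.sqrt (2 * s) * \sum_(0 <= k < m) N k t' * U n k t)).
  apply/funext => n; rewrite -(lin n).1.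
  by apply: eq_Rintegral => t _; rewrite V_statE.
apply: (Rintegral_dct _ (itg_cst Q 1) _ _).2.
- by move=> n; exact: (lin n).2.
- move=> n t'; apply: Rint_cos_le1; apply: measurable_funM => //.
  by apply: measurable_sum => k; exact: measurable_funM.
(* For a frozen Gaussian vector, [u] absorbs the frequency [sqrt (2 s)], so half the variance of the
   projection on [u] is [s * B v v]. *)
move=> t'; pose u := Num.sqrt (2 * s) *: v m t'.
have mu' : measurable_fun [set: l2 R] (l2dot u) by exact: measurable_l2dot.
have := clt_characteristic_function Z_indep Z_ident mu' (itg_l2dot_sqr iZ u)
  (Rint_l2dot_centered iZ Z_centered u).
have -> : \int[P]_t l2dot u (Z 0%N t) ^+ 2 / 2 = s * B (v m t') (v m t').
  rewrite -[X in X / 2]/(B u u) cov_formZl// cov_formC cov_formZl//.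
  by rewrite mulrA -expr2 sqr_sqrtr ?mulr_ge0//; field.
apply: cvg_trans; apply: near_eq_cvg; apply: nearW => n.
apply: eq_Rintegral => t _; congr cos.
under [in LHS]eq_bigr do rewrite l2dotZl l2dot_finl.
rewrite -mulr_sumr mulrCA; congr (_ * _).
rewrite /U; under [in RHS]eq_bigr do rewrite mulrCA mulr_sumr.
by rewrite -mulr_sumr exchange_big.
Qed.

End statistic.

Section Laplace_limit.
Context d (T : measurableType d) (R : realType) (P : probability T R).
Variable Z : nat -> {RV P >-> l2 R}.
Hypothesis Z_indep : mutually_independent Z.
Hypothesis Z_ident : identically_distributed Z.
Hypothesis Z_centered : is_expectation P (Z 0%N) 0.
Hypothesis iZ : itg P (fun t => `|Z 0%N t| ^+ 2).
Context d' (T' : measurableType d') (Q : probability T' R).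
Variable N : nat -> {RV Q >-> R}.
Hypothesis N_indep : mutually_independent N.
Hypothesis N_normal : forall i, std_normal (N i).
Local Notation B := (@cov_form _ _ _ P (Z 0%N)).
Local Notation tail := (variance_tail Z).
Variables (e : nat -> l2 R) (lam : nat -> R).
Hypothesis e_orth : forall i j, l2dot (e i) (e j) = ((i == j) && (lam i != 0))%:R.
Hypothesis e_eigen : forall i y, B y (e i) = lam i * l2dot y (e i).
Hypothesis e_max : forall x r, r != 0 -> (forall y, B y x = r * l2dot y x) ->
  (forall i, l2dot x (e i) = 0) -> x = 0.

Let lam_ge0 i : 0 <= lam i.
Proof. exact: (eigenvalue_ge0 e_orth e_eigen). Qed.

Let mN i : measurable_fun [set: T'] (N i). Proof. exact: measurable_funPT. Qed.

Definition weighted_chi_square p t' := \sum_(0 <= j < p) lam j * N j t' ^+ 2.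
Local Notation S := weighted_chi_square.

Lemma measurable_weighted_chi_square p : measurable_fun [set: T'] (S p).
Proof.
by apply: measurable_sum => j; apply: measurable_funM => //; exact: measurable_funX.
Qed.

Lemma weighted_chi_square_ge0 p t' : 0 <= S p t'.
Proof. by apply: sumr_ge0 => j _; rewrite mulr_ge0// sqr_ge0. Qed.

Let lam_e j : lam j * `|e j| ^+ 2 = lam j.
Proof.
rewrite l2_sqr_norm e_orth eqxx/=.
by have [->|_] := eqVneq (lam j) 0; rewrite ?mul0r ?mulr1.
Qed.

(** The matrix [b] of the duality. It is a square root of the covariance, because [sum_j b j k * b j
    l = B (l2_delta k) (l2_delta l)]. *)
Let b j k := Num.sqrt (lam j) * e j k.

(** By Parseval the squares of row [j] of [b] sum to [lam j], so the left side is the contribution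
    of the columns [k >= m]. Each column contributes at most the variance of coordinate [k], by
    [spectral_sum_le]. *)
Let sum_b_tail m p :
  \sum_(0 <= j < p) lam j - \sum_(0 <= k < m) \sum_(0 <= j < p) b j k ^+ 2 <= tail m.
Proof.
have bE j k : b j k ^+ 2 = lam j * l2dot (l2_delta k) (e j) ^+ 2.
  by rewrite exprMn sqr_sqrtr// l2dot_delta.
have h : \sum_(0 <= k < n) \sum_(0 <= j < p) b j k ^+ 2 @[n --> \oo] -->
    \sum_(0 <= j < p) lam j.
  under eq_fun do rewrite exchange_big/=.
  rewrite (eq_bigr (fun j => lam j * `|e j| ^+ 2)); last by move=> j _; rewrite lam_e.
  apply: cvg_sumr => j _.
  under eq_fun do under eq_bigr do rewrite exprMn sqr_sqrtr//.
  under eq_fun do rewrite -mulr_sumr.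
  by apply: cvgMl_tmp; exact: cvg_l2_sqr_norm.
rewrite lerBlDr; rewrite -(cvg_lim _ h)//.
apply: limr_le; first by apply/cvg_ex; eexists; exact: h.
near=> n; have mn : (m <= n)%N by near: n; exact: nbhs_infty_ge.
rewrite (big_cat_nat _ mn)//= addrC lerD2r.
apply: le_trans (sum_variance_le iZ mn); apply: ler_sum => k _.
under eq_bigr do rewrite bE.
exact: (spectral_sum_le iZ e_orth e_eigen).
Unshelve. all: end_near. Qed.

Lemma trace_le p : \sum_(0 <= j < p) lam j <= \int[P]_t `|Z 0%N t| ^+ 2.
Proof. by have := sum_b_tail 0 p; rewrite /variance_tail ![\sum_(0 <= k < 0) _]big_geq// !subr0. Qed.

Lemma Rint_weighted_chi_square p : itg Q (S p) /\
  \int[Q]_t S p t = \sum_(0 <= j < p) lam j.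
Proof.
have iN j : itg Q (fun t => lam j * N j t ^+ 2) by apply: itgZ; exact: itg_normal_sqr.
split; first by apply: itg_sum => j _.
rewrite Rint_sum => [|j _//]; apply: eq_bigr => j _.
by rewrite RintegralZl ?Rint_normal_sqr ?mulr1//; exact: itg_normal_sqr.
Qed.

Let v m t' := l2_fin m (fun k => N k t').

Let exp_itg (f : T' -> R) s : 0 <= s -> measurable_fun [set: T'] f ->
  (forall t, 0 <= f t) -> itg Q (fun t => expR (- (s * f t))).
Proof.
move=> s0 mf f0; apply: (@itg_bounded _ _ _ Q _ 1).
  apply: measurableT_comp => //; apply: measurableT_comp => //.
  exact: measurable_funM.
by move=> t; rewrite ger0_norm ?expR_ge0// -expR0 ler_expR oppr_le0 mulr_ge0.
Qed.

(** After the duality both exponents live on one space and compare pathwise: [W t] is the squared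
    norm of the first [m] coordinates of [w = sum_j sqrt (lam j) N_j e_j], whose full squared norm
    is [S p t]. So only the means of [S p] and [W] have to be compared. *)
Let Laplace_spectral s m p : 0 <= s ->
  `|\int[Q]_t expR (- (s * \sum_(0 <= j < p) lam j * l2dot (v m t) (e j) ^+ 2)) -
    \int[Q]_t expR (- (s * S p t))| <= s * tail m.
Proof.
move=> s0; pose W t := \sum_(0 <= k < m) (\sum_(0 <= j < p) b j k * N j t) ^+ 2.
have -> : \int[Q]_t expR (- (s * \sum_(0 <= j < p) lam j * l2dot (v m t) (e j) ^+ 2)) =
    \int[Q]_t expR (- (s * W t)).
  apply: etrans (gaussian_duality N_indep N_normal b p m s0).
  apply: eq_Rintegral => t _; congr (expR (- (_ * _))).
  apply: eq_bigr => j _; rewrite l2dot_finl.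
  rewrite -[in LHS](sqr_sqrtr (lam_ge0 j)) -exprMn mulr_sumr; congr (_ ^+ 2).
  by apply: eq_bigr => k _; rewrite /b; ring.
have W0 t : 0 <= W t by apply: sumr_ge0 => k _; exact: sqr_ge0.
have WS t : W t <= S p t.
  pose w := \sum_(0 <= j < p) (Num.sqrt (lam j) * N j t) *: e j.
  have -> : W t = \sum_(0 <= k < m) w k ^+ 2.
    apply: eq_bigr => k _; rewrite /w l2_sumE; congr (_ ^+ 2).
    by apply: eq_bigr => j _; rewrite l2ZE /b; ring.
  apply: le_trans (l2_partial_norm_le w m) _.
  rewrite l2_sqr_norm {1}/w l2dot_suml le_eqVlt; apply/orP; left; apply/eqP.
  rewrite /S !big_mkord; apply: eq_bigr => j _.
  rewrite l2dotZl /w big_mkord l2dot_sumr (bigD1 j)//= big1 ?addr0; last first.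
    by move=> i ij; rewrite l2dotZr e_orth eq_sym val_eqE (negbTE ij) mulr0.
  rewrite l2dotZr -l2_sqr_norm -[in RHS](lam_e j).
  by rewrite -[in RHS](sqr_sqrtr (lam_ge0 j)); ring.
have mW : measurable_fun [set: T'] W.
  apply: measurable_sum => k; apply: measurable_funX; apply: measurable_sum => j.
  exact: measurable_funM.
have iN2 j : itg Q (fun t => lam j * N j t ^+ 2).
  by apply: itgZ; exact: itg_normal_sqr.
have iS : itg Q (S p) by apply: itg_sum => j _.
have sq k := Rint_gaussian_sum_sqr N_indep N_normal (fun j => b j k) p.
have iW : itg Q W by apply: itg_sum => k _; exact: (sq k).1.
have iexpW := exp_itg s0 mW W0.
have iexpS := exp_itg s0 (measurable_weighted_chi_square p) (weighted_chi_square_ge0 p).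
rewrite -RintegralB//; apply: le_trans (le_normr_Rintegral measurableT _) _.
  exact: itgB.
apply: (@le_trans _ _ (\int[Q]_t (s * (S p t - W t)))).
  apply: le_Rintegral => //; [exact/itg_norm/itgB|exact/itgZ/itgB|].
  move=> t _; apply: le_trans (expRN_lipschitz s0 (W0 t) (weighted_chi_square_ge0 p t)) _.
  by rewrite distrC ger0_norm// subr_ge0.
rewrite RintegralZl//; last exact: itgB.
rewrite ler_wpM2l// RintegralB//; apply: le_trans (sum_b_tail m p).
rewrite Rint_sum; last by move=> j _.
rewrite Rint_sum; last by move=> k _; exact: (sq k).1.
rewrite le_eqVlt; apply/orP; left; apply/eqP; congr (_ - _).
  apply: eq_bigr => j _; rewrite RintegralZl//; last exact: itg_normal_sqr.
  by rewrite Rint_normal_sqr// mulr1.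
by apply: eq_bigr => k _; rewrite (sq k).2.
Qed.

Let Laplace_form (s : R) m (beta : R) : 0 <= s ->
  \int[Q]_t expR (- (s * S p t)) @[p --> \oo] --> beta ->
  `|\int[Q]_t expR (- (s * B (v m t) (v m t))) - beta| <= s * tail m.
Proof.
move=> s0 cS.
have mdot j : measurable_fun [set: T'] (fun t => l2dot (v m t) (e j)).
  rewrite (_ : (fun t => _) = fun t => \sum_(0 <= k < m) N k t * e j k).
    by apply: measurable_sum => k; exact: measurable_funM.
  by apply/funext => t; rewrite l2dot_finl.
have c1 : \int[Q]_t expR (- (s * \sum_(0 <= j < p) lam j * l2dot (v m t) (e j) ^+ 2))
    @[p --> \oo] --> \int[Q]_t expR (- (s * B (v m t) (v m t))).
  apply: (Rintegral_dct _ (itg_cst Q 1) _ _).2.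
  - move=> p; apply: measurableT_comp => //; apply: measurableT_comp => //.
    apply: measurable_funM => //; apply: measurable_sum => j.
    by apply: measurable_funM => //; exact: measurable_funX.
  - move=> p t; rewrite ger0_norm ?expR_ge0// -expR0 ler_expR oppr_le0 mulr_ge0//.
    by apply: sumr_ge0 => j _; rewrite mulr_ge0// sqr_ge0.
  - move=> t; apply: continuous_cvg; first exact: continuous_expR.
    apply: cvgN; apply: cvgMl_tmp.
    exact: (spectral_decomposition iZ e_orth e_eigen e_max).
have c2 : `|\int[Q]_t expR (- (s * \sum_(0 <= j < p) lam j * l2dot (v m t) (e j) ^+ 2)) -
    \int[Q]_t expR (- (s * S p t))| @[p --> \oo] -->
    `|\int[Q]_t expR (- (s * B (v m t) (v m t))) - beta|.
  by apply: cvg_norm; exact: cvgB c1 cS.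
rewrite -(cvg_lim _ c2)//; apply: limr_le; first by apply/cvg_ex; eexists; exact: c2.
by apply: nearW => p; exact: Laplace_spectral.
Qed.

Variable dim : nat -> nat.
Hypothesis dim_infty : dim n @[n --> \oo] --> \oo.

(** Truncating the dimension and passing to the spectral form each cost at most [s * tail m],
    uniformly in [n], so [m] is fixed before [n] grows. Taking [beta] as any limit of the transforms
    of [S p] keeps the infinite sum out of the statement. *)
Theorem Laplace_limit (s beta : R) : 0 <= s ->
  \int[Q]_t expR (- (s * S p t)) @[p --> \oo] --> beta ->
  \int[P]_t expR (- (s * V_stat Z (dim n) n t)) @[n --> \oo] --> beta.
Proof.
move=> s0 cS; apply/cvgrPdist_le => eps eps0.
have e3 : 0 < eps / 3 by rewrite divr_gt0.
have ct : s * tail m @[m --> \oo] --> (0 : R).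
  by rewrite -[X in _ --> X](mulr0 s); apply: cvgMl_tmp; exact: cvg_variance_tail.
have /cvgrPdist_le/(_ _ e3)[m _ /(_ m (leqnn m))/=] := ct.
rewrite sub0r normrN ger0_norm ?mulr_ge0 ?variance_tail_ge0// => tm.
have lf := Laplace_form m s0 cS.
have cl : \int[P]_t expR (- (s * V_stat Z m n t)) @[n --> \oo] -->
    \int[Q]_t expR (- (s * B (v m t) (v m t))) by exact: Laplace_clt.
have /cvgrPdist_le/(_ _ e3) h := cl.
near=> n.
have mn : (m <= dim n)%N by near: n; exact: (dim_infty (nbhs_infty_ge m)).
have h1 := Laplace_truncation Z_indep Z_ident Z_centered iZ n s0 mn.
have h2 : `|\int[Q]_t expR (- (s * B (v m t) (v m t))) -
   \int[P]_t expR (- (s * V_stat Z m n t))| <= eps / 3 by near: n.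
set a := \int[P]_t _ in h1 *; set c := \int[P]_t _ in h1 h2.
set f := \int[Q]_t _ in lf h2.
have -> : beta - a = (beta - f) + (f - c) + (c - a) by ring.
apply: le_trans (ler_normD _ _) _; rewrite (distrC c a).
apply: le_trans (lerD (ler_normD _ _) (lexx _)) _; rewrite (distrC beta f).
by have := le_trans lf tm; have := le_trans h1 tm; lra.
Unshelve. all: end_near. Qed.

End Laplace_limit.

(** * From Laplace transforms to distribution functions *)

Section Bernstein.
Context {R : realType}.
Implicit Types (f g : nat -> R) (y c : R).

(* [bernstein N f y] is the expectation of [f] at a binomial variable with
   parameters [N] and [y]. *)
Fixpoint bernstein (N : nat) f y : R :=
  if N is N'.+1 then y * bernstein N' (f \o succn) y + (1 - y) * bernstein N' f y
  else f 0%N.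

Lemma bernstein_poly N f : exists p : {poly R}, forall y, bernstein N f y = p.[y].
Proof.
elim: N f => [|N ih] f; first by exists (f 0%N)%:P => y; rewrite hornerC.
have [p hp] := ih (f \o succn); have [q hq] := ih f.
exists ('X * p + (1 - 'X) * q) => y.
by rewrite /= hp hq !hornerE.
Qed.

Lemma bernstein_lin N f g a y :
  bernstein N (fun k => a * f k + g k) y = a * bernstein N f y + bernstein N g y.
Proof.
elim: N f g => [//|N ih] f g /=.
rewrite -[X in y * bernstein N X y]/(fun k => a * (f \o succn) k + (g \o succn) k).
by rewrite !ih; ring.
Qed.

Lemma bernstein_cst N c y : bernstein N (fun=> c) y = c.
Proof. by elim: N => [//|N ih] /=; rewrite -[X in y * bernstein N X y]/(fun=> c) ih; ring. Qed.

Lemma bernstein_le N f g y : 0 <= y <= 1 -> (forall k, f k <= g k) ->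
  bernstein N f y <= bernstein N g y.
Proof.
move=> /andP[y0 y1]; elim: N f g => [|N ih] f g fg /=; first exact: fg.
apply: lerD; apply: ler_wpM2l; rewrite ?subr_ge0//; apply: ih => // k.
exact: fg.
Qed.

(** The offset [c] makes the recursion close: one more trial turns it into [1 + c - y] or [c - y].
    At [c = 0] this is the binomial variance. *)
Lemma bernstein_variance N c y :
  bernstein N (fun k => (k%:R + c - N%:R * y) ^+ 2) y = N%:R * (y * (1 - y)) + c ^+ 2.
Proof.
elim: N c => [|N ih] c /=; first by ring.
have e k : (k.+1%:R + c - N.+1%:R * y) ^+ 2 = (k%:R + (1 + c - y) - N%:R * y) ^+ 2 :> R.
  by rewrite -!natr1; congr (_ ^+ 2); ring.
have e' k : (k%:R + c - N.+1%:R * y) ^+ 2 = (k%:R + (c - y) - N%:R * y) ^+ 2 :> R.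
  by rewrite -natr1; congr (_ ^+ 2); ring.
rewrite [X in y * bernstein N X y](_ : _ =
    fun k => (k%:R + (1 + c - y) - N%:R * y) ^+ 2); last first.
  by apply/funext => k; rewrite -e.
rewrite [X in (1 - y) * bernstein N X y](_ : _ =
    fun k => (k%:R + (c - y) - N%:R * y) ^+ 2); last first.
  by apply/funext => k; rewrite -e'.
by rewrite !ih -natr1; ring.
Qed.

(** With [N = M^2] trials the empirical frequency deviates from [y] by about [1/M]. The inequality
    [u <= M u^2 + 1/M] replaces Cauchy-Schwarz: it reduces the mean deviation to the variance and
    gives an error of at most [2 L / M]. *)
Lemma lipschitz_poly_approx (h : R -> R) (L eps : R) : 0 <= L ->
  (forall x y, `|h x - h y| <= L * `|x - y|) -> 0 < eps ->
  exists p : {poly R}, forall y, 0 <= y <= 1 -> `|p.[y] - h y| <= eps.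
Proof.
move=> L0 hL eps0.
pose M := (Num.truncn (2 * L / eps)).+1.
have M0 : 0 < M%:R :> R by rewrite ltr0n.
have LM : 2 * L / M%:R <= eps.
  rewrite ler_pdivrMr// [leRHS]mulrC -ler_pdivrMr//; apply/ltW.
  by apply: real_truncnS_gt; exact: num_real.
pose N := (M * M)%N.
have NE : N%:R = M%:R ^+ 2 :> R by rewrite natrM expr2.
have [p hp] := bernstein_poly N (fun k => h (k%:R / N%:R)).
exists p => y y01; rewrite -hp -(bernstein_cst N (h y) y).
have -> : bernstein N (fun k => h (k%:R / N%:R)) y - bernstein N (fun=> h y) y =
    bernstein N (fun k => (- 1) * h y + h (k%:R / N%:R)) y.
  by rewrite (bernstein_lin N (fun=> h y)); ring.
pose G k : R := (L * M%:R / N%:R ^+ 2) * (k%:R + 0 - N%:R * y) ^+ 2 + L / M%:R.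
have GE : bernstein N G y <= eps.
  rewrite (bernstein_lin N (fun k => (k%:R + 0 - N%:R * y) ^+ 2) (fun=> L / M%:R)).
  rewrite bernstein_cst bernstein_variance; apply: le_trans LM.
  have -> : L * M%:R / N%:R ^+ 2 * (N%:R * (y * (1 - y)) + 0 ^+ 2) + L / M%:R =
      (L / M%:R) * (y * (1 - y) + 1).
    by rewrite NE; field; rewrite gt_eqF.
  have -> : 2 * L / M%:R = (L / M%:R) * 2 by ring.
  by rewrite ler_wpM2l// ?divr_ge0//; case/andP: y01; nra.
have hG k : `|- 1 * h y + h (k%:R / N%:R)| <= G k.
  rewrite mulN1r addrC; apply: le_trans (hL _ _) _.
  have -> : k%:R / N%:R - y = (k%:R + 0 - N%:R * y) / N%:R.
    by field; rewrite NE expf_eq0/= gt_eqF.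
  set z := _ + 0 - _; rewrite normrM normfV (ger0_norm (ler0n _ N)).
  have -> : G k = L * (M%:R * (`|z| / N%:R) ^+ 2 + M%:R^-1).
    rewrite /G -/z mulrDr; congr (_ + _).
    by rewrite exprMn real_normK ?num_real// exprVn; ring.
  rewrite ler_wpM2l//; set u := `|z| / _.
  rewrite -(ler_pM2l M0).
  have -> : M%:R * (M%:R * u ^+ 2 + M%:R^-1) = (M%:R * u) ^+ 2 + 1.
    by field; rewrite gt_eqF.
  by have := sqr_ge0 (M%:R * u - 1); set q := M%:R * u; nra.
rewrite ler_norml; apply/andP; split.
  rewrite lerNl; apply: le_trans GE.
  pose F k := - 1 * h y + h (k%:R / N%:R).
  have : bernstein N (fun k => - 1 * F k + 0) y <= bernstein N G y.
    apply: bernstein_le => // k; rewrite addr0 [leLHS]mulN1r; apply: le_trans (hG k).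
    by rewrite -normrN ler_norm.
  rewrite (bernstein_lin N F (fun=> 0)) bernstein_cst addr0 => h1; rewrite -[leLHS]mulN1r; exact: h1.
apply: le_trans GE; apply: bernstein_le => // k.
exact: le_trans (ler_norm _) (hG k).
Qed.

End Bernstein.

Section moment_convergence.
Context d (T : measurableType d) (R : realType) (P : probability T R).
Context d' (T' : measurableType d') (Q : probability T' R).
Variables (Y_ : nat -> T -> R) (Y : T' -> R).
Hypothesis mY_ : forall n, measurable_fun [set: T] (Y_ n).
Hypothesis mY : measurable_fun [set: T'] Y.
Hypothesis Y_01 : forall n t, 0 <= Y_ n t <= 1.
Hypothesis Y01 : forall t, 0 <= Y t <= 1.
Hypothesis cvg_moments : forall k : nat,
  \int[P]_t Y_ n t ^+ k @[n --> \oo] --> \int[Q]_t Y t ^+ k.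

Let itg_pow d0 (T0 : measurableType d0) (P0 : probability T0 R) (X : T0 -> R) k :
  measurable_fun [set: T0] X -> (forall t, 0 <= X t <= 1) ->
  itg P0 (fun t => X t ^+ k).
Proof.
move=> mX X01; apply: (@itg_bounded _ _ _ P0 _ 1); first exact: measurable_funX.
by move=> t; have /andP[x0 x1] := X01 t; rewrite ger0_norm ?exprn_ge0// exprn_ile1.
Qed.

Lemma cvg_Rint_poly (p : {poly R}) :
  \int[P]_t p.[Y_ n t] @[n --> \oo] --> \int[Q]_t p.[Y t].
Proof.
have pE d0 (T0 : measurableType d0) (P0 : probability T0 R) (X : T0 -> R) :
    measurable_fun [set: T0] X -> (forall t, 0 <= X t <= 1) ->
    \int[P0]_t p.[X t] = \sum_(i < size p) p`_i * \int[P0]_t X t ^+ i.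
  move=> mX X01; under eq_Rintegral do rewrite horner_coef.
  rewrite Rint_sum => [|i _]; last exact/itgZ/itg_pow.
  by apply: eq_bigr => i _; rewrite RintegralZl//; exact: itg_pow.
rewrite pE//; under eq_fun do rewrite pE//.
by apply: cvg_sumr => i _; apply: cvgMl_tmp.
Qed.

Lemma cvg_Rint_lipschitz (h : R -> R) L : 0 <= L ->
  (forall x y, `|h x - h y| <= L * `|x - y|) -> measurable_fun [set: R] h ->
  \int[P]_t h (Y_ n t) @[n --> \oo] --> \int[Q]_t h (Y t).
Proof.
move=> L0 hL mh; apply/cvgrPdist_le => eps eps0.
have e3 : 0 < eps / 3 by rewrite divr_gt0.
have [p hp] := lipschitz_poly_approx L0 hL e3.
have close d0 (T0 : measurableType d0) (P0 : probability T0 R) (X : T0 -> R) :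
    measurable_fun [set: T0] X -> (forall t, 0 <= X t <= 1) ->
    `|\int[P0]_t p.[X t] - \int[P0]_t h (X t)| <= eps / 3.
  move=> mX X01.
  have ip : itg P0 (fun t => p.[X t]).
    under [X in itg P0 X]eq_fun do rewrite horner_coef.
    by apply: itg_sum => i _; exact/itgZ/itg_pow.
  have ih : itg P0 (fun t => h (X t)).
    apply: (@itg_bounded _ _ _ P0 _ (`|h 0| + L)); first exact: measurableT_comp.
    move=> t; rewrite -[X in `|X|](subrK (h 0)) addrC.
    apply: le_trans (ler_normD _ _) _; rewrite lerD2l.
    apply: le_trans (hL _ _) _; rewrite subr0; have /andP[x0 x1] := X01 t.
    by rewrite ger0_norm// ler_piMr.
  by rewrite -RintegralB//; apply: Rint_norm_bound; [exact: itgB|move=> t; exact: hp].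
have /cvgrPdist_le/(_ _ e3) := @cvg_Rint_poly p; apply: filterS => n h1.
have h2 := close _ _ P _ (mY_ n) (Y_01 n); have h3 := close _ _ Q _ mY Y01.
set a := \int[Q]_t h (Y t) in h3 *; set b := \int[P]_t h (Y_ n t) in h2 *.
set pa := \int[Q]_t _ in h1 h3; set pb := \int[P]_t _ in h1 h2.
have -> : a - b = (a - pa) + (pa - pb) + (pb - b) by ring.
apply: le_trans (ler_normD _ _) _; apply: le_trans (lerD (ler_normD _ _) (lexx _)) _.
by rewrite (distrC a pa); lra.
Qed.

End moment_convergence.

(** * Mass of short intervals under normal and weighted chi-square laws *)

Section normal_concentration.
Context d (T : measurableType d) (R : realType) (Q : probability T R).
Local Notation mu := (@lebesgue_measure R).

Lemma normal_peak_le1 : normal_peak (1 : R) <= 1.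
Proof.
rewrite invf_le1; last first.
  by rewrite sqrtr_gt0 expr1n mul1r pmulrn_lgt0// pi_gt0.
rewrite -[leLHS]sqrtr1 ler_wsqrtr// expr1n mul1r mulr2n.
by have := @pi_ge2 R; lra.
Qed.

Lemma normal_prob_itv (a b : R) : a <= b ->
  (normal_prob 0 1 `[a, b]%classic <= (b - a)%:E)%E.
Proof.
move=> ab; apply: (@le_trans _ _ (\int[mu]_(x in `[a, b]%classic) 1%:E)%E).
  apply: ge0_le_integral => //.
  - by move=> x _; rewrite lee_fin normal_pdf_ge0.
  - by apply/measurable_EFinP/measurable_funTS; exact: measurable_normal_pdf.
  - move=> x _; rewrite lee_fin.
    by apply: le_trans (normal_pdf_ub _ _ (oner_neq0 _)) normal_peak_le1.
rewrite integral_cst//= mul1e lebesgue_measure_itv/= lte_fin.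
by case: ltP => // _; rewrite lee_fin subr_ge0.
Qed.

Variable X : {RV Q >-> R}.
Hypothesis X_normal : std_normal X.

Let QX a b : a <= b -> (Q [set t | (a <= X t <= b)%R] <= (b - a)%:E)%E.
Proof.
move=> ab; apply: le_trans (normal_prob_itv ab); rewrite -X_normal//.
Qed.

Let mX : measurable_fun [set: T] X. Proof. exact: measurable_funPT. Qed.

Let mXi a b : measurable [set t | a <= X t <= b].
Proof.
rewrite (_ : [set t | _] = X @^-1` `[a, b]%classic).
  by rewrite -[X in measurable X]setTI; exact: mX.
by apply/seteqP; split => t /=; rewrite in_itv.
Qed.

(** The event confines [X] to [[u, v]] or [[-v, -u]], each of length at most [sqrt ((b - a) / l)]
    because the square root is subadditive; the normal density is at most 1. *)
Lemma normal_sqr_concentration (l a b : R) : 0 < l -> a <= b ->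
  (Q [set t | (a <= l * X t ^+ 2 <= b)%R] <= (2 * Num.sqrt ((b - a) / l))%:E)%E.
Proof.
move=> l0 ab; pose u := Num.sqrt (a / l); pose v := Num.sqrt (b / l).
have uv : u <= v by rewrite ler_wsqrtr// ler_pM2r ?invr_gt0.
have vu : v - u <= Num.sqrt ((b - a) / l).
  (* Negative endpoints are harmless, since [Num.sqrt] vanishes at negative arguments. *)
  have [b0|b0] := leP b 0.
    rewrite /v ler0_sqrtr; last by rewrite pmulr_lle0 ?invr_gt0.
    by rewrite (@le_trans _ _ 0)// sub0r oppr_le0 sqrtr_ge0.
  have [a0|a0] := leP a 0.
    rewrite /u ler0_sqrtr ?subr0; last by rewrite pmulr_lle0 ?invr_gt0.
    by rewrite ler_wsqrtr// ler_pM2r ?invr_gt0//; lra.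
  rewrite -(@ler_pXn2r _ 2) ?nnegrE ?subr_ge0 ?sqrtr_ge0//.
  rewrite sqr_sqrtr ?divr_ge0 ?subr_ge0// ?(ltW l0)//.
  have u2 : u ^+ 2 = a / l by rewrite sqr_sqrtr// divr_ge0// ltW.
  have v2 : v ^+ 2 = b / l by rewrite sqr_sqrtr// divr_ge0// ltW.
  rewrite mulrBl -u2 -v2; have := sqrtr_ge0 (a / l); rewrite -/u; nra.
have sub : [set t | a <= l * X t ^+ 2 <= b] `<=`
    [set t | u <= X t <= v] `|` [set t | - v <= X t <= - u].
  move=> t /= /andP[h1 h2].
  have {}h1 : a / l <= X t ^+ 2 by rewrite ler_pdivrMr// mulrC.
  have {}h2 : X t ^+ 2 <= b / l by rewrite ler_pdivlMr// mulrC.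
  have {}h1 : u <= `|X t| by rewrite -sqrtr_sqr ler_wsqrtr.
  have {}h2 : `|X t| <= v by rewrite -sqrtr_sqr ler_wsqrtr.
  have [x0|x0] := leP 0 (X t); [left|right] => /=.
    by move: h1 h2; rewrite ger0_norm// => -> ->.
  by move: h1 h2; rewrite ltr0_norm// => h1 h2; apply/andP; split; lra.
apply: (@le_trans _ _ ((v - u)%:E + (- u - - v)%:E)%E); last first.
  by rewrite -EFinD lee_fin; lra.
apply: (@le_trans _ _ (Q ([set t | u <= X t <= v] `|` [set t | - v <= X t <= - u]))).
  apply: le_measure; rewrite ?inE//.
  - rewrite (_ : [set t | _] = (fun t => l * X t ^+ 2) @^-1` `[a, b]%classic).
      rewrite -[X in measurable X]setTI.
      have m : measurable_fun [set: T] (fun t => l * X t ^+ 2).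
        by apply: measurable_funM => //; exact: measurable_funX.
      exact: m.
    by apply/seteqP; split => t /=; rewrite in_itv.
  - exact: measurableU.
apply: le_trans (measureU2 _ _ _) _ => //.
by apply: leeD; apply: QX => //; rewrite lerN2.
Qed.

End normal_concentration.

Section chi_square_concentration.
Context d' (T' : measurableType d') (R : realType) (Q : probability T' R).
Variable N : nat -> {RV Q >-> R}.
Hypothesis N_indep : mutually_independent N.
Hypothesis N_normal : forall i, std_normal (N i).
Variable lam : nat -> R.
Local Notation S := (weighted_chi_square N lam).

(** Freezing all terms but the one at [i] merely translates the interval, and the bound for that
    single term does not see translations. It is therefore the same for every [p > i]. *)
Lemma chi_square_concentration i p (a b : R) : (i < p)%N -> 0 < lam i -> a <= b ->
  (Q [set t | (a <= S p t <= b)%R] <= (2 * Num.sqrt ((b - a) / lam i))%:E)%E.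
Proof.
move=> ip li ab.
pose s := [seq j <- index_iota 0 p | j != i].
have us : uniq (i :: s).
  by rewrite /= mem_filter eqxx/= filter_uniq// iota_uniq.
pose f j (x : R) := lam j * x ^+ 2.
have mf j : measurable_fun [set: R] (f j).
  by apply: measurable_funM => //; exact: measurable_funX.
have mN j : measurable_fun [set: T'] (N j) by exact: measurable_funPT.
have ind := independent2_partial_sum N_indep mf us.
have mW : measurable_fun [set: T'] (fun t => \sum_(j <- s) f j (N j t)).
  by apply: measurable_sum => j; exact: measurableT_comp.
pose D := [set z : R * R | a <= z.1 + f i z.2 <= b].
have mD : measurable D.
  have m : measurable_fun [set: R * R] (fun z => z.1 + f i z.2).
    by apply: measurable_funD => //; exact: (measurableT_comp (mf i) measurable_snd).
  rewrite (_ : D = (fun z => z.1 + f i z.2) @^-1` `[a, b]%classic).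
    by rewrite -[X in measurable X]setTI; exact: m.
  by apply/seteqP; split => t /=; rewrite in_itv.
have SE t : S p t = \sum_(j <- s) f j (N j t) + f i (N i t).
  rewrite addrC /S (bigD1_seq i) ?mem_iota ?iota_uniq ?subn0//=.
  by rewrite /s big_filter.
have -> : [set t | a <= S p t <= b] =
    [set t | D (\sum_(j <- s) f j (N j t), N i t)].
  by apply/seteqP; split => t /=; rewrite SE.
rewrite (independent2_law mW (mN i) ind mD).
apply: (@le_trans _ _ (\int[Q]_t (2 * Num.sqrt ((b - a) / lam i))%:E)%E); last first.
  by rewrite integral_cst//= probability_setT mule1.
have bound w : (Q [set t' | D (w, N i t')] <= (2 * Num.sqrt ((b - a) / lam i))%:E)%E.
  have -> : [set t' | D (w, N i t')] =
      [set t' | a - w <= lam i * N i t' ^+ 2 <= b - w].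
    by apply/seteqP; split => t' /=; rewrite /f lerBlDl lerBrDl.
  rewrite (_ : b - a = (b - w) - (a - w)); last by ring.
  by apply: normal_sqr_concentration => //; rewrite lerB.
apply: ge0_le_integral => //.
exact: measurable_section_probability.
Qed.

End chi_square_concentration.

Section ramp.
Context {R : realType}.

(** For [M > 0], the piecewise linear function that rises from 0 at [(j - 1) / M] to 1 at
    [j / M]. *)
Definition ramp (M : R) (j : nat) (y : R) : R :=
  Num.min 1 (Num.max 0 (M * y - j%:R + 1)).

Lemma ramp_lipschitz M j x y : 0 <= M ->
  `|ramp M j x - ramp M j y| <= M * `|x - y|.
Proof.
move=> M0; rewrite -[X in X * _]ger0_norm// -normrM mulrBr /ramp.
have -> : M * x - M * y = (M * x - j%:R + 1) - (M * y - j%:R + 1) by ring.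
set u := M * x - _ + _; set w := M * y - _ + _.
have clampE (z : R) : Num.min 1 (Num.max 0 z) =
    (if z <= 0 then 0 else if 1 <= z then 1 else z).
  case: (leP z 0) => z0; first exact/min_idPr/ler01.
  by case: (leP 1 z).
have h1 : u - w <= `|u - w| by exact: ler_norm.
have h2 : w - u <= `|u - w| by rewrite distrC ler_norm.
have h3 : 0 <= `|u - w| by [].
set n := `|u - w| in h1 h2 h3 *; rewrite !clampE ler_norml.
clearbody n u w; clear clampE M0.
by case: (leP u 0) => ?; case: (leP w 0) => ?; case: (leP 1 u) => ?;
  case: (leP 1 w) => ?; apply/andP; split; lra.
Qed.

Lemma measurable_ramp M j : measurable_fun [set: R] (ramp M j).
Proof.
apply: measurable_minr => //; apply: measurable_maxr => //.
apply: measurable_funD => //; exact: measurable_funB.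
Qed.

Lemma ramp_ge0 M j y : 0 <= ramp M j y.
Proof. by rewrite /ramp le_min ler01/= le_max lexx. Qed.

Lemma ramp_le1 M j y : ramp M j y <= 1.
Proof. by rewrite /ramp ge_min lexx. Qed.

Lemma ramp_eq1 M j y : j%:R <= M * y -> ramp M j y = 1.
Proof.
by move=> h; apply/min_idPl; rewrite le_max; apply/orP; right; lra.
Qed.

Lemma ramp_eq0 M j y : M * y <= j%:R - 1 -> ramp M j y = 0.
Proof.
move=> h; rewrite /ramp (max_idPl _) ?(min_idPr _)//; lra.
Qed.

End ramp.

Section cdf_convergence.
Context d (T : measurableType d) (R : realType) (P : probability T R).
Context d' (T' : measurableType d') (Q : probability T' R).
Variables (V : nat -> T -> R) (S : nat -> T' -> R).
Hypothesis mV : forall n, measurable_fun [set: T] (V n).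
Hypothesis V_ge0 : forall n t, 0 <= V n t.
Hypothesis S_ge0 : forall p t, 0 <= S p t.
Hypothesis S_nd : forall p q t, (p <= q)%N -> S p t <= S q t.
Hypothesis itg_S : forall p, itg Q (S p).
Hypothesis Laplace : forall s beta : R, 0 <= s ->
  \int[Q]_t expR (- (s * S p t)) @[p --> \oo] --> beta ->
  \int[P]_t expR (- (s * V n t)) @[n --> \oo] --> beta.
Variables (K C : R) (p0 : nat).
Hypothesis K_ge0 : 0 <= K.
Hypothesis C_ge0 : 0 <= C.
Hypothesis S_tight : forall p, \int[Q]_t S p t <= K.
Hypothesis S_conc : forall p a b, (p0 <= p)%N -> a <= b ->
  (Q [set t | (a <= S p t <= b)%R] <= (C * Num.sqrt (b - a))%:E)%E.

Let mS p : measurable_fun [set: T'] (S p). Proof. exact: itg_measurable (itg_S p). Qed.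

Let mexp d0 (T0 : measurableType d0) (f : T0 -> R) : measurable_fun [set: T0] f ->
  measurable_fun [set: T0] (fun t => expR (- f t)).
Proof. by move=> mf; apply: measurableT_comp => //; exact: measurableT_comp. Qed.

Let exp01 (x : R) : 0 <= x -> 0 <= expR (- x) <= 1.
Proof. by move=> x0; rewrite expR_ge0/= -expR0 ler_expR oppr_le0. Qed.

(** This is [exp (- V_infty)], with value 0 where the partial sums diverge, so finiteness of the
    limit variable need not be discussed. *)
Let Y t := limn (fun p => expR (- S p t)).

Let cvgY t : expR (- S p t) @[p --> \oo] --> Y t.
Proof.
apply: (@nonincreasing_is_cvgn _ (fun p => expR (- S p t))).
  by move=> p q pq; rewrite ler_expR lerN2 S_nd.
by exists 0 => _ [p _ <-]; exact: expR_ge0.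
Qed.

Let Y01 t : 0 <= Y t <= 1.
Proof.
have c : cvgn (fun p => expR (- S p t)) by apply/cvg_ex; exists (Y t); exact: cvgY.
apply/andP; split; [apply: limr_ge => //|apply: limr_le => //]; apply: nearW => p.
  exact: expR_ge0.
by have /andP[] := exp01 (S_ge0 p t).
Qed.

Let mY : measurable_fun [set: T'] Y.
Proof.
apply: (@measurable_fun_cvg _ _ _ _ (fun p t => expR (- S p t))) => [p|t _].
  exact: mexp.
exact: cvgY.
Qed.

Let Y_geP t (x : R) : (expR (- x) <= Y t) <-> (forall p, S p t <= x).
Proof.
have c : cvgn (fun p => expR (- S p t)) by apply/cvg_ex; exists (Y t); exact: cvgY.
split=> [h p|h].
  rewrite -lerN2 -ler_expR; apply: le_trans h _.
  apply: (@nonincreasing_cvgn_ge _ (fun p => expR (- S p t))) => //.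
  by move=> q r qr; rewrite ler_expR lerN2 S_nd.
by apply: limr_ge => //; apply: nearW => p; rewrite ler_expR lerN2.
Qed.

Let moments (k : nat) :
  \int[P]_t expR (- V n t) ^+ k @[n --> \oo] --> \int[Q]_t Y t ^+ k.
Proof.
have kE (x : R) : expR (- x) ^+ k = expR (- (k%:R * x)).
  by rewrite -expRM_natl mulrN.
have h : \int[Q]_t expR (- (k%:R * S p t)) @[p --> \oo] --> \int[Q]_t Y t ^+ k.
  under eq_fun do under eq_Rintegral do rewrite -kE.
  apply: (Rintegral_dct _ (itg_cst Q 1) _ _).2.
  - by move=> p; apply: measurable_funX; exact: mexp.
  - move=> p t; have /andP[e0 e1] := exp01 (S_ge0 p t).
    by rewrite ger0_norm ?exprn_ge0// exprn_ile1.
  - move=> t; exact: (cvg_comp _ _ (@cvgY t) (@exprn_continuous R k (Y t))).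
by have := Laplace (ler0n _ k) h; under eq_fun do under eq_Rintegral do rewrite -kE.
Qed.

Let itg_ramp d0 (T0 : measurableType d0) (P0 : probability T0 R) (f : T0 -> R) M j :
  measurable_fun [set: T0] f -> itg P0 (fun t => ramp M j (f t)).
Proof.
move=> mf; apply: (@itg_bounded _ _ _ P0 _ 1).
  exact: (measurableT_comp (measurable_ramp M j) mf).
by move=> t; rewrite ger0_norm ?ramp_ge0// ramp_le1.
Qed.

Let ramp_cvg M j : 0 <= M ->
  \int[P]_t ramp M j (expR (- V n t)) @[n --> \oo] --> \int[Q]_t ramp M j (Y t).
Proof.
move=> M0; apply: (cvg_Rint_lipschitz _ mY _ Y01 moments M0).
- by move=> n; exact: mexp.
- by move=> n t; exact: exp01.
- by move=> x y; exact: ramp_lipschitz.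
- exact: measurable_ramp.
Qed.

Let Rint_le_prob d0 (T0 : measurableType d0) (P0 : probability T0 R) (f : T0 -> R)
    (A : set T0) : measurable A -> measurable_fun [set: T0] f ->
  (forall t, 0 <= f t <= 1) -> (forall t, ~ A t -> f t = 0) ->
  \int[P0]_t f t <= fine (P0 A).
Proof.
move=> mA mf f01 fA.
have -> : fine (P0 A) = \int[P0]_t (\1_A t : R).
  by rewrite /Rintegral integral_indic// setIT.
apply: le_Rintegral => //.
- by apply: (@itg_bounded _ _ _ P0 _ 1) => // t; have /andP[f0 f1] := f01 t; rewrite ger0_norm.
- by apply: (@itg_bounded _ _ _ P0 _ 1) => // t; rewrite indicE; case: (_ \in _); rewrite /= ?normr1 ?normr0.
- move=> t _; rewrite indicE; have [At|/negP At] := boolP (t \in A).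
    by have /andP[] := f01 t.
  by rewrite fA// => /mem_set.
Qed.

Let prob_le_Rint d0 (T0 : measurableType d0) (P0 : probability T0 R) (f : T0 -> R)
    (A : set T0) : measurable A -> measurable_fun [set: T0] f ->
  (forall t, 0 <= f t <= 1) -> (forall t, A t -> f t = 1) ->
  fine (P0 A) <= \int[P0]_t f t.
Proof.
move=> mA mf f01 fA.
have -> : fine (P0 A) = \int[P0]_t (\1_A t : R).
  by rewrite /Rintegral integral_indic// setIT.
apply: le_Rintegral => //.
- by apply: (@itg_bounded _ _ _ P0 _ 1) => // t; rewrite indicE; case: (_ \in _); rewrite /= ?normr1 ?normr0.
- by apply: (@itg_bounded _ _ _ P0 _ 1) => // t; have /andP[f0 f1] := f01 t; rewrite ger0_norm.
- move=> t _; rewrite indicE; have [At|At] := boolP (t \in A).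
    by rewrite fA//; exact: set_mem.
  by have /andP[] := f01 t.
Qed.

Let measurable_itv_pre d0 (T0 : measurableType d0) (f : T0 -> R) (i : interval R) :
  measurable_fun [set: T0] f -> measurable [set t | f t \in i].
Proof.
move=> mf; rewrite (_ : [set t | _] = f @^-1` [set` i]); last by [].
by rewrite -[X in measurable X]setTI; apply: mf => //; exact: measurable_itv.
Qed.

(* Splits according to whether the window lies near [0], where the law of
   [exp (- S p)] has little mass by Markov's inequality, or away from it, where
   [S p] is confined to a short interval. *)
Let window_small (eps : R) : 0 < eps -> exists M : nat, (0 < M)%N /\
    forall p j, (p0 <= p)%N ->
    fine (Q [set t | 0 <= M%:R * expR (- S p t) - j%:R + 1 <= 3]) <= eps.
Proof.
move=> eps0.
(* [L] is chosen so that Markov gives [K / L <= eps], and [delta] so that [C * sqrt delta <= eps].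
   The constants 6 in [r] ensure, when [j + 2 > eta M], that [j - 1 >= eta M / 2] and
   [3 / (j - 1) <= delta]. *)
pose L := K / eps + 1; have L0 : 0 < L by rewrite ltr_wpDl// divr_ge0// ltW.
pose eta := expR (- L); have eta0 : 0 < eta by exact: expR_gt0.
pose delta := (eps / (C + 1)) ^+ 2.
have C1 : 0 < C + 1 by rewrite ltr_wpDl.
have delta0 : 0 < delta by rewrite exprn_gt0// divr_gt0.
pose r := Num.max (6 / eta) (6 / (eta * delta)).
pose M := (Num.truncn r).+1.
have rM : r < M%:R by apply: real_truncnS_gt; exact: num_real.
have M0 : 0 < M%:R :> R by rewrite ltr0n.
have Me : 6 <= eta * M%:R.
  rewrite mulrC -ler_pdivrMr//; apply: le_trans (ltW rM); by rewrite le_max lexx.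
have Md : 6 <= delta * (eta * M%:R).
  have ed0 : 0 < eta * delta by rewrite mulr_gt0.
  rewrite mulrA (mulrC delta) [leRHS]mulrC -(ler_pdivrMr _ _ ed0).
  by apply: le_trans (ltW rM); rewrite le_max lexx orbT.
exists M; split => // p j pp0.
have mE : measurable [set t | 0 <= M%:R * expR (- S p t) - j%:R + 1 <= 3].
  rewrite (_ : [set t | _] = [set t | (fun t => M%:R * expR (- S p t) - j%:R + 1) t \in `[0, 3]]).
    apply: measurable_itv_pre; apply: measurable_funD => //; apply: measurable_funB => //.
    by apply: measurable_funM => //; exact: mexp.
  by apply/seteqP; split => t; rewrite /= in_itv.
have finQ A : measurable A -> Q A \is a fin_num by move=> mA; exact: fin_num_measure.
have [je|je] := leP ((j%:R + 2) / M%:R) eta.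
  have mA : measurable [set t | L <= S p t].
    rewrite (_ : [set t | _] = [set t | S p t \in `[L, +oo[]).
      exact: measurable_itv_pre.
    by apply/seteqP; split => t; rewrite /= in_itv/= andbT.
  apply: (@le_trans _ _ (fine (Q [set t | L <= S p t]))).
    rewrite fine_le ?finQ//; apply: le_measure; rewrite ?inE// => t /= /andP[_ h].
    rewrite -lerN2 -ler_expR -/eta; apply: le_trans je.
    by rewrite ler_pdivlMr// mulrC; lra.
  have iLS : itg Q (fun t => L^-1 * S p t) by exact: itgZ.
  apply: (@le_trans _ _ (\int[Q]_t (L^-1 * S p t))).
    have -> : fine (Q [set t | L <= S p t]) = \int[Q]_t (\1_[set t | L <= S p t] t : R).
      by rewrite /Rintegral integral_indic// setIT.
    apply: le_Rintegral => //.
      by apply: (@itg_bounded _ _ _ Q _ 1) => // t; rewrite indicE; case: (_ \in _); rewrite /= ?normr1 ?normr0.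
    move=> t _; rewrite indicE; have [/set_mem/= At|_] := boolP (t \in _).
      by rewrite ler_pdivlMl// mulr1.
    by rewrite mulr_ge0// invr_ge0 ltW.
  rewrite RintegralZl// ler_pdivrMl//; apply: le_trans (S_tight p) _.
  by rewrite /L mulrDl divfK ?gt_eqF//; lra.
have jM : eta * M%:R < j%:R + 2 by rewrite -ltr_pdivlMr.
pose al : R := (j%:R - 1) / M%:R; pose be : R := (j%:R + 2) / M%:R.
have j1 : eta * M%:R / 2 <= j%:R - 1 by lra.
have j10 : 0 < j%:R - 1 :> R by apply: lt_le_trans j1; rewrite divr_gt0// mulr_gt0.
have al0 : 0 < al by rewrite divr_gt0.
have be0 : 0 < be by rewrite divr_gt0//; lra.
have ab : al <= be by rewrite ler_pM2r ?invr_gt0//; lra.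
(* The window for [exp (- S p)] is [[al, be]], so [S p] ranges over an interval of length [ln (be /
   al) <= be / al - 1 = 3 / (j - 1)]. *)
have lnab : ln be - ln al <= delta.
  rewrite -ln_div ?posrE//.
  have -> : be / al = 1 + 3 / (j%:R - 1) by rewrite /be /al; field; rewrite !gt_eqF.
  have z0 : 0 < 1 + 3 / (j%:R - 1) :> R by rewrite ltr_wpDr// divr_ge0// ltW.
  have := expR_ge1Dx (ln (1 + 3 / (j%:R - 1) : R)); rewrite lnK ?posrE//.
  rewrite lerD2l => /le_trans; apply; rewrite ler_pdivrMr//.
  apply: le_trans (ler_wpM2l (ltW delta0) j1); lra.
have sub : [set t | 0 <= M%:R * expR (- S p t) - j%:R + 1 <= 3] `<=`
    [set t | - ln be <= S p t <= - ln al].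
  move=> t /= /andP[h1 h2]; apply/andP; split.
    rewrite lerNl -ler_expR lnK ?posrE// ler_pdivlMr// mulrC; lra.
  rewrite lerNr -ler_expR lnK ?posrE// ler_pdivrMr// mulrC; lra.
have mB : measurable [set t | - ln be <= S p t <= - ln al].
  rewrite (_ : [set t | _] = [set t | S p t \in `[- ln be, - ln al]]).
    exact: measurable_itv_pre.
  by apply/seteqP; split => t; rewrite /= in_itv.
apply: (@le_trans _ _ (fine (Q [set t | - ln be <= S p t <= - ln al]))).
  by rewrite fine_le ?finQ//; apply: le_measure; rewrite ?inE.
rewrite -lee_fin fineK ?finQ//; apply: le_trans (S_conc pp0 _) _.
  by rewrite lerN2 ler_ln ?posrE.
rewrite lee_fin; apply: (@le_trans _ _ (C * (eps / (C + 1)))).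
  have e1 : 0 <= eps / (C + 1) by rewrite divr_ge0// ltW.
  apply: ler_wpM2l => //; rewrite -[leRHS](ger0_norm e1) -sqrtr_sqr ler_wsqrtr//.
  by rewrite opprK addrC.
rewrite mulrCA ler_piMr ?(ltW eps0)// ler_pdivrMr//; lra.
Qed.

(** In terms of [exp (- V n)] the event is a half-line, whose indicator lies between two
    neighbouring ramps. Convergence is needed only for the finitely many ramps of a grid of mesh
    [1/M], and [M] depends on [eps] alone; this yields uniformity in [x]. *)
Lemma cdf_uniform_cvg (eps : R) : 0 < eps -> \forall n \near \oo, forall x,
  `|fine (P [set t | V n t <= x]) - fine (Q [set t | forall p, S p t <= x])| <= eps.
Proof.
move=> eps0; have e2 : 0 < eps / 2 by rewrite divr_gt0.
have [M [M0 hM]] := window_small e2.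
have M0' : (0 : R) <= M%:R by [].
(* The difference of the two ramps vanishes outside [[(j - 1) / M, (j + 2) / M]], the window of
   [window_small]. The estimate holds for [S p] with [p >= p0] and passes to [Y] by dominated
   convergence. *)
have osc j : \int[Q]_t ramp M%:R j (Y t) - \int[Q]_t ramp M%:R j.+2 (Y t) <= eps / 2.
  have cr i : \int[Q]_t ramp M%:R i (expR (- S p t)) @[p --> \oo] -->
      \int[Q]_t ramp M%:R i (Y t).
    apply: (Rintegral_dct _ (itg_cst Q 1) _ _).2.
    - move=> p; exact: (measurableT_comp (measurable_ramp M%:R i) (mexp (mS p))).
    - by move=> p t; rewrite ger0_norm ?ramp_ge0// ramp_le1.
    - move=> t; apply/cvgrPdist_le => e e0.
      have : M%:R * `|Y t - expR (- S p t)| @[p --> \oo] --> (0 : R).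
        rewrite -[X in _ --> X](mulr0 M%:R); apply: cvgMl_tmp.
        rewrite -(@normr0 R R) -(subrr (Y t)); apply: cvg_norm.
        by apply: cvgB; [exact: cvg_cst|exact: cvgY].
      move=> /cvgrPdist_le/(_ _ e0); apply: filterS => p.
      rewrite sub0r normrN ger0_norm ?mulr_ge0//; apply: le_trans.
      exact: ramp_lipschitz.
  have c : \int[Q]_t ramp M%:R j (expR (- S p t)) -
      \int[Q]_t ramp M%:R j.+2 (expR (- S p t)) @[p --> \oo] -->
      \int[Q]_t ramp M%:R j (Y t) - \int[Q]_t ramp M%:R j.+2 (Y t).
    exact: cvgB.
  rewrite -(cvg_lim _ c)//; apply: limr_le; first by apply/cvg_ex; eexists; exact: c.
  near=> p; have pp0 : (p0 <= p)%N by near: p; exact: nbhs_infty_ge.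
  apply: le_trans (hM p j pp0).
  have mr i : measurable_fun [set: T'] (fun t => ramp M%:R i (expR (- S p t))).
    exact: (measurableT_comp (measurable_ramp M%:R i) (mexp (mS p))).
  rewrite -RintegralB//; [|exact/itg_ramp/mexp..].
  have nd y : 0 <= ramp M%:R j y - ramp M%:R j.+2 y.
    rewrite subr_ge0 /ramp.
    have [h|h] := leP (M%:R * y - j.+2%:R + 1) 0.
      by rewrite (min_idPr ler01) le_min ler01/= le_max lexx.
    rewrite le_min ge_min lexx/= ge_min; apply/orP; right.
    by rewrite le_max; apply/orP; right; rewrite -!natr1; lra.
  apply: Rint_le_prob.
  - rewrite (_ : [set t | _] = [set t | (fun t => M%:R * expR (- S p t) - j%:R + 1) t \in `[0, 3]]).
      apply: measurable_itv_pre; apply: measurable_funD => //; apply: measurable_funB => //.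
      by apply: measurable_funM => //; exact: mexp.
    by apply/seteqP; split => t; rewrite /= in_itv.
  - exact: measurable_funB.
  - move=> t; rewrite nd/=; have := ramp_le1 M%:R j (expR (- S p t)).
    by have := ramp_ge0 M%:R j.+2 (expR (- S p t)); lra.
  - move=> t /= /negP; rewrite negb_and -!ltNge => /orP[h|h].
      by rewrite !ramp_eq0 ?subrr// -?natr1; lra.
    by rewrite !ramp_eq1 ?subrr// -?natr1; lra.
have near_ramp : \forall n \near \oo, forall j : 'I_M.+3,
    `|\int[Q]_t ramp M%:R j (Y t) - \int[P]_t ramp M%:R j (expR (- V n t))| <= eps / 2.
  apply: filter_forall => j.
  by have /cvgrPdist_le/(_ _ e2) := @ramp_cvg M%:R j M0'.
apply: filterS near_ramp => n hn x.
have mVx : measurable [set t | V n t <= x].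
  rewrite (_ : [set t | _] = [set t | V n t \in `]-oo, x]]).
    exact: measurable_itv_pre.
  by apply/seteqP; split => t; rewrite /= in_itv.
have mSx : measurable [set t | forall p, S p t <= x].
  rewrite (_ : [set t | _] = [set t | Y t \in `[expR (- x), +oo[]).
    exact: measurable_itv_pre.
  by apply/seteqP; split => t; rewrite /= in_itv/= andbT => /Y_geP.
have [x0|x0] := ltP x 0.
  rewrite (_ : [set t | V n t <= x] = set0) ?measure0; last first.
    by apply/seteqP; split => // t /=; have := V_ge0 n t; lra.
  rewrite (_ : [set t | forall p, S p t <= x] = set0) ?measure0 ?subrr ?normr0 ?ltW//.
  by apply/seteqP; split => // t /= /(_ 0%N); have := S_ge0 0 t; lra.
pose y := expR (- x); have /andP[y0 y1] := exp01 x0.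
(* From [i <= M y < i + 1] it follows that [ramp i] is 1 on [[y, +oo[] and [ramp i.+2] is 0 below
   [y]; [ramp i.+1] may still be positive there. As [y <= 1], the indices stay below [M + 3]. *)
pose i := Num.truncn (M%:R * y).
have /truncn_itv/andP[iy yi] : 0 <= M%:R * y by rewrite mulr_ge0.
have iM : (i <= M)%N.
  by rewrite -(ler_nat R); apply: le_trans iy _; rewrite ler_piMr.
have i3 : (i < M.+3)%N by rewrite ltnS (leq_trans iM)// -addn2 leq_addr.
have h1 := hn (Ordinal i3).
have h2 := hn (@Ordinal M.+3 i.+2 iM).
rewrite /= in h1 h2.
have o := osc i.
have mYr j : measurable_fun [set: T'] (fun t => ramp M%:R j (Y t)).
  exact: (measurableT_comp (measurable_ramp M%:R j) mY).
have mVr j : measurable_fun [set: T] (fun t => ramp M%:R j (expR (- V n t))).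
  exact: (measurableT_comp (measurable_ramp M%:R j) (mexp (mV n))).
have r01 j (z : R) : 0 <= ramp M%:R j z <= 1 by rewrite ramp_ge0 ramp_le1.
have hi z : y <= z -> ramp M%:R i z = 1.
  by move=> yz; apply: ramp_eq1; apply: le_trans iy _; rewrite ler_wpM2l.
have lo z : ~ (y <= z) -> ramp M%:R i.+2 z = 0.
  move=> /negP; rewrite -ltNge => zy; apply: ramp_eq0.
  apply: (@le_trans _ _ (M%:R * y)); first by rewrite ler_wpM2l// ltW.
  by rewrite -natr1; lra.
have VE t : (V n t <= x) = (y <= expR (- V n t)) by rewrite ler_expR lerN2.
have u1 := prob_le_Rint P mVx (mVr i) (fun t => r01 i _)
  (fun t h => hi _ (eq_ind _ is_true h _ (VE t))).
have u2 : \int[P]_t ramp M%:R i.+2 (expR (- V n t)) <= fine (P [set t | V n t <= x]).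
  by apply: Rint_le_prob => // t /= h; apply: lo; rewrite -VE.
have u3 : fine (Q [set t | forall p, S p t <= x]) <= \int[Q]_t ramp M%:R i (Y t).
  by apply: prob_le_Rint => // t /= /Y_geP; exact: hi.
have u4 : \int[Q]_t ramp M%:R i.+2 (Y t) <= fine (Q [set t | forall p, S p t <= x]).
  by apply: Rint_le_prob => // t /= h; apply: lo => /Y_geP.
move: h1 h2; rewrite !ler_norml => /andP[h1 h1'] /andP[h2 h2'].
by apply/andP; split; lra.
Unshelve. all: end_near. Qed.

End cdf_convergence.

(** * Uniform distance between the distribution functions *)

Lemma ereal_sup_dist_cvg0 (R : realType) (a : nat -> R -> R) (b : R -> R) :
  (forall eps, 0 < eps -> \forall n \near \oo, forall x, `|a n x - b x| <= eps) ->
  ereal_sup [set `|(a n x)%:E - (b x)%:E|%E | x in [set: R]] @[n --> \oo] --> 0%E.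
Proof.
move=> h; pose D n := ereal_sup [set `|(a n x)%:E - (b x)%:E|%E | x in [set: R]].
have D0 n : (0 <= D n)%E.
  apply: (@le_trans _ _ `|(a n 0)%:E - (b 0)%:E|%E) => //.
  by apply: ereal_sup_ubound; exists 0.
have Dle n eps : (forall x, `|a n x - b x| <= eps) -> (D n <= eps%:E)%E.
  by move=> he; apply: ge_ereal_sup => _ [x _ <-]; rewrite -EFinB lee_fin.
have Dfin n eps : (forall x, `|a n x - b x| <= eps) -> D n \is a fin_num.
  by move=> he; rewrite ge0_fin_numE//; apply: le_lt_trans (Dle _ _ he) (ltry _).
apply/fine_cvgP; split.
  by apply: filterS (h _ ltr01) => n; exact: Dfin.
apply/cvgrPdist_le => eps eps0; apply: filterS (h _ eps0) => n hn.
rewrite sub0r normrN ger0_norm; last exact: (fine_ge0 (D0 n)).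
by rewrite -lee_fin fineK; [exact: Dle|exact: Dfin hn].
Qed.

(** The terms are nonnegative, so the series is the supremum of its partial sums. This replaces the
    extended-real event by countably many real ones. *)
Lemma V_infty_le (R : realType) (T : Type) (lam : nat -> R) (N : nat -> T -> R) t x :
  (forall i, 0 <= lam i) ->
  (V_infty lam N t <= x%:E)%E <-> forall p, \sum_(0 <= j < p) lam j * N j t ^+ 2 <= x.
Proof.
move=> lam0.
have ge0 i : (0 <= (lam i * N i t ^+ 2)%:E)%E by rewrite lee_fin mulr_ge0// sqr_ge0.
split=> [h p|h].
  rewrite -lee_fin -sumEFin; apply: le_trans h.
  exact: (@nneseries_lim_ge _ _ xpredT).
apply: lime_le; first exact: is_cvg_nneseries.
by apply: nearW => p; rewrite /= sumEFin lee_fin.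
Qed.

Section uniform_convergence.
Context (R : realType).
Context (d : measure_display) (T : measurableType d) (P : probability T R).
Context (d' : measure_display) (T' : measurableType d') (Q : probability T' R).
Variables (dim : nat -> nat) (Z : nat -> {RV P >-> l2 R}).
Variables (lam : nat -> R) (N : nat -> {RV Q >-> R}).
Hypothesis dim_infty : dim n @[n --> \oo] --> \oo.
Hypothesis Z_indep : mutually_independent Z.
Hypothesis Z_ident : identically_distributed Z.
Hypothesis Z_centered : is_expectation P (Z 0%N) 0.
Hypothesis iZ : itg P (fun t => `|Z 0%N t| ^+ 2).
Hypothesis N_indep : mutually_independent N.
Hypothesis N_normal : forall i, std_normal (N i).
Variable e : nat -> l2 R.
Local Notation B := (@cov_form _ _ _ P (Z 0%N)).
Hypothesis e_orth : forall i j, l2dot (e i) (e j) = ((i == j) && (lam i != 0))%:R.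
Hypothesis e_eigen : forall i y, B y (e i) = lam i * l2dot y (e i).
Hypothesis e_max : forall x r, r != 0 -> (forall y, B y x = r * l2dot y x) ->
  (forall i, l2dot x (e i) = 0) -> x = 0.
Local Notation S := (weighted_chi_square N lam).

Let lam_ge0 i : 0 <= lam i.
Proof. exact: (eigenvalue_ge0 e_orth e_eigen). Qed.

Lemma measurable_V_stat_le m n x : measurable [set t | V_stat Z m n t <= x].
Proof.
rewrite (_ : [set t | _] = V_stat Z m n @^-1` (`]-oo, x]%classic)).
  by rewrite -[X in measurable X]setTI; apply: measurable_V_stat.
by apply/seteqP; split => t; rewrite /= in_itv.
Qed.

(** The spectral decomposition makes the covariance form vanish, so the nonnegative statistic has
    mean 0 and is almost surely 0. *)
Lemma V_stat_cdf_degenerate m n x : (forall i, lam i = 0) -> 0 <= x ->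
  P [set t | V_stat Z m n t <= x] = 1%E.
Proof.
move=> l0 x0.
have Gam0 v : B v v = 0.
  have h := spectral_decomposition iZ e_orth e_eigen e_max (v := v).
  rewrite -(cvg_lim _ h)//; under eq_fun do under eq_bigr do rewrite l0 mul0r.
  by under eq_fun do rewrite big1_eq; exact: lim_cst.
have [iV Vle] := Rint_V_stat_le Z_indep Z_ident Z_centered iZ m n.
rewrite big1 in Vle; last by move=> k _; exact: Gam0.
have V0 : \int[P]_t V_stat Z m n t = 0.
  by apply/eqP; rewrite eq_le Vle/= Rintegral_ge0// => t _; exact: V_stat_ge0.
have mV := measurable_V_stat Z m n.
have mA := measurable_V_stat_le m n x.
have : ae_eq P setT (EFin \o V_stat Z m n) (cst 0%E).
  apply/ae_eq_integral_abs => //; first exact/measurable_EFinP.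
  under eq_integral do rewrite gee0_abs ?lee_fin ?V_stat_ge0//.
  by rewrite (Rint_EFin iV) V0.
move=> ae; have neg : P (~` [set t | V_stat Z m n t <= x]) = 0%E.
  apply: measure_negligible; first exact: measurableC.
  apply: negligibleS ae => t /= h1 h2; apply: h1.
  by have /= [->] := h2 I.
move: neg; rewrite probability_setC// => h.
have fP : P [set t | V_stat Z m n t <= x] \is a fin_num by exact: fin_num_measure.
by move: h; rewrite -(fineK fP) -EFinB => -[] /eqP; rewrite subr_eq0 => /eqP <-.
Qed.

Lemma V_stat_cdf_cvg eps : 0 < eps -> \forall n \near \oo, forall x,
  `|fine (P [set t | V_stat Z (dim n) n t <= x]) -
    fine (Q [set t | forall p, S p t <= x])| <= eps.
Proof.
move=> eps0; have [l0|/existsNP[i /eqP li]] := pselect (forall i, lam i = 0).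
  (* Here the limit law is an atom at 0, yet uniform convergence holds because both distribution
     functions coincide for every [n]. *)
  apply: nearW => n x; have [x0|x0] := ltP x 0.
    rewrite (_ : [set t | V_stat _ _ _ _ <= x] = set0) ?measure0; last first.
      by apply/seteqP; split => // t /=; have := V_stat_ge0 Z (dim n) n t; lra.
    rewrite (_ : [set t | forall p, S p t <= x] = set0) ?measure0 ?subrr ?normr0 ?ltW//.
    apply/seteqP; split => // t /= /(_ 0%N); rewrite /weighted_chi_square big_geq//; lra.
  rewrite (V_stat_cdf_degenerate _ _ l0 x0).
  rewrite (_ : [set t | forall p, S p t <= x] = setT) ?probability_setT ?subrr ?normr0 ?ltW//.
  apply/seteqP; split => // t _ p; rewrite /weighted_chi_square big1// => j _.
  by rewrite l0 mul0r.
have {}li : 0 < lam i by rewrite lt_neqAle eq_sym li lam_ge0.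
(* The mean of [S p] is at most the total variance, which gives tightness. From [p = i + 1] on, the
   term with [lam i > 0] is present, and [2 / sqrt (lam i)] is the constant of its concentration
   bound. *)
apply: (@cdf_uniform_cvg _ _ _ P _ _ Q _ S _ _ _ _ _ _
  (\int[P]_t `|Z 0%N t| ^+ 2) (2 / Num.sqrt (lam i)) i.+1).
- by move=> n; exact: measurable_V_stat.
- by move=> n t; exact: V_stat_ge0.
- by move=> p t; exact: (weighted_chi_square_ge0 _ e_orth e_eigen).
- move=> p q t pq; rewrite /weighted_chi_square (big_cat_nat _ pq)//= lerDl.
  by apply: sumr_ge0 => j _; rewrite mulr_ge0// sqr_ge0.
- by move=> p; have [] := Rint_weighted_chi_square N_normal lam p.
- move=> s beta s0; exact: (Laplace_limit Z_indep Z_ident Z_centered iZ N_indep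
    N_normal e_orth e_eigen e_max dim_infty s0).
- by apply: Rintegral_ge0 => t _; exact: sqr_ge0.
- by rewrite divr_ge0// sqrtr_ge0.
- move=> p; have [_ ->] := Rint_weighted_chi_square N_normal lam p.
  exact: (trace_le iZ e_orth e_eigen).
- move=> p a b ip ab.
  have := chi_square_concentration N_indep N_normal ip li ab.
  move=> /le_trans; apply.
  rewrite lee_fin sqrtrM ?subr_ge0// sqrtrV ?lam_ge0//.
  by rewrite le_eqVlt; apply/orP; left; apply/eqP; ring.
- exact: eps0.
Qed.

End uniform_convergence.

Theorem proposition3 (R : realType)
  (d : measure_display) (T : measurableType d) (P : probability T R)
  (d' : measure_display) (T' : measurableType d') (Q : probability T' R)
  (dim : nat -> nat) (Z : nat -> {RV P >-> l2 R})
  (lam : nat -> R) (N : nat -> {RV Q >-> R})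
  (dim_infty : dim n @[n --> \oo] --> \oo)
  (Z_indep : mutually_independent Z)
  (Z_ident : identically_distributed Z)
  (Z_centered : is_expectation P (Z 0%N) 0)
  (Z_moment2 : ('E_P[(fun t => `|Z 0%N t| ^+ 2)%R] < +oo)%E)
  (lam_eigen : lists_eigenvalues (cov_matrix P (Z 0%N)) lam)
  (N_indep : mutually_independent N)
  (N_normal : forall i, std_normal (N i)) :
  ereal_sup [set `|P [set t | (V_stat Z (dim n) n t <= x)%R]
                   - Q [set t | V_infty lam N t <= x%:E]|%E | x in [set: R]]
    @[n --> \oo] --> 0%E.
Proof.
have iZ : itg P (fun t => `|Z 0%N t| ^+ 2).
  apply: itg_ge0_lty => [|t|]; last by rewrite unlock in Z_moment2.
    apply: measurable_funX.
    exact: (measurableT_comp (@measurable_l2_norm R) (measurable_funPT (Z 0%N))).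
  exact: sqr_ge0.
have [e [e_orth e_eigen e_max]] := eigenvector_family iZ Z_centered lam_eigen.
have lam0 := eigenvalue_ge0 e_orth e_eigen.
have h := V_stat_cdf_cvg dim_infty Z_indep Z_ident Z_centered iZ N_indep N_normal
  e_orth e_eigen e_max.
have mS x : measurable [set t | forall p, weighted_chi_square N lam p t <= x].
  rewrite (_ : [set t | _] =
      \bigcap_p (weighted_chi_square N lam p @^-1` (`]-oo, x]%classic))).
    apply: bigcapT_measurable => p; rewrite -[X in measurable X]setTI.
    exact: measurable_weighted_chi_square.
  apply/seteqP; split=> t /= ht p; first by move=> _; rewrite /= in_itv/=; exact: ht.
  by have := ht p I; rewrite /= in_itv.
have := ereal_sup_dist_cvg0 h.
rewrite (_ : (fun n => ereal_sup _) = fun n =>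
  ereal_sup [set `|P [set t | (V_stat Z (dim n) n t <= x)%R]
                   - Q [set t | V_infty lam N t <= x%:E]|%E | x in [set: R]]) //.
apply/funext => n; congr ereal_sup.
apply: eq_imagel => x _; rewrite !fineK; first last.
- exact/fin_num_measure/measurable_V_stat_le.
- exact/fin_num_measure/mS.
congr (`|_ - Q _|)%E; apply/seteqP; split=> t /=.
  by move=> ht; apply/(V_infty_le _ _ _ lam0).
by move=> /(V_infty_le _ _ _ lam0).
Qed.
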